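(* Let $n\ge 2$ be an integer. 1. $\eta(C_2^2\oplus C_{2n})=2n+4$ and $\mathsf s(C_2^2\oplus C_{2n})=4n+3$. 2. $\eta(C_2^3\oplus C_{2n})=2n+6$, and if $n\ge 36$, then $\mathsf s(C_2^3\oplus C_{2n})=4n+5$.
   Context: $C_m$ denotes the cyclic group of order $m$, and $C_m^k$ the direct sum of $k$ copies of $C_m$. Groups are finite abelian, written additively; $\exp(G)$ is the exponent of $G$. A sequence over $G$ is a finite unordered sequence of elements of $G$ with repetition allowed (a multiset; an element of the free abelian monoid with basis $G$). Its length is the number of terms counted with multiplicity; a subsequence is a sub-multiset; it is zero-sum if the sum of its terms (with multiplicity) is $0$. The constant $\mathsf s(G)$ is the smallest positive integer $l$ such that every sequence $S$ over $G$ of length $|S|\ge l$ has a zero-sum subsequence $T$ of length $|T|=\exp(G)$. The constant $\eta(G)$ is the smallest positive integer $l$ such that every sequence $S$ over $G$ of length $|S|\ge l$ has a nonempty zero-sum subsequence $T$ of length $1\le |T|\le \exp(G)$. *)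

(* Defs.v *)
From HB Require Import structures.
From mathcomp Require Import all_boot all_order all_algebra all_fingroup
  all_solvable.

Set Implicit Arguments.
Unset Strict Implicit.
Unset Printing Implicit Defensive.

Import GRing.Theory.

(* MathComp equips U * V with its zmodType and finType structures but does not
   declare their join. *)
HB.instance Definition _ (U V : finZmodType) := GRing.Zmodule.on (U * V)%type.

Local Open Scope ring_scope.

(* exponent refers to the finGroupType whose law is the addition of G. *)
Definition exp_of (G : finZmodType) : nat := exponent [set: G].

(* Finite unordered sequences over G are represented by lists.  A sublist
   (subseq) of S selects an arbitrary set of positions, so up to reordering the
   sublists of S are exactly the sub-multisets of S, and neither the length nor
   the sum of a list depends on the order of its terms. *)
Definition zero_sum_subseq (G : finZmodType) (S T : seq G) : Prop :=
  subseq T S /\ \sum_(x <- T) x = 0.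

Definition s_prop (G : finZmodType) (l : nat) : Prop :=
  forall S : seq G, (l <= size S)%N ->
    exists T : seq G, zero_sum_subseq S T /\ size T = exp_of G.

Definition eta_prop (G : finZmodType) (l : nat) : Prop :=
  forall S : seq G, (l <= size S)%N ->
    exists T : seq G, zero_sum_subseq S T /\ (1 <= size T <= exp_of G)%N.

Definition smallest_pos (P : nat -> Prop) (l : nat) : Prop :=
  [/\ (0 < l)%N, P l & forall m : nat, (0 < m)%N -> P m -> (l <= m)%N].

(* s_const G l and eta_const G l read "s(G) = l" and "eta(G) = l"; existence of
   the constant is part of the assertion, and its uniqueness is immediate. *)
Definition s_const (G : finZmodType) (l : nat) : Prop :=
  smallest_pos (s_prop G) l.

Definition eta_const (G : finZmodType) (l : nat) : Prop :=
  smallest_pos (eta_prop G) l.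

(* Main.v *)
Require Import Defs.
From mathcomp Require Import all_boot all_order all_algebra all_fingroup
  all_solvable.
From mathcomp Require Import zify.

Set Implicit Arguments.
Unset Strict Implicit.
Unset Printing Implicit Defensive.

Import GRing.Theory.
Local Open Scope ring_scope.

(* Let G = C_2^r + C_2n and let E = 2G be cyclic of order n, so that G / E is C_2^(r+1).
   A block, that is a sequence of terms whose classes mod E add up to 0, has its sum in E.

   For s: two terms of one class form a pair, a block of length 2.  A sequence of
   4n + 2r - 1 terms contains about 2n disjoint pairs.  If no n of them have sum 0, the
   inverse Erdos-Ginzburg-Ziv theorem over E shows that, after a translation, most pairs
   have sum 0 or h for one generator h of E.  Padding any further block of 2m terms with
   such pairs to the length 2n leaves few possible values for its sum.  In the leftover
   terms, which lie in distinct classes, blocks of 4 terms must have sum h and blocks of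
   6 terms sum h or 2h.  The classes are points of F_2^4, and these linear relations force
   4x = h for nearly all leftover terms x; exchanging a pair with leftover terms
   contradicts this.

   For eta, r = 3: the terms in E, the sums of pairs and the sums of disjoint blocks of
   leftover terms together form a zero-sum free sequence over E as long as at most 2n
   terms are involved.  When its length is nearly n it is nearly constant, which again
   fixes the sums of the lines and planes formed by the classes of the leftover terms.

   For eta, r = 2: adjoining 2n - 1 zeros gives eta <= s - 2n + 1. *)

(** Adjoining zeros to the bound for s would give eta with r = 3 only for n >= 36; the separate
    argument for eta is organised by the deficit d between n and the number of values in E supplied
    by single terms and pairs. For s with r = 2 the inverse theorem is met in its extremal case and
    all pair values are known. For r = 3 boundedly many of them stay uncontrolled: they are absorbed
    into two blocks, and a potential bounded by 2n - 2 shows that only boundedly many improvements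
    are possible, each at the cost of at most two pairs. Pairs and blocks use at most 4n - 4 terms,
    so nine classes are left over. Nine is critical: a tenth point makes the relations
    contradictory, while nine points allow one exception to 4x = h. Hence all pairs lie in the
    exceptional class, where they can be regrouped at will. The configurations of points are
    enumerated by computation, which is feasible because an affine change of coordinates first puts
    a plane of the complement in a fixed position. *)

(** * Zero-sum free sequences over cyclic groups *)

(* The cardinals and counts to be identified may differ in the inferred instances. *)
Ltac clia := repeat match goal with
  | H : is_true (leq _ _) |- _ => revert H
  | H : @eq nat _ _ |- _ => revert H
  end; repeat match goal with
  | |- context [#|?x|] => move: #|x| => ?
  | |- context [count ?p ?s] => move: (count p s) => ?
  | |- context [size ?s] => move: (size s) => ?
  end; lia.

Section SumSets.
Variable G : finZmodType.
Implicit Types (A B E : {set G}) (R S T U W : seq G) (x y : G).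

Definition sumset A B : {set G} := [set x + y | x in A, y in B].

Lemma sumsetP A B x :
  reflect (exists a b, [/\ a \in A, b \in B & x = a + b]) (x \in sumset A B).
Proof.
apply: (iffP imset2P) => [[a b Aa Bb ->]|[a [b [Aa Bb ->]]]]; first by exists a, b.
by exists a b.
Qed.

(* Dyson's transform: move the b with a + b outside A from B to A. *)
Lemma scherk A B : 0 \in A -> 0 \in B ->
    (forall a b, a \in A -> b \in B -> a + b = 0 -> a = 0 /\ b = 0) ->
  (#|A| + #|B| <= #|sumset A B| + 1)%N.
Proof.
have [m] := ubnP #|B|; elim: m => // m IHm in A B * => ltBm A0 B0 uAB.
have subA : A \subset sumset A B.
  by apply/subsetP=> a Aa; apply/sumsetP; exists a, 0; rewrite addr0.
have [/set0Pn[b]|] := boolP (B :\ 0 != set0); last first.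
  rewrite negbK => /eqP B1; rewrite [#|B|](cardsD1 0) B0 B1 cards0 addn0.
  by rewrite leq_add2r subset_leq_card.
rewrite !inE => /andP[b0 Bb].
(* If [A + b] were inside [A], translation by [b] would permute [A], and 0 = x + b with x in [A]
   would contradict [uAB], as [b] is nonzero. *)
have [a Aa nAab] : exists2 a, a \in A & a + b \notin A.
  have [/exists_inP //|] := boolP [exists a in A, a + b \notin A].
  rewrite negb_exists => /forallP clA.
  have/eqP im : [set x + b | x in A] == A.
    rewrite eqEcard card_imset ?leqnn ?andbT; last exact: addIr.
    by apply/subsetP=> _ /imsetP[x Ax ->]; have := clA x; rewrite Ax negbK.
  move: A0; rewrite -{1}im => /imsetP[x Ax e0].
  by have [_ be] := uAB x b Ax Bb (esym e0); rewrite be eqxx in b0.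
pose B' := [set y in B | a + y \notin A].
have B'b : b \in B' by rewrite inE Bb.
have subB : B' \subset B by apply/subsetP=> y; rewrite inE => /andP[].
have B'0 : 0 \notin B' by rewrite inE addr0 Aa andbF.
pose A' := A :|: [set a + y | y in B'].
have cA' : #|A'| = (#|A| + #|B'|)%N.
  rewrite cardsU (_ : A :&: _ = set0) ?cards0 ?subn0.
    by rewrite card_imset //; exact: addrI.
  apply/setP=> x; rewrite !inE; apply/negP=> /andP[Ax /imsetP[y]].
  by rewrite inE => /andP[_ nA] ex; rewrite -ex Ax in nA.
have cB : #|B| = (#|B'| + #|B :\: B'|)%N.
  by rewrite -(cardsID B' B) (setIidPr subB).
have subAB : sumset A' (B :\: B') \subset sumset A B.
  apply/subsetP=> _ /sumsetP[c [d [Ac Bd ->]]].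
  move: Bd; rewrite !inE negb_and negbK => /andP[+ Bd]; rewrite Bd /= => Aad.
  move: Ac; rewrite inE => /orP[Ac|/imsetP[y B'y ->]]; first by apply/sumsetP; exists c, d.
  apply/sumsetP; exists (a + d), y; split=> //; first exact: (subsetP subB).
  by rewrite addrAC.
have := IHm A' (B :\: B'); rewrite cA'.
have ltB' : (#|B :\: B'| < m)%N.
  have : (0 < #|B'|)%N by apply/card_gt0P; exists b.
  rewrite cB in ltBm. lia.
move=> /(_ ltB'); rewrite !inE A0 B0 negb_and negbK addr0 Aa /= => /(_ isT isT).
have H : forall c d, c \in A' -> d \in B :\: B' -> c + d = 0 -> c = 0 /\ d = 0.
  move=> c d Ac; rewrite !inE negb_and negbK => /andP[+ Bd]; rewrite Bd /= => Aad.
  move: Ac; rewrite inE => /orP[Ac|/imsetP[y B'y ->]]; first exact: uAB.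
  rewrite addrAC => e0; have [_ y0] := uAB _ _ Aad (subsetP subB _ B'y) e0.
  by rewrite -y0 B'y in B'0.
move=> /(_ H); move: (subset_leq_card subAB); rewrite cB; clia.
Qed.

(* The subset sums of R, the empty one included. *)
Fixpoint ssums R : {set G} :=
  if R is x :: R' then ssums R' :|: [set x + y | y in ssums R'] else [set 0].

Lemma ssumsP R x :
  reflect (exists2 T, subseq T R & \sum_(y <- T) y = x) (x \in ssums R).
Proof.
elim: R x => [|y R IHR] x /=.
  rewrite inE; apply: (iffP eqP) => [->|[T]]; first by exists [::]; rewrite ?big_nil.
  by rewrite /= => /eqP -> <-; rewrite big_nil.
rewrite inE; apply: (iffP orP) => [[/IHR[T sT <-]|/imsetP[z /IHR[T sT <-] ->]]|[T sT <-]].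
- by exists T => //; exact: subseq_trans sT (subseq_cons _ _).
- by exists (y :: T); rewrite /= ?eqxx // big_cons.
- case: T sT => [|z T] /=; first by left; apply/IHR; exists [::]; rewrite ?sub0seq.
  have [->|_] := eqVneq z y => sT; last by left; apply/IHR; exists (z :: T).
  by right; apply/imsetP; exists (\sum_(i <- T) i); [apply/IHR; exists T | rewrite big_cons].
Qed.

Lemma ssums0 R : 0 \in ssums R.
Proof. by apply/ssumsP; exists [::]; rewrite ?sub0seq ?big_nil. Qed.

(** Parts are halves of a reordering of [R], not sublists: the notion is then invariant under
    permutation, and the complement [W] has a name. *)
Definition zsf R := forall T W, perm_eq (T ++ W) R -> T <> [::] -> \sum_(x <- T) x != 0.

Lemma zsf_perm R R' : perm_eq R R' -> zsf R -> zsf R'.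
Proof. by move=> p zR T W pT; apply: (zR T W); rewrite (perm_trans pT) // perm_sym. Qed.

Lemma zsf_catl R R' : zsf (R ++ R') -> zsf R.
Proof.
move=> zR T W pT; apply: (zR T (W ++ R')).
by rewrite catA perm_cat2r.
Qed.

Lemma zsf_catr R R' : zsf (R ++ R') -> zsf R'.
Proof. by move=> zR; apply: (@zsf_catl R' R); apply: zsf_perm zR; rewrite perm_catC. Qed.

Lemma zsf_neq0 R x : zsf R -> x \in R -> x != 0.
Proof.
move=> zR Rx; have := zR [:: x] (rem x R); rewrite big_seq1; apply=> //.
by rewrite perm_sym perm_to_rem.
Qed.

Lemma zsf_subseq R T : zsf R -> subseq T R -> T <> [::] -> \sum_(x <- T) x != 0.
Proof. by move=> zR /perm_to_subseq[W pW] T0; apply: (zR T W) => //; rewrite perm_sym. Qed.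

Lemma ssums_cat R R' : ssums (R ++ R') = sumset (ssums R) (ssums R').
Proof.
apply/setP=> x; apply/ssumsP/sumsetP => [[T sT <-]|[a [b [/ssumsP[T sT <-] /ssumsP[T' sT' <-] ->]]]].
  move: sT => /subseqP[m sm ->].
  exists (\sum_(y <- mask (take (size R) m) R) y), (\sum_(y <- mask (drop (size R) m) R') y).
  split; [by apply/ssumsP; exists (mask (take (size R) m) R); rewrite ?mask_subseq| |].
    by apply/ssumsP; exists (mask (drop (size R) m) R'); rewrite ?mask_subseq.
  rewrite -big_cat -mask_cat ?cat_take_drop //.
  by rewrite size_takel // sm size_cat leq_addr.
by exists (T ++ T'); rewrite ?cat_subseq // big_cat.
Qed.

(** Freeness of the concatenation means that 0 splits in only one way between the two sets of subset
    sums, which is the hypothesis of [scherk]. *)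
Lemma card_ssums_cat R R' : zsf (R ++ R') ->
  (#|ssums R| + #|ssums R'| <= #|ssums (R ++ R')| + 1)%N.
Proof.
move=> zR; rewrite ssums_cat; apply: scherk; rewrite ?ssums0 //.
move=> a b /ssumsP[T sT <-] /ssumsP[T' sT' <-] e0.
have [TT|/eqP TT] := eqVneq (T ++ T') [::]; last first.
  by have := zsf_subseq zR (cat_subseq sT sT') TT; rewrite big_cat /= e0 eqxx.
by case: T T' TT {e0 sT sT'} => [|? ?] [|? ?] //; rewrite big_nil.
Qed.

Lemma card_ssums R : zsf R -> (size R < #|ssums R|)%N.
Proof.
elim: R => [|x R IHR] zR; first by rewrite cards1.
have zR' : zsf R by apply: (@zsf_catr [:: x]).
have := @card_ssums_cat [:: x] R zR; rewrite /= imset_set1 addr0 cards2 eq_sym.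
rewrite (zsf_neq0 zR) ?mem_head //; have := IHR zR'; clia.
Qed.

Definition fl (P : seq (G * G)) := flatten [seq [:: p.1; p.2] | p <- P].

(** Two distinct terms have the four subset sums 0, x, y, x + y, so a pair adds 3 to the bound
    instead of 2. *)
Lemma card_ssums_pairs P R : all (fun p => p.1 != p.2) P -> zsf (fl P ++ R) ->
  (3 * size P + size R < #|ssums (fl P ++ R)|)%N.
Proof.
elim: P => [|[x y] P IHP] /= => [_|/andP[nxy dP] zR]; first by rewrite add0n; exact: card_ssums.
have zR' := @zsf_catr [:: x; y] _ zR; have := IHP dP zR'.
have := @card_ssums_cat [:: x; y] (fl P ++ R) zR.
have x0 := zsf_neq0 zR (mem_head _ _).
have y0 : y != 0 by apply: (zsf_neq0 zR); rewrite !inE eqxx orbT.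
have xy0 : x + y != 0.
  by have := @zsf_subseq _ [:: x; y] zR; rewrite big_cons big_seq1 /= !eqxx sub0seq; apply.
suff -> : #|ssums [:: x; y]| = 4 by rewrite /=; clia.
have e : ssums [:: x; y] =i [:: 0; y; x; x + y].
  by move=> z; rewrite /= !imset_set1 !imsetU !imset_set1 !inE !addr0 -!orbA.
rewrite (eq_card e); apply/eqP; rewrite -[_ == _]/(_ == size [:: 0; y; x; x + y]).
apply/eqP/card_uniqP; rewrite /= !inE !negb_or !(eq_sym 0) x0 y0 xy0 (eq_sym y x) nxy /=.
by rewrite -{1}[y]add0r (inj_eq (addIr _)) eq_sym x0 -{1}[x]addr0 (inj_eq (addrI _)) eq_sym y0.
Qed.

End SumSets.

Arguments ssums : simpl never.

Lemma count_le_part (T : eqType) (R S : seq T) :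
  (forall x, (count_mem x R <= count_mem x S)%N) -> exists W, perm_eq (R ++ W) S.
Proof.
move=> /count_subseqP[R' /perm_to_subseq[W pW] pR]; exists W.
by rewrite (perm_trans _ (_ : perm_eq (R' ++ W) S)) ?perm_cat2r // perm_sym.
Qed.

Lemma count_part (T : eqType) (R W S : seq T) (p : pred T) :
  perm_eq (R ++ W) S -> (count p R + count p W)%N = count p S.
Proof. by move/seq.permP/(_ p); rewrite count_cat. Qed.

(** * Short zero-sum parts of sequences with bounded multiplicities *)

Section Layers.
Variables (G : finZmodType) (E : {set G}).
Implicit Types (R S T U W : seq G) (x y : G).
Hypothesis E0 : 0 \in E.
Hypothesis ED : forall x y, x \in E -> y \in E -> x + y \in E.

Lemma sumE T : {subset T <= E} -> \sum_(x <- T) x \in E.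
Proof.
by move=> sT; rewrite big_seq; apply: (big_ind (fun x => x \in E)).
Qed.

Lemma ssumsE R : {subset R <= E} -> ssums R \subset E.
Proof.
move=> sR; apply/subsetP=> _ /ssumsP[T sT <-].
by apply: sumE => x /(mem_subseq sT)/sR.
Qed.

Lemma sum_count_mem U : (\sum_(x : G) count_mem x U)%N = size U.
Proof.
elim: U => [|y U IHU] /=; first by rewrite big1.
rewrite big_split /= IHU (bigD1 y) //= eqxx big1 ?addn0 // => x.
by rewrite eq_sym => /negPf->.
Qed.

(* The layers {x | i < count x U}, i < h, have total size |U|, and picking at most
   one element from each of them selects a part of U. *)
Lemma short_zero_sum U h : {subset U <= E} -> 0 \notin U ->
    (forall x, (count_mem x U <= h)%N) -> (#|E| <= size U)%N ->
  exists T W, [/\ perm_eq (T ++ W) U, (0 < size T <= h)%N & \sum_(x <- T) x = 0].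
Proof.
move=> sU U0 leh leEU; pose A i : {set G} := [set x | (i < count_mem x U)%N].
set P := exists T W, _.
(* [C] collects sums using at most one term from each of the first [t] layers. The layer [A t]
   either cancels an element of [C], which gives the part sought, or enlarges [C] by its full size
   through [scherk]. *)
have claim t : (t <= h)%N -> P \/ exists C : {set G}, [/\ 0 \in C, C \subset E,
    forall c, c \in C -> exists T, [/\ forall x, (count_mem x T <= minn t (count_mem x U))%N,
      (size T <= t)%N & \sum_(x <- T) x = c]
    & (1 + \sum_(i < t) #|A i| <= #|C|)%N].
  elim: t => [_|t IHt lt].
    right; exists [set 0]; rewrite inE eqxx sub1set E0 big_ord0 cards1; split=> // c.
    by rewrite inE => /eqP->; exists [::]; rewrite big_nil.
  case: (IHt (ltnW lt)) => [|[C [C0 sC CT leC]]]; first by left.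
  have ext c b : c \in C -> b \in A t -> exists T,
      [/\ forall x, (count_mem x T <= minn t.+1 (count_mem x U))%N,
        (0 < size T <= t.+1)%N & \sum_(x <- T) x = c + b].
    move=> Cc Ab; have [T [cT szT <-]] := CT c Cc; exists (b :: T).
    rewrite big_cons addrC; split=> // x /=.
    have := cT x; move: Ab; rewrite inE; have [->|_] := eqVneq b x; clia.
  have [/exists_inP[c Cc /exists_inP[b Ab /eqP cb0]]|nex] :=
    boolP [exists c in C, [exists b in A t, c + b == 0]].
    left; have [T [cT szT sT]] := ext c b Cc Ab.
    have [|W pW] := @count_le_part _ T U; first by move=> x; have := cT x; clia.
    exists T, W; split; [by [] | | by rewrite sT].
    by case/andP: szT => -> /leq_trans->.
  right; exists (sumset C (0 |: A t)).
  have AE x : x \in A t -> x \in E.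
    by rewrite inE => /(leq_ltn_trans (leq0n _)); rewrite -has_count has_pred1 => /sU.
  have At0 : 0 \notin A t.
    by rewrite inE (count_memPn U0).
  split.
  - by apply/sumsetP; exists 0, 0; rewrite !inE eqxx addr0.
  - apply/subsetP=> _ /sumsetP[c [b [Cc + ->]]]; rewrite !inE => /orP[/eqP->|Ab].
      by rewrite addr0 (subsetP sC).
    by apply: ED; [exact: (subsetP sC) | apply: AE; rewrite inE].
  - move=> _ /sumsetP[c [b [Cc + ->]]]; rewrite in_setU1 => /orP[/eqP->|Ab].
      have [T [cT szT sT]] := CT c Cc; exists T; rewrite addr0; split=> //; last exact: leqW.
      by move=> x; have := cT x; clia.
    by have [T [cT szT sT]] := ext c b Cc Ab; case/andP: szT; exists T.
  - have := @scherk _ C (0 |: A t) C0; rewrite cardsU1 At0 setU11 big_ord_recr /=.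
    move=> /(_ isT)=> sch.
    suff H : forall a b, a \in C -> b \in 0 |: A t -> a + b = 0 -> a = 0 /\ b = 0.
      by move: (sch H) leC; move: (\sum_(i < t) _)%N => ?; clia.
    move=> a b Ca; rewrite in_setU1 => /orP[/eqP->|Ab]; first by rewrite addr0.
    move=> ab0; case/negP: nex; apply/exists_inP; exists a => //.
    by apply/exists_inP; exists b => //; apply/eqP.
(* No layer lies beyond [h], and the sizes of the layers add up to |U|, so [C] would have more than
   |E| elements. *)
case: (claim h (leqnn h)) => // -[C [_ sC _ leC]]; exfalso.
move: (subset_leq_card sC) leC.
suff -> : (\sum_(i < h) #|A i|)%N = size U by move: leEU; clia.
rewrite -sum_count_mem; transitivity (\sum_(i < h) \sum_(x : G) (i < count_mem x U))%N.
  by apply: eq_bigr => i _; rewrite -sum1_card big_mkcond; apply: eq_bigr => x _; rewrite inE; case: ifP.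
rewrite exchange_big /=; apply: eq_bigr => x _.
rewrite -(big_mkord xpredT (fun i => (i < count_mem x U) : nat)) (big_cat_nat (n := count_mem x U)) //=.
rewrite (eq_big_nat _ _ (F2 := fun=> 1%N)); last by move=> i; lia.
rewrite [X in (_ + X)%N]big1_seq ?addn0 ?sum_nat_const_nat; first by lia.
by move=> i /=; rewrite mem_index_iota; lia.
Qed.

End Layers.

Lemma filter_pred1 (T : eqType) (R : seq T) g :
  [seq x <- R | x == g] = nseq (count_mem g R) g.
Proof. by rewrite -size_filter; apply/all_pred1P; exact: filter_all. Qed.

(** * Structure of long zero-sum free sequences *)

Section ZeroSumFree.
Variables (G : finZmodType) (E : {set G}).
Implicit Types (R S T U W P : seq G) (x y g : G).
Hypothesis E0 : 0 \in E.
Hypothesis ED : forall x y, x \in E -> y \in E -> x + y \in E.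
Local Notation n := #|E|.
Hypothesis nE : forall x, x \in E -> x *+ n = 0.

Lemma ssums_perm R R' : perm_eq R R' -> ssums R = ssums R'.
Proof.
suff sub S S' : perm_eq S S' -> ssums S \subset ssums S'.
  by move=> p; apply/eqP; rewrite eqEsubset !sub // perm_sym.
move=> pS; apply/subsetP=> _ /ssumsP[T sT <-]; apply/ssumsP.
have [|T' sT' pT] := (count_subseqP T S').1.
  by move=> x; rewrite -(seq.permP pS) leq_count_subseq.
by exists T' => //; apply: perm_big; rewrite perm_sym.
Qed.

Lemma gt0E : (0 < n)%N. Proof. by apply/card_gt0P; exists 0. Qed.

Lemma size_zsf R : {subset R <= E} -> zsf R -> (size R < n)%N.
Proof. by move=> sR /card_ssums/leq_trans; apply; exact/subset_leq_card/ssumsE. Qed.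

Lemma zsf_two R x y : zsf R -> x \in R -> y \in R -> x != y ->
  (size R + 2 <= #|ssums R|)%N.
Proof.
move=> zR Rx Ry nxy; have pR := perm_to_rem Rx.
have Ry' : y \in rem x R by move: Ry; rewrite (perm_mem pR) inE eq_sym (negPf nxy).
have pR2 : perm_eq R [:: x, y & rem y (rem x R)].
  by rewrite (perm_trans pR) // perm_cons perm_to_rem.
have : (3 * 1 + size (rem y (rem x R)) < #|ssums [:: x, y & rem y (rem x R)]|)%N.
  apply: (@card_ssums_pairs _ [:: (x, y)]); first by rewrite /= nxy.
  exact: zsf_perm pR2 zR.
by rewrite -(ssums_perm pR2) (perm_size pR2) /=; clia.
Qed.

Lemma zsf_const R : zsf R -> (#|ssums R| < size R + 2)%N ->
  exists g, R = nseq (size R) g.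
Proof.
case: R => [|g R] zR ltR; first by exists 0.
exists g; apply/all_pred1P/allP=> x Rx; apply/negPn/negP=> /= nx.
by have := zsf_two zR Rx (mem_head _ _) nx; rewrite leqNgt ltR.
Qed.

Lemma zsf_max R : {subset R <= E} -> zsf R -> (n <= (size R).+1)%N ->
  exists g, R = nseq (size R) g.
Proof.
move=> sR zR leR; apply: zsf_const => //.
by have := subset_leq_card (ssumsE E0 ED sR); move: leR; clia.
Qed.

Lemma sum_nseq m g : \sum_(x <- nseq m g) x = g *+ m.
Proof. by rewrite big_nseq -Monoid.iteropE. Qed.

Lemma zsf_nseq m g j : zsf (nseq m g) -> (0 < j <= m)%N -> g *+ j != 0.
Proof.
move=> z /andP[j0 lej]; rewrite -sum_nseq; apply: (z _ (nseq (m - j) g)).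
  by rewrite -nseqD subnKC.
by case: j j0 {lej}.
Qed.

Definition gen g := g \in E /\ forall j, (0 < j < n)%N -> g *+ j != 0.

(** The order of g divides n and exceeds m; since n < 2 (m + 1), it is n itself. *)
Lemma gen_large g m : g \in E -> (forall j, (0 < j <= m)%N -> g *+ j != 0) ->
  (n < 2 * m.+1)%N -> gen g.
Proof.
move=> Eg gm ltn; split=> // j0 /andP[j00 ltj0]; apply/negP=> /eqP gj0.
have ex : exists j, (0 < j)%N && (g *+ j == 0) by exists j0; rewrite j00 gj0 eqxx.
case: (ex_minnP ex) => j /andP[j0' /eqP gj] minj.
have lej : (j <= j0)%N by apply: minj; rewrite j00 gj0 eqxx.
have mj : (n %% j = 0)%N.
  apply/eqP; rewrite -leqn0 leqNgt; apply/negP=> r0.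
  have : (j <= n %% j)%N.
    apply: minj; rewrite r0 /=; have := nE Eg; rewrite {1}(divn_eq n j).
    by rewrite mulrnDr mulnC mulrnA gj mul0rn add0r => ->.
  by rewrite leqNgt ltn_pmod.
have /dvdnP[q eq] : (j %| n)%N by rewrite /dvdn mj.
have q2 : (2 <= q)%N by case: q eq => [|[|q]]; have := gt0E; lia.
have : (j <= m)%N by have := leq_mul q2 (leqnn j); lia.
by move=> lejm; have := gm j; rewrite j0' lejm gj eqxx => /(_ isT).
Qed.

Lemma genP g x : gen g -> x \in E -> exists2 j, (j < n)%N & x = g *+ j.
Proof.
move=> [Eg gg] Ex; pose f (i : 'I_n) := g *+ i.
have fE i : f i \in E.
  by rewrite /f; elim: (nat_of_ord i) => [|k IHk]; rewrite ?mulr0n // mulrSr ED.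
have finj : injective f.
  suff H (i j : 'I_n) : (i < j)%N -> f i != f j.
    move=> i j fij; have [/H|/H|] := ltngtP (i : nat) j; last exact: val_inj.
      by rewrite fij eqxx.
    by rewrite fij eqxx.
  move=> lij; rewrite /f -(subnK (ltnW lij)) mulrnDr eq_sym -subr_eq0 addrK.
  by apply: gg; rewrite subn_gt0 lij /= (leq_ltn_trans (leq_subr _ _)).
have : x \in [set f i | i : 'I_n].
  suff -> : [set f i | i : 'I_n] = E by [].
  apply/eqP; rewrite eqEcard card_imset // card_ord leqnn andbT.
  by apply/subsetP=> _ /imsetP[i _ ->].
by case/imsetP=> i _ ->; exists i.
Qed.

Lemma gen_eq0 g j : gen g -> (g *+ j == 0) = (n %| j)%N.
Proof.
move=> [Eg gg]; rewrite {1}(divn_eq j n) mulrnDr mulnC mulrnA nE // mul0rn add0r.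
have := ltn_pmod j gt0E; rewrite /dvdn; case: (j %% n)%N => [|r] ltr; first by rewrite mulr0n !eqxx.
by rewrite (negPf (gg r.+1 _)).
Qed.

(** If j + m were at least n, then [v] and n - j copies of [g] would have sum 0. *)
Lemma zsf_cons_nseq g v m : gen g -> v \in E -> zsf (v :: nseq m g) ->
  exists2 j, (0 < j /\ j + m < n)%N & v = g *+ j.
Proof.
move=> gg Ev z; have [j ltj ev] := genP gg Ev; exists j => //.
have v0 := zsf_neq0 z (mem_head _ _).
case: j ltj ev => [|j] ltj ev; first by rewrite ev mulr0n eqxx in v0.
split=> //; rewrite ltnNge; apply/negP=> lenm.
have := z (v :: nseq (n - j.+1) g) (nseq (m - (n - j.+1)) g).
rewrite /= -nseqD subnKC; last by rewrite leq_subLR.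
move=> /(_ (perm_refl _)); rewrite big_cons sum_nseq ev -mulrnDr subnKC; last exact: (ltnW ltj).
case: gg => Eg _; rewrite nE // eqxx => H; apply: notF; exact: H.
Qed.

(** Pair distinct terms until only copies of one term g remain. By [card_ssums_pairs] there are
    fewer than k pairs, so g is in the majority. Then all other terms can be paired with copies of
    g, and the same bound shows that there are fewer than k of them. *)
Lemma zsf_mult R k : {subset R <= E} -> zsf R -> (n <= size R + k)%N -> (5 * k <= n)%N ->
  (0 < k)%N -> exists g, (n + 1 <= count_mem g R + 2 * k)%N.
Proof.
move=> sR zR leR le5 k0.
have [P [r [g [nP pR]]]] : exists (P : seq (G * G)) r g,
    all (fun p => p.1 != p.2) P /\ perm_eq R (fl P ++ nseq r g).
  have [m] := ubnP (size R); elim: m {sR zR leR} R => // m IHm R ltR.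
  case: R ltR => [|x R] ltR; first by exists [::], 0%N, 0.
  have [/allP cR|/allPn[y Ry nyx]] := boolP (all (pred1 x) R).
    exists [::], (size R).+1, x; split=> //=; rewrite perm_cons.
    by rewrite (all_pred1P _ _ (introT allP cR)) size_nseq.
  have pR := perm_to_rem Ry.
  have [|P [r [g [nP pP]]]] := IHm (rem y R).
    by have := perm_size pR; move: ltR => /=; lia.
  exists ((x, y) :: P), r, g; rewrite /= eq_sym nyx; split=> //.
  by rewrite perm_cons (perm_trans pR) // perm_cons.
have lts := leq_trans (card_ssums_pairs nP (zsf_perm pR zR)).
have {}lts : (3 * size P + size (nseq r g) < n)%N.
  by apply: lts; rewrite -(ssums_perm pR); exact/subset_leq_card/ssumsE.
have szfl (Q : seq (G * G)) : size (fl Q) = (2 * size Q)%N.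
  by elim: Q => //= p Q IHQ; rewrite IHQ; lia.
have szR := perm_size pR; rewrite size_cat szfl size_nseq in szR lts.
set v := count_mem g R.
have lev : (r <= v)%N.
  by rewrite /v (seq.permP pR) count_cat count_nseq /= eqxx mul1n leq_addl.
pose O := [seq x <- R | x != g].
have szO : (v + size O = size R)%N.
  by rewrite -(count_predC (pred1 g) R) size_filter.
pose Q := [seq (x, g) | x <- O].
have nQ : all (fun p => p.1 != p.2) Q.
  by apply/allP=> _ /mapP[x + ->]; rewrite mem_filter => /andP[].
(* Here 5 k <= n ensures that there are enough copies of g for all terms of [O]. *)
have pQ : perm_eq R (fl Q ++ nseq (v - size O) g).
  have pO : perm_eq (fl Q) (O ++ nseq (size O) g).
    rewrite /Q; elim: (O) => //= x O' IHO; rewrite perm_cons.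
    by apply/seq.permP=> p; move/seq.permP/(_ p): IHO; rewrite /= !count_cat /=; clia.
  rewrite perm_sym (perm_trans (perm_cat pO (perm_refl _))) // -catA -nseqD subnKC; last first.
    move: lev szO szR lts leR le5; move: (v) (size O) (size R) (size P) => ? ? ? ?; clia.
  by rewrite /v -filter_pred1 perm_catC; apply/permPl; exact: perm_filterC.
have := leq_trans (card_ssums_pairs nQ (zsf_perm pQ zR)) (_ : _ <= n)%N.
rewrite -(ssums_perm pQ) => /(_ (subset_leq_card (ssumsE E0 ED sR))).
rewrite size_map size_nseq => H; exists g; rewrite -/v; move: H szO leR le5; move: (v) (size O) (size R) => ? ? ?; clia.
Qed.

End ZeroSumFree.

Lemma zsf_dec (G : finZmodType) (R : seq G) :
  zsf R \/ exists T W, [/\ perm_eq (T ++ W) R, T <> [::] & \sum_(x <- T) x = 0].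
Proof.
pose ok (m : (size R).-tuple bool) := (mask m R != [::]) && (\sum_(x <- mask m R) x == 0).
have [/existsP[m /andP[/eqP m0 /eqP sm]]|/existsPn nex] := boolP [exists m, ok m].
  right; have [W pW] := perm_to_subseq (mask_subseq m R).
  by exists (mask m R), W; split=> //; rewrite perm_sym.
left=> T W pT T0; apply/negP=> /eqP sT.
have [|T' /subseqP[m szm eT'] pTT'] := (count_subseqP T R).1.
  by move=> x; rewrite -(count_part _ pT) leq_addr.
have sz : size m == size R by rewrite szm.
have := nex (Tuple sz); rewrite /ok /= -eT' -(perm_big _ pTT') sT eqxx andbT negbK.
by move=> /eqP T'0; move: pTT'; rewrite T'0 => /perm_nilP.
Qed.

(** * An inverse Erdos-Ginzburg-Ziv theorem *)

Section InverseEGZ.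
Variables (G : finZmodType) (E : {set G}).
Implicit Types (R S T U W P : seq G) (x y g : G).
Hypothesis E0 : 0 \in E.
Hypothesis ED : forall x y, x \in E -> y \in E -> x + y \in E.
Local Notation n := #|E|.
Hypothesis nE : forall x, x \in E -> x *+ n = 0.

Lemma EMn x m : x \in E -> x *+ m \in E.
Proof. by move=> Ex; elim: m => [|m IHm]; rewrite ?mulr0n // mulrSr ED. Qed.

Lemma EN x : x \in E -> - x \in E.
Proof.
move=> Ex; have := nE Ex; rewrite -(prednK (gt0E E0)) mulrS => /eqP.
by rewrite addrC addr_eq0 => /eqP <-; exact: EMn.
Qed.

Lemma EB x y : x \in E -> y \in E -> x - y \in E.
Proof. by move=> Ex Ey; rewrite ED ?EN. Qed.

(* Shift a most frequent term p to 0, with multiplicity h.  A zero-sum part of the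
   remaining terms of length at least n - h could be shortened to a length between
   n - h and n and completed by zeros; so after removing a longest one more than
   n - k - 1 terms are left, and they are zero-sum free. *)
Lemma egz_inverse P k : {subset P <= E} -> (size P + k + 1 = 2 * n)%N -> (k < n)%N ->
    (forall T W, perm_eq (T ++ W) P -> size T = n -> \sum_(x <- T) x != 0) ->
  exists p h R W, [/\ p \in E, perm_eq P (nseq h p ++ [seq r + p | r <- R] ++ W),
    zsf R, {subset R <= E} & (n <= size R + k)%N /\ forall x, (count_mem x P <= h)%N].
Proof.
move=> sP szP ltk nz; pose p := [arg max_(x > 0) count_mem x P]; pose h := count_mem p P.
have leh x : (count_mem x P <= h)%N by rewrite /h /p; case: arg_maxnP => // y _; apply.
have n0 := gt0E E0.
have Pp : p \in P.
  have [x Px] : exists x, x \in P.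
    by case: (P) szP => [|x P'] szP; [exfalso; move: szP => /=; clia | exists x; rewrite mem_head].
  by rewrite -has_pred1 has_count (leq_trans _ (leh x)) // -has_count has_pred1.
have Ep := sP p Pp.
pose Q := [seq x <- P | x != p]; pose T0 := [seq x - p | x <- Q].
have pP : perm_eq P (nseq h p ++ Q).
  by rewrite perm_sym /h -filter_pred1; apply/permPl; exact: perm_filterC.
have T0p : [seq r + p | r <- T0] = Q.
  by rewrite -map_comp -[RHS]map_id; apply: eq_map => x /=; rewrite subrK.
have szT0 : (h + size T0 = size P)%N by rewrite size_map (perm_size pP) size_cat size_nseq.
have sT0 : {subset T0 <= E}.
  by move=> _ /mapP[x + ->]; rewrite mem_filter => /andP[_ Px]; rewrite EB // sP.
have T0n0 : 0 \notin T0.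
  apply/negP=> /mapP[x]; rewrite mem_filter => /andP[nx _] /eqP.
  by rewrite eq_sym subr_eq0 (negPf nx).
have cT0 x : (count_mem x T0 <= h)%N.
  apply: leq_trans (leh (x + p)); rewrite count_map.
  rewrite (eq_count (a2 := pred1 (x + p))); last by move=> y /=; rewrite subr_eq.
  by rewrite /Q count_filter; apply: sub_count => y /andP[].
have big U W : perm_eq (U ++ W) T0 -> \sum_(x <- U) x = 0 -> (size U < n - h)%N.
  have [m] := ubnP (size U); elim: m U W => // m IHm U W ltU pU sU.
  rewrite ltnNge; apply/negP=> leU.
  have sUE : {subset U <= E} by move=> x Ux; rewrite sT0 // -(perm_mem pU) mem_cat Ux.
  have [leUn|ltnU] := leqP (size U) n.
    have := nz ([seq r + p | r <- U] ++ nseq (n - size U) p)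
      ([seq r + p | r <- W] ++ nseq (h - (n - size U)) p).
    rewrite big_cat big_map big_split /= sU add0r sum_nseq big_const_seq count_predT.
    rewrite -Monoid.iteropE -mulrnDr size_cat size_map size_nseq subnKC // nE // eqxx.
    move=> /(_ _ erefl) H; apply: notF; apply: H.
    rewrite (perm_trans _ (_ : perm_eq (nseq h p ++ Q) P)) 1?perm_sym // -T0p.
    move: pU => /(perm_map (+%R^~ p)) /seq.permP pU; apply/seq.permP=> a.
    have := pU a; rewrite map_cat !count_cat => <-.
    have le : (n - size U <= h)%N by clia.
    have -> : nseq h p = nseq (n - size U) p ++ nseq (h - (n - size U)) p.
      by rewrite -nseqD subnKC.
    rewrite count_cat; clia.
  (* More than n nonzero terms with multiplicities at most [h]: a zero-sum part of at most [h] terms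
     can be removed, and the zero-sum rest [V] still has more than n - h terms, against the
     induction hypothesis. *)
  have [T [V [pT /andP[T0' leT] sT]]] : exists T V,
      [/\ perm_eq (T ++ V) U, (0 < size T <= h)%N & \sum_(x <- T) x = 0].
    apply: (short_zero_sum E0 ED) => //; last exact: ltnW.
      by apply: contra T0n0 => U0; rewrite -(perm_mem pU) mem_cat U0.
    by move=> x; apply: leq_trans (cT0 x); rewrite -(count_part _ pU) leq_addr.
  have szV := perm_size pT; rewrite size_cat in szV.
  have : (size V < n - h)%N.
    apply: (IHm V (T ++ W)); first by clia.
      apply/seq.permP=> a; move/seq.permP/(_ a): pU; move/seq.permP/(_ a): pT.
      by rewrite !count_cat; clia.
    by move: sU; rewrite -(perm_big _ pT) big_cat /= sT add0r.
  by clia.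
suff [R [W [pR zR szR]]] : exists R W, [/\ perm_eq T0 (R ++ W), zsf R & (n <= size R + k)%N].
  exists p, h, R, [seq r + p | r <- W]; split=> //; last first.
    by move=> x Rx; rewrite sT0 // (perm_mem pR) mem_cat Rx.
  by rewrite (perm_trans pP) // perm_cat2l -T0p -map_cat perm_map.
(* Zero-sum parts of the rest are moved to [U] as long as there are any; [big] bounds the final
   [U]. *)
have : exists U W, perm_eq (U ++ W) T0 /\ \sum_(x <- U) x = 0.
  by exists [::], T0; rewrite big_nil.
case=> U [W]; have [m] := ubnP (size W); elim: m U W => // m IHm U W ltW [pU sU].
have [zW|[T [V [pT T0' sT]]]] := zsf_dec W.
  exists W, U; split=> //; first by rewrite perm_sym perm_catC.
  have := big U W pU sU; have := perm_size pU; rewrite size_cat; clia.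
apply: (IHm (U ++ T) V).
  by have := perm_size pT; rewrite size_cat; case: (T) T0' => //= ? ? _; clia.
split; last by rewrite big_cat /= sU sT addr0.
by rewrite -catA (perm_trans _ pU) // perm_cat2l.
Qed.

End InverseEGZ.

(* A decision procedure for equations in abelian groups. *)
Inductive zexp := ZVar of nat | ZZero | ZAdd of zexp & zexp | ZOpp of zexp | ZMul of zexp & nat.

Section Abel.
Variable G : zmodType.

Fixpoint zeval (env : seq G) e : G := match e with
  | ZVar i => nth 0 env i
  | ZZero => 0
  | ZAdd e1 e2 => zeval env e1 + zeval env e2
  | ZOpp e1 => - zeval env e1
  | ZMul e1 k => zeval env e1 *+ k
  end.

Fixpoint zcoef e (i : nat) : int := match e with
  | ZVar j => Posz (i == j)
  | ZZero => 0
  | ZAdd e1 e2 => zcoef e1 i + zcoef e2 i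
  | ZOpp e1 => - zcoef e1 i
  | ZMul e1 k => zcoef e1 i * Posz k
  end.

Lemma zevalE env e : zeval env e = \sum_(i < size env) nth 0 env i *~ zcoef e i.
Proof.
elim: e => [j||e1 IH1 e2 IH2|e IHe|e IHe k] /=.
- have [ltj|lej] := ltnP j (size env).
    rewrite (bigD1 (Ordinal ltj)) //= eqxx mulr1z big1 ?addr0 // => i.
    by rewrite -(inj_eq val_inj) /= => /negPf->; rewrite mulr0z.
  rewrite nth_default // big1 // => i _.
  by rewrite ltn_eqF ?mulr0z // (leq_trans (ltn_ord i)).
- by rewrite big1.
- by rewrite IH1 IH2 -big_split; apply: eq_bigr => i _; rewrite mulrzDr.
- by rewrite IHe -sumrN; apply: eq_bigr => i _; rewrite mulrNz.
- by rewrite IHe -sumrMnl; apply: eq_bigr => i _; rewrite mulrzA pmulrn.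
Qed.

Lemma zeval_eq env e1 e2 :
  all (fun i => zcoef e1 i == zcoef e2 i) (iota 0 (size env)) ->
  zeval env e1 = zeval env e2.
Proof.
move=> /allP eq12; rewrite !zevalE; apply: eq_bigr => i _.
by rewrite (eqP (eq12 i _)) // mem_iota ltn_ord.
Qed.

End Abel.

Ltac zin x env := match env with
  | nil => constr:(false)
  | @cons _ x _ => constr:(true)
  | @cons _ _ ?env' => zin x env'
  end.
Ltac zadd x env := match zin x env with true => env | false => constr:(cons x env) end.
Ltac zidx x env := match env with
  | @cons _ x _ => constr:(0%N)
  | @cons _ _ ?env' => let k := zidx x env' in constr:(S k)
  end.
Ltac znum k := lazymatch k with O => constr:(true) | S ?j => znum j | _ => constr:(false) end.
Ltac zvars t env := lazymatch t with
  | (?a + ?b)%R => let env' := zvars a env in zvars b env'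
  | (- ?a)%R => zvars a env
  | (?a *+ ?k)%R => let b := znum k in
    lazymatch b with true => zvars a env | false => zadd t env end
  | (0)%R => env
  | _ => zadd t env
  end.
Ltac zreify t env := lazymatch t with
  | (?a + ?b)%R => let a' := zreify a env in let b' := zreify b env in constr:(ZAdd a' b')
  | (- ?a)%R => let a' := zreify a env in constr:(ZOpp a')
  | (?a *+ ?k)%R => let b := znum k in lazymatch b with
    | true => let a' := zreify a env in constr:(ZMul a' k)
    | false => let j := zidx t env in constr:(ZVar j) end
  | (0)%R => constr:(ZZero)
  | _ => let k := zidx t env in constr:(ZVar k)
  end.
Ltac abel := lazymatch goal with |- @eq ?T ?a ?b =>
  let env0 := constr:(@nil T) in let env1 := zvars a env0 in let env := zvars b env1 in
  let a' := zreify a env in let b' := zreify b env in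
  refine (@zeval_eq _ env a' b' _); vm_compute; reflexivity end.

(* [lincomb e] proves a = b from a proof e of a linear combination l = r
   with a - b = l - r. *)
Lemma lincomb_eq (G : zmodType) (a b l r : G) : l = r -> a - b = l - r -> a = b.
Proof. by move=> -> /eqP; rewrite subrr subr_eq0 => /eqP. Qed.
Ltac lincomb e := apply: (lincomb_eq e); abel.

Lemma addE (G : zmodType) (a b c d : G) : a = b -> c = d -> a + c = b + d.
Proof. by move=> -> ->. Qed.
Lemma subE (G : zmodType) (a b c d : G) : a = b -> c = d -> a - c = b - d.
Proof. by move=> -> ->. Qed.
Lemma mulE (G : zmodType) (a b : G) k : a = b -> a *+ k = b *+ k.
Proof. by move=> ->. Qed.

(** * Points of the affine space over F_2 of dimension 4 *)

(* The sets of points with sum 0 are the blocks; those with 4 points are the planes. *)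
Definition K4 : finZmodType := (bool * bool * bool * bool)%type.

Section Planes.
Variable G : zmodType.
Implicit Types (phi : K4 -> G) (f : pred K4) (h : G) (a b c d p x y : K4).

Definition planes f phi h := forall a b c d, uniq [:: a; b; c; d] ->
  all f [:: a; b; c; d] -> a + b + c + d = 0 -> phi a + phi b + phi c + phi d = h.
Definition blocks6 f phi h := forall a b c d x y, uniq [:: a; b; c; d; x; y] ->
  all f [:: a; b; c; d; x; y] -> a + b + c + d + x + y = 0 ->
  let s := phi a + phi b + phi c + phi d + phi x + phi y in s = h \/ s = h *+ 2.

Lemma K4xx x : x + x = 0. Proof. by case: x => [[[[] []] []] []]. Qed.
Lemma K4N x : - x = x. Proof. by case: x => [[[[] []] []] []]. Qed.
Lemma K4addK x y : x + y + y = x. Proof. by rewrite -addrA K4xx addr0. Qed.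
Lemma K4eq0 x y : (x + y == 0) = (x == y). Proof. by rewrite -{1}(K4N y) subr_eq0. Qed.

Definition pairs f x := [set c : K4 | f c && f (c + x)].
(** For x nonzero a pair {c, c + x} is counted at both ends, so 6 means three disjoint pairs in
    direction x. *)
Definition gooddir f x := (6 <= #|pairs f x|)%N.

(* Three pairs in direction x form three planes. *)
Lemma good_pair f phi h x c : planes f phi h -> x != 0 -> gooddir f x ->
  f c -> f (c + x) -> (phi c + phi (c + x)) *+ 2 = h.
Proof.
move=> pl x0 gx fc fcx; set D := pairs f x; have {}gx : (6 <= #|D|)%N := gx.
have Dx y : y \in D -> y + x \in D.
  by rewrite !inE => /andP[fy fyx]; rewrite fyx K4addK.
have nx y : (y == y + x) = false by rewrite -{1}[y]addr0 (inj_eq (addrI _)) eq_sym (negPf x0).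
have Dc : c \in D by rewrite inE fc.
have pick (S : seq K4) : (size S < 6)%N -> exists2 d, d \in D & d \notin S.
  move=> szS; have [/subset_leq_card leD|/subsetPn[d Dd nd]] := boolP (D \subset S).
    by have := card_size S; move: gx szS leD; clia.
  by exists d.
have [d Dd] := pick [:: c; c + x] isT; rewrite !inE negb_or => /andP[ndc ndcx].
have [e De] := pick [:: c; c + x; d; d + x] isT.
rewrite !inE !negb_or => /and4P[nec necx ned nedx].
have P y z : y \in D -> z \in D -> z != y -> z != y + x ->
    phi y + phi (y + x) + phi z + phi (z + x) = h.
  move=> Dy Dz nzy nzyx; apply: pl.
  - have -> : [:: y; y + x; z; z + x] = [:: y; y + x] ++ [:: z; z + x] by [].
    have e1 : (z + x == y) = (z == y + x) by apply/eqP/eqP => [<-|->]; rewrite K4addK.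
    rewrite cat_uniq /= !inE !nx /= (negPf nzy) (negPf nzyx) e1 (negPf nzyx) /=.
    by rewrite (inj_eq (addIr _)) (negPf nzy).
  - by move: Dy Dz; rewrite !inE /= => /andP[-> ->] /andP[-> ->].
  - by rewrite (addrA y) K4xx add0r -addrA (addrA z z) K4xx add0r K4xx.
lincomb (subE (addE (P c d Dc Dd ndc ndcx) (P c e Dc De nec necx)) (P d e Dd De ned nedx)).
Qed.

(** The sides of the triangle p, p + x, p + y are good pairs, each with doubled sum h; the two sides
    at p minus the third leave 4 phi(p). *)
Lemma triangle_value f phi h p x y : planes f phi h ->
  x != 0 -> y != 0 -> x != y -> gooddir f x -> gooddir f y -> gooddir f (x + y) ->
  f p -> f (p + x) -> f (p + y) -> phi p *+ 4 = h.
Proof.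
move=> pl x0 y0 nxy gx gy gxy fp fpx fpy.
have e1 := good_pair pl x0 gx fp fpx.
have e2 := good_pair pl y0 gy fp fpy.
have pxy : p + x + (x + y) = p + y by rewrite addrA K4addK.
have e3 : (phi (p + x) + phi (p + y)) *+ 2 = h.
  by rewrite -pxy; apply: good_pair pl _ gxy fpx _; rewrite ?K4eq0 // pxy.
lincomb (subE (addE e1 e2) e3).
Qed.

(** The block is made of three good pairs, so twice its sum is 3h; a sum h or 2h would give 2h = 3h
    or 4h = 3h. *)
Lemma blocks6_contra f phi h a b c x y : h != 0 -> planes f phi h -> blocks6 f phi h ->
  x != 0 -> y != 0 -> x != y -> gooddir f x -> gooddir f y -> gooddir f (x + y) ->
  uniq [:: a; a + x; b; b + y; c; c + (x + y)] ->
  all f [:: a; a + x; b; b + y; c; c + (x + y)] -> False.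
Proof.
move=> h0 pl b6 x0 y0 nxy gx gy gxy U /[dup] A /and5P[fa fax fb fby /and3P[fc fcxy _]].
have xy0 : x + y != 0 by rewrite K4eq0.
have e1 := good_pair pl x0 gx fa fax.
have e2 := good_pair pl y0 gy fb fby.
have e3 := good_pair pl xy0 gxy fc fcxy.
have s0 : a + (a + x) + b + (b + y) + c + (c + (x + y)) = 0.
  by rewrite -[RHS](K4xx (a + b + c + x + y)); abel.
have [e|e] := b6 _ _ _ _ _ _ U A s0; case/negP: h0; apply/eqP.
- lincomb (subE (mulE 2 e) (addE (addE e1 e2) e3)).
- lincomb (subE (addE (addE e1 e2) e3) (mulE 2 e)).
Qed.

(* If Y lies in a subgroup H and misses few of its points, all directions are good. *)
Lemma planes_big (H Y : {set K4}) phi h p : {in H &, forall x y, x + y \in H} ->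
  Y \subset H -> (#|H| + 6 <= 2 * #|Y|)%N -> planes (mem Y) phi h -> p \in Y ->
  phi p *+ 4 = h.
Proof.
move=> HD YH leY pl Yp.
have cH : (#|Y| <= #|H|)%N by apply: subset_leq_card.
have gd x : x \in H -> gooddir (mem Y) x.
  move=> Hx; pose Y' := [set y + x | y in Y].
  have eD : pairs (mem Y) x = Y :&: Y'.
    apply/setP=> c; rewrite !inE; congr (_ && _); apply/idP/imsetP => [Yc|[y Yy ->]].
      by exists (c + x); rewrite ?K4addK.
    by rewrite K4addK.
  rewrite /gooddir eD.
  have cY' : #|Y'| = #|Y| by apply: card_imset; exact: addIr.
  (* By inclusion-exclusion Y and its translate share at least 2|Y| - |H| >= 6 points. *)
  have : (#|Y :|: Y'| <= #|H|)%N.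
    apply/subset_leq_card/subsetP=> y; rewrite inE => /orP[/(subsetP YH)//|/imsetP[z Yz ->]].
    by apply: HD => //; exact: (subsetP YH).
  have := cardsUI Y Y'; move: leY; rewrite cY'; clia.
have [q Yq] : exists2 q, q \in Y & q != p.
  have : (1 < #|Y|)%N by move: leY cH; clia.
  by rewrite (cardsD1 p) Yp => /card_gt0P[q]; rewrite !inE => /andP[? ?]; exists q.
move=> nqp.
have [r Yr] : exists2 r, r \in Y & (r != p) && (r != q).
  have : (2 < #|Y|)%N by move: leY cH; clia.
  rewrite (cardsD1 p) Yp (cardsD1 q) !inE Yq nqp => /card_gt0P[r]; rewrite !inE.
  by move=> /and3P[? ? ?]; exists r => //; apply/andP.
move=> /andP[nrp nrq]; have HY y : y \in Y -> y \in H by apply/subsetP.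
apply: (@triangle_value _ _ _ p (p + q) (p + r) pl); rewrite ?K4eq0 1?(eq_sym p) //.
- by rewrite (inj_eq (addrI _)) eq_sym.
- by apply/gd/HD; exact: HY.
- by apply/gd/HD; exact: HY.
- by apply/gd/HD; apply/HD; exact: HY.
- by rewrite /= addrA K4xx add0r.
- by rewrite /= addrA K4xx add0r.
Qed.

End Planes.

(** * Exhaustive check of the nine-point sets *)

Definition kl : seq K4 := [seq (i.1, i.2, j.1, j.2) |
  j <- [:: (false, false); (true, false); (false, true); (true, true)],
  i <- [:: (false, false); (true, false); (false, true); (true, true)]].

Definition e1 : K4 := (true, false, false, false).
Definition e2 : K4 := (false, true, false, false).
Definition e3 : K4 := (false, false, true, false).
Definition e4 : K4 := (false, false, false, true).

Definition bit (b : bool) (n : nat) := if b then n else 0%N.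
(** [kl] lists the points by increasing [idx], so a list of values along [kl] is read off at
    position [idx]. The first four points form the plane spanned by [e1] and [e2]. *)
Definition idx (x : K4) : nat :=
  let: (b1, b2, b3, b4) := x in (bit b1 1 + bit b2 2 + bit b3 4 + bit b4 8)%N.

Definition sel (b : bool) (x : K4) : K4 := if b then x else 0.
Definition lin (b1 b2 b3 b4 : K4) (x : K4) : K4 :=
  let: (i, j, k, l) := x in sel i b1 + sel j b2 + sel k b3 + sel l b4.

(** This and the next definitions are list versions of [pairs], [gooddir], [cert] and [tri]: they
    reduce by evaluation, which finite sets do not. *)
Definition pairl (f : pred K4) x : seq K4 := [seq c <- kl | f c && f (c + x)].
Definition gdb f x := (6 <= size (pairl f x))%N.
Definition dirs f : seq K4 := [seq x <- kl | (x != 0) && gdb f x].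
Definition halfl (f : pred K4) (x : K4) : seq K4 := [seq c <- pairl f x | ltn (idx c) (idx (c + x))].
Definition certd (f : pred K4) (x y : K4) :=
  [&& gdb f x, gdb f y, gdb f (x + y) & has (fun a => has (fun b =>
    uniq [:: a; a + x; b; b + y] && has (fun c => uniq [:: a; a + x; b; b + y; c; c + (x + y)])
      (halfl f (x + y))) (halfl f y)) (halfl f x)].
Definition certb (f : pred K4) := has (fun y => [&& y != 0, e1 != y & certd f e1 y]) kl.
Definition trib (f : pred K4) (D : seq K4) (p : K4) :=
  has (fun x => has (fun y => [&& x != y, x + y \in D, f (p + x) & f (p + y)]) D) D.
Definition t1b (f : pred K4) := let D := dirs f in
  has (fun q => all (fun p => f p ==> (p == q) || trib f D p) kl) kl.

Fixpoint masks n k : seq bitseq := match n with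
  | 0 => if k is 0 then [:: [::]] else [::]
  | n'.+1 => [seq false :: m | m <- masks n' k] ++
             (if k is k'.+1 then [seq true :: m | m <- masks n' k'] else [::])
  end.

Definition tab (m : bitseq) (x : K4) := nth false m (idx x).
(** The four leading [false] keep a plane empty; [m] selects nine of the other twelve points. Either
    there is a certificate with directions in the empty plane, or all points but one lie in
    triangles and every tenth point creates a certificate. The enlarged set is tabulated again to
    keep its evaluation cheap. *)
Definition checkm m := let f := tab (nseq 4 false ++ m) in
  certd f e1 e2 || (t1b f && all (fun y => f y || certb (tab [seq (x == y) || f x | x <- kl])) kl).

Lemma kl_all x : x \in kl. Proof. by case: x => [[[[] []] []] []]. Qed.

Lemma card_kl (f : pred K4) : #|[set x : K4 | f x]| = count f kl.
Proof.
rewrite cardsE cardE -size_filter; apply/perm_size/uniq_perm.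
- exact: enum_uniq.
- exact: filter_uniq.
- by move=> x; rewrite mem_enum mem_filter kl_all andbT.
Qed.

Lemma gdbE f x : gdb f x = gooddir f x.
Proof. by rewrite /gdb /gooddir /pairs card_kl size_filter. Qed.

Lemma eq_gooddir f f' x : f =1 f' -> gooddir f x = gooddir f' x.
Proof.
move=> ff'; rewrite /gooddir; suff -> : pairs f x = pairs f' x by [].
by apply/setP=> c; rewrite !inE !ff'.
Qed.

(* [cert f] is a 6-point block inside f made of three good pairs, [tri f p] a triangle
   of good pairs at p. *)
Definition cert (f : pred K4) := exists x y a b c, [/\ x != 0, y != 0 & x != y] /\
  [/\ gooddir f x, gooddir f y, gooddir f (x + y),
      uniq [:: a; a + x; b; b + y; c; c + (x + y)] &
      all f [:: a; a + x; b; b + y; c; c + (x + y)]].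
Definition tri (f : pred K4) (p : K4) := exists x y, [/\ x != 0, y != 0 & x != y] /\
  [/\ gooddir f x, gooddir f y, gooddir f (x + y), f (p + x) & f (p + y)].

Lemma certdP f x y : x != 0 -> y != 0 -> x != y -> certd f x y -> cert f.
Proof.
move=> x0 y0 xy /and4P[gx gy gxy /hasP[a Pa /hasP[b Pb /andP[_ /hasP[c Pc U]]]]].
exists x, y, a, b, c; split=> //; rewrite -!gdbE; split=> //=.
have P d w : d \in halfl f w -> f d && f (d + w) by rewrite !mem_filter => /and3P[].
by move: (P _ _ Pa) (P _ _ Pb) (P _ _ Pc) => /andP[-> ->] /andP[-> ->] /andP[-> ->].
Qed.

Lemma certbP f : certb f -> cert f.
Proof. by move=> /hasP[y _ /and3P[y0 xy]]; exact: certdP. Qed.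

Lemma t1bP f : t1b f -> exists q, forall p, f p -> p != q -> tri f p.
Proof.
move=> /hasP[q _ /allP H]; exists q => p fp npq.
have := H p (kl_all p); rewrite fp (negPf npq) /= => /hasP[x Dx /hasP[y Dy /and4P[xy Dxy fx fy]]].
have D z : z \in dirs f -> z != 0 /\ gooddir f z.
  by rewrite mem_filter gdbE => /andP[/andP[]].
have [x0 gx] := D x Dx; have [y0 gy] := D y Dy; have [_ gxy] := D _ Dxy.
by exists x, y; split.
Qed.

Lemma eq_cert f f' : f =1 f' -> cert f -> cert f'.
Proof.
move=> ff' [x [y [a [b [c [xy [gx gy gxy U A]]]]]]]; exists x, y, a, b, c.
by split=> //; rewrite -!(eq_gooddir _ ff') -(eq_all ff').
Qed.

Lemma eq_tri f f' p : f =1 f' -> tri f p -> tri f' p.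
Proof.
move=> ff' [x [y [xy [gx gy gxy U A]]]]; exists x, y.
by split=> //; rewrite -!(eq_gooddir _ ff') -!ff'.
Qed.

(** * Invariance under affine bijections *)

Section Affine.
Variables (L : K4 -> K4) (z : K4).
Hypotheses (LD : forall x y, L (x + y) = L x + L y) (Linj : injective L).
Let g x := z + L x.

Lemma L_0 : L 0 = 0. Proof. by apply: (addrI (L 0)); rewrite -LD !addr0. Qed.

Lemma L_eq0 x : (L x == 0) = (x == 0).
Proof. by rewrite -{1}L_0 (inj_eq Linj). Qed.

Lemma affD x y : z + L (x + y) = z + L x + L y.
Proof. by rewrite LD addrA. Qed.

Lemma aff_inj : injective g. Proof. by move=> x y /addrI/Linj. Qed.

Lemma aff_gooddir f x : gooddir (f \o g) x -> gooddir f (L x).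
Proof.
move=> /leq_trans; apply; rewrite -(card_imset _ aff_inj); apply/subset_leq_card/subsetP.
by move=> y /imsetP[c + ->]; rewrite !inE /= /g affD.
Qed.

Lemma aff_cert f : cert (f \o g) -> cert f.
Proof.
move=> [x [y [a [b [c [[x0 y0 xy] [gx gy gxy U A]]]]]]].
exists (L x), (L y), (g a), (g b), (g c); rewrite !L_eq0 (inj_eq Linj) -LD; split=> //.
have e : [:: g a; g a + L x; g b; g b + L y; g c; g c + L (x + y)] =
    map g [:: a; a + x; b; b + y; c; c + (x + y)].
  by rewrite /= /g !LD !addrA.
by rewrite e map_inj_uniq ?all_map; [split=> //; exact: aff_gooddir | exact: aff_inj].
Qed.

Lemma aff_tri f p : tri (f \o g) p -> tri f (g p).
Proof.
move=> [x [y [[x0 y0 xy] [gx gy gxy fx fy]]]]; exists (L x), (L y).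
rewrite !L_eq0 (inj_eq Linj) -LD -!affD; split=> //; split=> //; exact: aff_gooddir.
Qed.

End Affine.

Lemma linD b1 b2 b3 b4 x y : lin b1 b2 b3 b4 (x + y) = lin b1 b2 b3 b4 x + lin b1 b2 b3 b4 y.
Proof.
have e (a b : bool) (c : K4) : sel (a + b) c = sel a c + sel b c.
  by case: a b => [] []; rewrite /sel /= ?K4xx ?addr0 ?add0r.
case: x y => [[[i j] k] l] [[[i' j'] k'] l'].
have -> : ((i, j, k, l) : K4) + (i', j', k', l') = (i + i', j + j', k + k', l + l') by [].
by rewrite /lin !e; abel.
Qed.

Lemma lin_inj b1 b2 b3 b4 : all (fun u => (u == 0) || (lin b1 b2 b3 b4 u != 0)) kl ->
  injective (lin b1 b2 b3 b4).
Proof.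
move=> /allP H x y e; apply/eqP; rewrite -K4eq0; have := H (x + y) (kl_all _).
by rewrite linD e K4xx eqxx orbF.
Qed.

Definition basis_ok (b1 b2 : K4) := [|| b1 == 0, b2 == 0, b1 == b2 |
  has (fun z => (z \notin [:: 0; b1; b2; b1 + b2]) &&
    has (fun t => all (fun u => (u == 0) || (lin b1 b2 z t u != 0)) kl) kl) kl].

Lemma basis_check : all (fun b1 => all (basis_ok b1) kl) kl.
Proof. lazy. exact (erefl true). Qed.

Lemma lin_basis b1 b2 : b1 != 0 -> b2 != 0 -> b1 != b2 ->
  exists b3 b4, injective (lin b1 b2 b3 b4).
Proof.
move=> /negP n1 /negP n2 /negP n12.
have /or4P[//|//|//|] : basis_ok b1 b2 := allP (allP basis_check b1 (kl_all b1)) b2 (kl_all b2).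
by move=> /hasP[z _ /andP[_ /hasP[t _ /lin_inj H]]]; exists z, t.
Qed.

Lemma masksP n k m : size m = n -> count id m = k -> m \in masks n k.
Proof.
elim: n k m => [|n IHn] k [|b m] //=; first by move=> _ <-.
move=> [szm]; rewrite mem_cat; case: b => /= [|e].
  by rewrite add1n => <-; rewrite mem_map ?IHn ?orbT // => ? ? [].
by rewrite mem_map ?IHn // => ? ? [].
Qed.

Lemma checkm_all : all checkm (masks 12 9).
Proof. lazy. exact (erefl true). Qed.

Lemma tabE (f : pred K4) : f =1 tab [seq f x | x <- kl].
Proof. by case=> [[[[] []] []] []]. Qed.

(** Seven points have 21 pairs, but only 15 nonzero sums exist, so two distinct pairs have equal
    sums; such pairs are disjoint. *)
Lemma plane_in (Z : {set K4}) : (6 < #|Z|)%N -> exists a b c d,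
  [/\ a \in Z, b \in Z, c \in Z & d \in Z] /\ uniq [:: a; b; c; d] /\ a + b + c + d = 0.
Proof.
move=> ltZ; pose D := [set B : {set K4} | B \subset Z & #|B| == 2].
pose s (B : {set K4}) := \sum_(x in B) x.
have D2 B : B \in D -> exists a b, [/\ a \in Z, b \in Z, a != b, B = [set a; b] & s B = a + b].
  rewrite inE => /andP[BZ /cards2P[a [b [nab eB]]]]; exists a, b.
  have [Ba Bb] : a \in B /\ b \in B by rewrite eB !inE !eqxx orbT.
  split; [exact: (subsetP BZ) | exact: (subsetP BZ) | by [] | by [] |].
  by rewrite /s eB big_setU1 ?big_set1 // inE.
have /injectivePn[B1 [B2 nB e]] : ~~ injectiveb (fun B : {B | B \in D} => s (val B)).
  apply/negP=> /injectiveP inj.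
  pose N := [set x : K4 | x != 0].
  have : (#|{: {B | B \in D}}| <= #|N|)%N.
    rewrite -(card_codom inj); apply/subset_leq_card/subsetP=> _ /codomP[[B DB] ->].
    by have [a [b [_ _ nab _ /= ->]]] := D2 B DB; rewrite inE K4eq0.
  rewrite card_sig card_kl /= (_ : #|_| = #|D|); last by apply: eq_card => B; rewrite inE.
  rewrite cards_draws; have := leq_bin2l 2 ltZ; rewrite (_ : 'C(7, 2) = 21)%N //.
  by move=> /leq_trans le /le.
have [a [b [Za Zb nab eB1 s1]]] := D2 _ (valP B1).
have [c [d [Zc Zd ncd eB2 s2]]] := D2 _ (valP B2).
move: e; rewrite s1 s2 => e.
have s0 : a + b + c + d = 0 by rewrite -addrA -e K4xx.
exists a, b, c, d; split=> //; split=> //.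
have neB : [set a; b] != [set c; d] by rewrite -eB1 -eB2 (inj_eq val_inj).
have ac : a != c.
  by apply: contraNneq neB => ac; move: e; rewrite ac => /addrI ->.
have ad : a != d.
  apply: contraNneq neB => ad; move: e; rewrite ad [c + d]addrC => /addrI ->.
  by rewrite setUC.
have bc : b != c.
  apply: contraNneq neB => bc; move: e; rewrite bc [c + d]addrC => /addIr ->.
  by rewrite setUC.
have bd : b != d.
  by apply: contraNneq neB => bd; move: e; rewrite bd => /addIr ->.
by rewrite /= !inE !negb_or nab ac ad bc bd ncd.
Qed.

Lemma card_K4 : #|K4| = 16.
Proof. by rewrite -cardsT (card_kl predT). Qed.

(** The seven points outside [Y] contain a plane. An affine bijection carries the plane of [e1] and
    [e2] onto it, which leaves the 220 masks of [checkm_all]. *)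
Lemma nine_points (Y : {set K4}) : #|Y| = 9 -> cert (mem Y) \/
  (exists q, forall p, p \in Y -> p != q -> tri (mem Y) p) /\
  (forall y, y \notin Y -> cert (mem (y |: Y))).
Proof.
move=> cY; have cZ : #|~: Y| = 7%N by have := cardsC Y; rewrite cY card_K4; lia.
have [|a [b [c [d [[Za Zb Zc Zd] [U s0]]]]]] := @plane_in (~: Y); first by rewrite cZ.
move: U; rewrite /= !inE !negb_or => /and4P[/and3P[nab nac nad] /andP[nbc nbd] ncd _].
have [||| b3 [b4 Linj]] := @lin_basis (a + b) (a + c); rewrite ?K4eq0 ?(inj_eq (addrI _)) //.
set L := lin _ _ _ _ in Linj.
have LD := linD (a + b) (a + c) b3 b4 : forall x y, L (x + y) = L x + L y.
pose g x := a + L x; pose f : pred K4 := mem Y; pose f' := f \o g.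
have ginj : injective g by exact: aff_inj.
have f'0 i j : f' (i, j, false, false) = false.
  have gE : g (i, j, false, false) \in [:: a; b; c; d].
    rewrite /g /L /lin /sel !addr0 !inE; case: i; case: j; rewrite ?addr0 ?add0r.
    - have -> : a + (a + b + (a + c)) = a + b + c + d + d.
        by rewrite K4addK addrACA K4xx add0r addrA.
      by rewrite s0 add0r eqxx !orbT.
    - by rewrite addrA K4xx add0r eqxx orbT.
    - by rewrite addrA K4xx add0r eqxx !orbT.
    - by rewrite eqxx.
  move: gE; rewrite /f' /= !inE; move: Za Zb Zc Zd; rewrite !inE /f /=.
  by move=> /negPf ea /negPf eb /negPf ec /negPf ed /or4P[] /eqP->.
pose m := [seq f' x | x <- drop 4 kl].
have fE : f' =1 tab (nseq 4 false ++ m).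
  by move=> x; rewrite tabE; congr (tab _ x); rewrite /= !f'0.
have gon x : x \in codom g by rewrite (inj_card_onto ginj).
have cm : count id m = 9.
  have : count f' kl = 9.
    rewrite -card_kl -cY -(card_imset _ ginj); apply: eq_card => x.
    apply/imsetP/idP => [[y]|Yx]; first by rewrite inE => ? ->.
    have /codomP[y ey] := gon x.
    by exists y; rewrite // inE /f' /= -ey.
  rewrite -(cat_take_drop 4 kl) count_cat => <-; rewrite /m count_map.
  by rewrite [X in (X + _)%N]/= !f'0.
have mm : m \in masks 12 9 by apply: masksP.
have := allP checkm_all m mm; rewrite /checkm => /orP[|/andP[T1 /allP T2]].
  move/certdP => /(_ isT isT isT) /(eq_cert (fsym fE)) /aff_cert C; left.
  exact: C.
right; split.
  have [q Hq] := t1bP T1; exists (g q) => p Yp npq.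
  have /codomP[p' ep] := gon p.
  rewrite ep; apply: aff_tri => //; apply: (eq_tri (fsym fE)); apply: Hq.
    by rewrite -fE /f' /= -ep.
  by apply: contra npq => /eqP <-; rewrite ep.
move=> y Yy; have /codomP[y' ey] := gon y.
have /orP[|/certbP C] := T2 y' (kl_all y').
  by rewrite -(fE y') /f' /= -ey /f /= (negPf Yy).
apply: (aff_cert LD Linj (z := a)); apply: eq_cert C => x.
by rewrite -(tabE (fun x => _ || _)) -(fE x) /= !inE -(inj_eq ginj) ey eq_sym.
Qed.

Section FL.
Variables (G : zmodType) (phi : K4 -> G) (h : G).
Hypothesis h0 : h != 0.

Lemma planes_sub (Y Y' : {set K4}) : Y \subset Y' ->
  planes (mem Y') phi h -> planes (mem Y) phi h.
Proof.
move=> /subsetP sY pl a b c d U A; apply: pl => //.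
by apply/allP=> x /(allP A)/sY.
Qed.

Lemma blocks6_sub (Y Y' : {set K4}) : Y \subset Y' ->
  blocks6 (mem Y') phi h -> blocks6 (mem Y) phi h.
Proof.
move=> /subsetP sY b6 a b c d x y U A; apply: b6 => //.
by apply/allP=> z /(allP A)/sY.
Qed.

Lemma cert_contra (Y : {set K4}) : planes (mem Y) phi h -> blocks6 (mem Y) phi h -> ~ cert (mem Y).
Proof.
move=> pl b6 [x [y [a [b [c [[x0 y0 xy] [gx gy gxy U A]]]]]]].
exact: (blocks6_contra h0 pl b6 x0 y0 xy gx gy gxy U A).
Qed.

Lemma tri_value (Y : {set K4}) p : planes (mem Y) phi h -> p \in Y -> tri (mem Y) p -> phi p *+ 4 = h.
Proof.
move=> pl Yp [x [y [[x0 y0 xy] [gx gy gxy fx fy]]]].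
exact: (triangle_value pl x0 y0 xy gx gy gxy Yp fx fy).
Qed.

(** Nine of the points carry a certificate or get one from a tenth; [cert_contra] excludes both. *)
Lemma ten_points (Y : {set K4}) : (9 < #|Y|)%N ->
  planes (mem Y) phi h -> blocks6 (mem Y) phi h -> False.
Proof.
move=> ltY pl b6; have [Y' sY' cY'] : exists2 Y' : {set K4}, Y' \subset Y & #|Y'| = 9.
  have : (0 < #|[set B : {set K4} | B \subset Y & #|B| == 9]|)%N.
    by rewrite cards_draws bin_gt0 ltnW.
  by case/card_gt0P=> B; rewrite inE => /andP[? /eqP ?]; exists B.
have [y Yy nY'y] : exists2 y, y \in Y & y \notin Y'.
  by apply/subsetPn/negP=> /subset_leq_card; rewrite cY' leqNgt ltY.
have [|[_ /(_ y nY'y)]] := nine_points cY'.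
  by apply: cert_contra; [exact: planes_sub pl | exact: blocks6_sub b6].
have sY : y |: Y' \subset Y by rewrite subUset sub1set Yy.
by apply: cert_contra; [exact: planes_sub pl | exact: blocks6_sub b6].
Qed.

Lemma nine_points_value (Y : {set K4}) : (8 < #|Y|)%N ->
  planes (mem Y) phi h -> blocks6 (mem Y) phi h ->
  #|Y| = 9 /\ exists q, forall p, p \in Y -> p != q -> tri (mem Y) p.
Proof.
move=> leY pl b6; have [lt9|le9] := ltnP 9 #|Y|; first by case: (ten_points lt9 pl b6).
have cY : #|Y| = 9 by apply/eqP; rewrite eqn_leq le9.
by have [/(cert_contra pl b6)//|[]] := nine_points cY.
Qed.

End FL.

(** * Values on the lines and planes of the projective space over F_2 *)

Section Lines.
Variable G : zmodType.
Implicit Types (phi : K4 -> G) (f : pred K4) (l Q : seq K4) (g : G).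

Fixpoint vsum phi l : G := if l is x :: l' then phi x + vsum phi l' else 0.
Fixpoint ksum l : K4 := if l is x :: l' then x + ksum l' else 0.

Definition line l := (size l == 3) && (ksum l == 0).
Definition plane Q := (size Q == 4) && (ksum Q == 0).

(** [D] tells which planes a line controls: all of them when n - 3 values in E are already known,
    only the disjoint ones when n - 4 are. *)
Definition line_values (D : rel (seq K4)) f phi := forall l1 l2,
  line l1 -> line l2 -> uniq (l1 ++ l2) -> all f (l1 ++ l2) ->
  [/\ vsum phi l1 = vsum phi l2, vsum phi l1 != 0, vsum phi l1 *+ 2 != 0 &
    forall Q, plane Q -> uniq Q -> all f Q -> D Q l1 ->
      vsum phi Q = vsum phi l1 \/ vsum phi Q = vsum phi l1 *+ 2].

Definition disj Q l := uniq (Q ++ l).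
Definition anyD Q l := true.

Lemma line_values_weak f phi : line_values anyD f phi -> line_values disj f phi.
Proof.
move=> H l1 l2 L1 L2 U A; have [e n1 n2 HQ] := H l1 l2 L1 L2 U A.
by split=> // Q PQ UQ AQ _; exact: HQ.
Qed.

Lemma mulrn_eq2 g z : g != 0 -> g *+ 2 != 0 -> (z <= 3)%N -> g *+ z = g *+ 2 -> z = 2.
Proof.
move=> g0 g2; case: z => [|[|[|[|z]]]] // _ e; case/negP: g0.
- by case/negP: g2; rewrite -e.
- by apply/eqP; lincomb (subE (erefl 0) e).
- by apply/eqP; lincomb e.
Qed.

(* t1 and t2 are the values of two lines through the same point a, s that of the plane
   formed by their other points. *)
Lemma double_value g (a t1 t2 s : G) : t1 = g -> t2 = g -> s = g \/ s = g *+ 2 ->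
  a *+ 2 = t1 + t2 - s -> exists z : bool, a *+ 2 = g *+ z.
Proof.
move=> -> -> [->|->] ->; [exists true | exists false]; first by rewrite addrK.
by rewrite mulr2n subrr.
Qed.

(** Doubling the sum of the line gives (x + y + z) g = 2g with a coefficient at most 3. *)
Lemma line_count g (a b c : G) (x y z : bool) : g != 0 -> g *+ 2 != 0 ->
  a *+ 2 = g *+ x -> b *+ 2 = g *+ y -> c *+ 2 = g *+ z -> a + (b + (c + 0)) = g ->
  (x + y + z = 2)%N.
Proof.
move=> g0 g2 ea eb ec e; apply: (mulrn_eq2 g0 g2); first by case: x y z {ea eb ec} => [] [] [].
by rewrite !mulrnDr -ea -eb -ec -e; abel.
Qed.

(** Strict sorting by [idx] keeps one ordering of each line and discards triples with repeated
    points. *)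
Definition lines_of (s : seq K4) : seq (seq K4) :=
  [seq l <- [seq [:: a; b; a + b] | a <- s, b <- s] | sorted ltn (map idx l) && all (mem s) l].

(** The nonzero vectors of a hyperplane that avoids [e1], [e2] and [e3]: a Fano plane inside
    [fanoX]. *)
Definition fano : seq K4 := [:: e1 + e2; e1 + e3; e2 + e3; e4; e1 + e2 + e4; e1 + e3 + e4; e2 + e3 + e4].
Definition fanoX : seq K4 := [seq x <- kl | x \notin [:: 0; e1; e2; e3]].
Definition compl (s l : seq K4) := [seq x <- s | x \notin l].

(** The first half compares any two lines of [fano] through a third line. The second half finds, for
    each complement of a line in [fano], a disjoint line whose value can in turn be compared with
    that of a line of [fano]. *)
Lemma fano_check :
  all (fun l1 => all (fun l2 => has (fun l3 => uniq (l1 ++ l3) && uniq (l2 ++ l3)) (lines_of fanoX))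
    (lines_of fano)) (lines_of fano) &&
  all (fun l => has (fun l3 => uniq (compl fano l ++ l3) &&
    has (fun l1 => uniq (l3 ++ l1)) (lines_of fano)) (lines_of fanoX)) (lines_of fano).
Proof. lazy. exact (erefl true). Qed.

Definition cosets : seq K4 := [seq x <- kl | x \notin [:: 0; e1; e2; e1 + e2]].

Lemma coset_check : all (fun l1 => all (fun l2 => has (fun l3 =>
  uniq (l1 ++ l3) && uniq (l2 ++ l3)) (lines_of cosets)) (lines_of cosets)) (lines_of cosets).
Proof. lazy. exact (erefl true). Qed.

Lemma lines_ofP (s l : seq K4) : l \in lines_of s -> line l /\ all (mem s) l.
Proof.
rewrite mem_filter => /andP[/andP[_ A] /allpairsP[[a b] [_ _ /= el]]]; split=> //.
by rewrite el /line /= addr0 addrA K4xx eqxx.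
Qed.

(* Lines of the plane [fano] are compared through lines that are disjoint from it. *)
Lemma fano_contra f phi : all f fanoX -> line_values disj f phi -> False.
Proof.
move=> fX H; have [/allP C1 /allP C2] := andP fano_check.
have sF : all (mem fanoX) fano by [].
have F l : l \in lines_of fano -> line l /\ all f l.
  move=> /lines_ofP[L /allP A]; split=> //; apply/allP=> x /A Fx; apply: (allP fX).
  exact: (allP sF).
have X l : l \in lines_of fanoX -> line l /\ all f l.
  by move=> /lines_ofP[L /allP A]; split=> //; apply/allP=> x /A Fx; apply: (allP fX).
have eqF l1 l2 : l1 \in lines_of fano -> l2 \in lines_of fano ->
    [/\ vsum phi l1 = vsum phi l2, vsum phi l1 != 0 & vsum phi l1 *+ 2 != 0].
  move=> F1 F2; have /hasP[l3 X3 /andP[U1 U2]] := allP (C1 l1 F1) l2 F2.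
  have [L1 A1] := F _ F1; have [L2 A2] := F _ F2; have [L3 A3] := X _ X3.
  have [|-> n1 n2 _] := H l1 l3 L1 L3 U1; first by rewrite all_cat A1.
  by have [|-> _ _ _] := H l2 l3 L2 L3 U2; first by rewrite all_cat A2.
pose l0 := [:: e1 + e2; e1 + e3; e2 + e3]; pose g := vsum phi l0.
have F0 : l0 \in lines_of fano by [].
have [_ g0 g2] := eqF _ _ F0 F0; rewrite -/g in g0 g2.
have lv l : l \in lines_of fano -> vsum phi l = g by move=> Fl; case: (eqF _ _ Fl F0).
have pv l : l \in lines_of fano -> plane (compl fano l) ->
    vsum phi (compl fano l) = g \/ vsum phi (compl fano l) = g *+ 2.
  move=> Fl PQ; have /hasP[l3 X3 /andP[U3 /hasP[l1 F1 U1]]] := C2 l Fl.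
  have [L1 A1] := F _ F1; have [L3 A3] := X _ X3.
  have [|e _ _ HQ] := H l3 l1 L3 L1 U1; first by rewrite all_cat A3.
  rewrite -(lv _ F1) -e; apply: HQ => //; first by rewrite /compl filter_uniq.
  apply/allP=> x; rewrite mem_filter => /andP[_ Fx]; apply: (allP fX).
  exact: (allP sF).
pose x1 := phi (e1 + e2); pose x2 := phi (e1 + e3); pose x3 := phi (e2 + e3).
pose x4 := phi e4; pose x5 := phi (e1 + e2 + e4); pose x6 := phi (e1 + e3 + e4).
pose x7 := phi (e2 + e3 + e4).
have l123 : x1 + (x2 + (x3 + 0)) = g := lv l0 F0.
have l145 : x1 + (x4 + (x5 + 0)) = g := lv [:: e1 + e2; e4; e1 + e2 + e4] erefl.
have l246 : x2 + (x4 + (x6 + 0)) = g := lv [:: e1 + e3; e4; e1 + e3 + e4] erefl.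
have l347 : x3 + (x4 + (x7 + 0)) = g := lv [:: e2 + e3; e4; e2 + e3 + e4] erefl.
have l167 : x1 + (x6 + (x7 + 0)) = g := lv [:: e1 + e2; e1 + e3 + e4; e2 + e3 + e4] erefl.
have l257 : x2 + (x5 + (x7 + 0)) = g := lv [:: e1 + e3; e1 + e2 + e4; e2 + e3 + e4] erefl.
have l356 : x3 + (x5 + (x6 + 0)) = g := lv [:: e2 + e3; e1 + e2 + e4; e1 + e3 + e4] erefl.
pose V s := s = g \/ s = g *+ 2.
have q2345 : V (x2 + (x3 + (x4 + (x5 + 0)))) :=
  pv [:: e1 + e2; e1 + e3 + e4; e2 + e3 + e4] erefl erefl.
have q1346 : V (x1 + (x3 + (x4 + (x6 + 0)))) :=
  pv [:: e1 + e3; e1 + e2 + e4; e2 + e3 + e4] erefl erefl.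
have q1247 : V (x1 + (x2 + (x4 + (x7 + 0)))) :=
  pv [:: e2 + e3; e1 + e2 + e4; e1 + e3 + e4] erefl erefl.
have q1256 : V (x1 + (x2 + (x5 + (x6 + 0)))) :=
  pv [:: e2 + e3; e4; e2 + e3 + e4] erefl erefl.
move: (x1) (x2) (x3) (x4) (x5) (x6) (x7) l123 l145 l246 l347 l167 l257 l356 q2345 q1346 q1247 q1256.
move=> {x1 x2 x3 x4 x5 x6 x7} x1 x2 x3 x4 x5 x6 x7 l123 l145 l246 l347 l167 l257 l356 q2345 q1346 q1247 q1256.
have [|z1 y1] := double_value (a := x1) l123 l145 q2345; first by abel.
have [|z2 y2] := double_value (a := x2) l123 l246 q1346; first by abel.
have [|z3 y3] := double_value (a := x3) l123 l347 q1247; first by abel.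
have [|z4 y4] := double_value (a := x4) l145 l246 q1256; first by abel.
have [|z5 y5] := double_value (a := x5) l145 l257 q1247; first by abel.
have [|z6 y6] := double_value (a := x6) l246 l167 q1247; first by abel.
have [|z7 y7] := double_value (a := x7) l347 l167 q1346; first by abel.
(* On every line exactly two points have double g. Each of the seven points lies on three of the
   seven lines, so three times the number of such points would be 14. *)
have c1 := line_count g0 g2 y1 y2 y3 l123; have c2 := line_count g0 g2 y1 y4 y5 l145.
have c3 := line_count g0 g2 y2 y4 y6 l246; have c4 := line_count g0 g2 y3 y4 y7 l347.
have c5 := line_count g0 g2 y1 y6 y7 l167; have c6 := line_count g0 g2 y2 y5 y7 l257.
have := line_count g0 g2 y3 y5 y6 l356; move: c1 c2 c3 c4 c5 c6; clear.
move: (nat_of_bool z1) (nat_of_bool z2) (nat_of_bool z3) (nat_of_bool z4) (nat_of_bool z5)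
  (nat_of_bool z6) (nat_of_bool z7); lia.
Qed.

(** The points form three cosets of the plane of [e1] and [e2], and each line takes one point from
    each. The line relations make the sum of the coset of a0 equal to 4 a0; it is g or 2g, hence
    nonzero, so 2 a0 = g. The same for b0 and c0 contradicts [line_count] on the line a0, b0, c0. *)
Lemma coset_contra f phi : all f cosets -> line_values anyD f phi -> False.
Proof.
move=> fX H; have /allP C := coset_check.
have F l : l \in lines_of cosets -> line l /\ all f l.
  by move=> /lines_ofP[L /allP A]; split=> //; apply/allP=> x /A Fx; apply: (allP fX).
pose l0 := [:: e3; e4; e3 + e4]; pose g := vsum phi l0.
have F0 : l0 \in lines_of cosets by [].
have lH l1 : l1 \in lines_of cosets -> [/\ vsum phi l1 = g, g != 0, g *+ 2 != 0 &
    forall Q, plane Q -> uniq Q -> all f Q -> vsum phi Q = g \/ vsum phi Q = g *+ 2].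
  move=> F1; have /hasP[l3 X3 /andP[U1 U2]] := allP (C l1 F1) l0 F0.
  have [L1 A1] := F _ F1; have [L2 A2] := F _ F0; have [L3 A3] := F _ X3.
  have [|-> _ _ _] := H l1 l3 L1 L3 U1; first by rewrite all_cat A1.
  have [|<- n1 n2 HQ] := H l0 l3 L2 L3 U2; first by rewrite all_cat A2.
  by split=> // Q PQ UQ AQ; exact: HQ.
have [_ g0 g2 HQ] := lH _ F0.
have lv l : l \in lines_of cosets -> vsum phi l = g by move=> /lH[].
pose V s := s = g \/ s = g *+ 2.
have pv Q : all (mem cosets) Q -> plane Q -> uniq Q -> V (vsum phi Q).
  by move=> /allP sQ PQ UQ; apply: HQ => //; apply/allP=> x /sQ; exact: (allP fX).
pose a0 := phi e3; pose a1 := phi (e3 + e1); pose a2 := phi (e3 + e2); pose a3 := phi (e3 + e1 + e2).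
pose b0 := phi e4; pose b1 := phi (e4 + e1); pose b2 := phi (e4 + e2); pose b3 := phi (e4 + e1 + e2).
pose c0 := phi (e3 + e4); pose c1 := phi (e3 + e4 + e1); pose c2 := phi (e3 + e4 + e2).
pose c3 := phi (e3 + e4 + e1 + e2).
have l000 : a0 + (b0 + (c0 + 0)) = g := lv l0 F0.
have l110 : a1 + (b1 + (c0 + 0)) = g := lv [:: e3 + e1; e4 + e1; e3 + e4] erefl.
have l220 : a2 + (b2 + (c0 + 0)) = g := lv [:: e3 + e2; e4 + e2; e3 + e4] erefl.
have l330 : a3 + (b3 + (c0 + 0)) = g := lv [:: e3 + e1 + e2; e4 + e1 + e2; e3 + e4] erefl.
have l011 : a0 + (b1 + (c1 + 0)) = g := lv [:: e3; e4 + e1; e3 + e4 + e1] erefl.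
have l101 : a1 + (b0 + (c1 + 0)) = g := lv [:: e3 + e1; e4; e3 + e4 + e1] erefl.
have l022 : a0 + (b2 + (c2 + 0)) = g := lv [:: e3; e4 + e2; e3 + e4 + e2] erefl.
have l202 : a2 + (b0 + (c2 + 0)) = g := lv [:: e3 + e2; e4; e3 + e4 + e2] erefl.
have l033 : a0 + (b3 + (c3 + 0)) = g := lv [:: e3; e4 + e1 + e2; e3 + e4 + e1 + e2] erefl.
have l303 : a3 + (b0 + (c3 + 0)) = g := lv [:: e3 + e1 + e2; e4; e3 + e4 + e1 + e2] erefl.
have l123 : a1 + (b2 + (c3 + 0)) = g := lv [:: e3 + e1; e4 + e2; e3 + e4 + e1 + e2] erefl.
have l132 : a1 + (b3 + (c2 + 0)) = g := lv [:: e3 + e1; e4 + e1 + e2; e3 + e4 + e2] erefl.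
have l231 : a2 + (b3 + (c1 + 0)) = g := lv [:: e3 + e2; e4 + e1 + e2; e3 + e4 + e1] erefl.
have l213 : a2 + (b1 + (c3 + 0)) = g := lv [:: e3 + e2; e4 + e1; e3 + e4 + e1 + e2] erefl.
have l312 : a3 + (b1 + (c2 + 0)) = g := lv [:: e3 + e1 + e2; e4 + e1; e3 + e4 + e2] erefl.
have l321 : a3 + (b2 + (c1 + 0)) = g := lv [:: e3 + e1 + e2; e4 + e2; e3 + e4 + e1] erefl.
have qA : V (a0 + (a1 + (a2 + (a3 + 0)))) := pv [:: e3; e3 + e1; e3 + e2; e3 + e1 + e2] erefl erefl erefl.
have qB : V (b0 + (b1 + (b2 + (b3 + 0)))) := pv [:: e4; e4 + e1; e4 + e2; e4 + e1 + e2] erefl erefl erefl.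
have qC : V (c0 + (c1 + (c2 + (c3 + 0)))) :=
  pv [:: e3 + e4; e3 + e4 + e1; e3 + e4 + e2; e3 + e4 + e1 + e2] erefl erefl erefl.
have qab : V (a0 + (b0 + (a1 + (b1 + 0)))) := pv [:: e3; e4; e3 + e1; e4 + e1] erefl erefl erefl.
have qac : V (a0 + (c0 + (a1 + (c1 + 0)))) := pv [:: e3; e3 + e4; e3 + e1; e3 + e4 + e1] erefl erefl erefl.
have qbc : V (b0 + (c0 + (b1 + (c1 + 0)))) := pv [:: e4; e3 + e4; e4 + e1; e3 + e4 + e1] erefl erefl erefl.
move: (a0) (a1) (a2) (a3) (b0) (b1) (b2) (b3) (c0) (c1) (c2) (c3) l000 l110 l220 l330 l011 l101
  l022 l202 l033 l303 l123 l132 l231 l213 l312 l321 qA qB qC qab qac qbc.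
move=> {a0 a1 a2 a3 b0 b1 b2 b3 c0 c1 c2 c3} a0 a1 a2 a3 b0 b1 b2 b3 c0 c1 c2 c3.
move=> l000 l110 l220 l330 l011 l101 l022 l202 l033 l303 l123 l132 l231 l213 l312 l321 qA qB qC qab qac qbc.
have [|zc yc] := double_value (a := c0) l000 l110 qab; first by abel.
have [|zb yb] := double_value (a := b0) l000 l101 qac; first by abel.
have [|za ya] := double_value (a := a0) l000 l011 qbc; first by abel.
have c := line_count g0 g2 ya yb yc l000.
have one (z : bool) x s : V s -> s = x *+ 4 -> x *+ 2 = g *+ z -> z.
  case: z => // vs es ex; have s0 : s = 0 by rewrite es (mulrnA x 2 2) ex mulr0n mul0rn.
  by case: vs; rewrite s0 => /esym/eqP; rewrite ?(negPf g0) ?(negPf g2).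
have oA : za.
  apply: one qA _ ya; lincomb (addE (addE (subE l110 l000) (subE l303 l213))
    (addE (subE l220 l000) (subE l202 l022))).
have oB : zb.
  apply: one qB _ yb; lincomb (addE (addE (subE l110 l000) (subE l033 l123))
    (addE (subE l220 l000) (subE l022 l202))).
have oC : zc.
  apply: one qC _ yc; lincomb (addE (addE (subE l011 l000) (subE l303 l312))
    (addE (subE l022 l000) (subE l202 l220))).
by rewrite oA oB oC in c.
Qed.

Section Linear.
Variable L : K4 -> K4.
Hypotheses (LD : forall x y, L (x + y) = L x + L y) (Linj : injective L).

Lemma ksum_map l : ksum (map L l) = L (ksum l).
Proof. by elim: l => /= [|x l ->]; rewrite ?LD // (L_0 LD). Qed.

Lemma vsum_map phi l : vsum (phi \o L) l = vsum phi (map L l).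
Proof. by elim: l => //= x l ->. Qed.

Lemma line_values_lin (D D' : rel (seq K4)) f phi :
  (forall Q l, D' Q l -> D (map L Q) (map L l)) ->
  line_values D f phi -> line_values D' (f \o L) (phi \o L).
Proof.
have lineL l : line l -> line (map L l).
  by rewrite /line size_map ksum_map => /andP[-> /eqP->]; rewrite (L_0 LD) eqxx.
move=> DD' H l1 l2 L1 L2 U A.
have [|||| e n1 n2 HQ] := H (map L l1) (map L l2); try exact: lineL.
- by rewrite -map_cat map_inj_uniq.
- by rewrite -map_cat all_map.
rewrite !vsum_map; split=> // Q /andP[sQ kQ] UQ AQ DQ; rewrite vsum_map; apply: HQ.
- by rewrite /plane size_map sQ ksum_map (eqP kQ) (L_0 LD) eqxx.
- by rewrite map_inj_uniq.
- by rewrite all_map.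
- exact: DD'.
Qed.

End Linear.

Lemma lin_e1 b1 b2 b3 b4 : lin b1 b2 b3 b4 e1 = b1.
Proof. by rewrite /lin /e1 /sel !addr0. Qed.
Lemma lin_e2 b1 b2 b3 b4 : lin b1 b2 b3 b4 e2 = b2.
Proof. by rewrite /lin /e2 /sel !addr0 add0r. Qed.
Lemma lin_e3 b1 b2 b3 b4 : lin b1 b2 b3 b4 e3 = b3.
Proof. by rewrite /lin /e3 /sel !addr0 !add0r. Qed.

Definition xcodes (c1 c2 c3 : K4) : pred K4 := fun x => x \notin [:: 0; c1; c2; c3].

Lemma third_basis : all (fun x => (x \in [:: 0; e1; e2; e1 + e2]) ||
  has (fun t => all (fun u => (u == 0) || (lin e1 e2 x t u != 0)) kl) kl) kl.
Proof. lazy. exact (erefl true). Qed.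

Lemma fano_case c1 c2 c3 f phi : c1 != 0 -> c2 != 0 -> c1 != c2 ->
  c3 \notin [:: 0; c1; c2; c1 + c2] -> (forall x, xcodes c1 c2 c3 x -> f x) ->
  line_values disj f phi -> False.
Proof.
move=> n1 n2 n12 n3 Xf H; have [b3 [b4 Linj]] := lin_basis n1 n2 n12.
have Lon x : x \in codom (lin c1 c2 b3 b4) by rewrite (inj_card_onto Linj).
have /codomP[x ex] := Lon c3.
have L1 := lin_e1 c1 c2 b3 b4; have L2 := lin_e2 c1 c2 b3 b4.
have L0 : lin c1 c2 b3 b4 0 = 0 by exact: (L_0 (linD c1 c2 b3 b4)).
have L12 : lin c1 c2 b3 b4 (e1 + e2) = c1 + c2 by rewrite linD L1 L2.
(* [lin_basis] prescribes two images only. In its coordinates [c3] is [x], and a second map fixing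
   [e1] and [e2] sends [e3] to [x]. *)
have [t Minj] : exists t, injective (lin e1 e2 x t).
  have /orP[xW|/hasP[t _ /lin_inj]] := allP third_basis x (kl_all x); last by exists t.
  case/negP: n3; rewrite ex; move: xW; rewrite !inE => /or4P[] /eqP->.
  - by rewrite L0 eqxx.
  - by rewrite L1 eqxx orbT.
  - by rewrite L2 eqxx !orbT.
  - by rewrite [lin _ _ _ _ _]L12 eqxx !orbT.
pose N := lin c1 c2 b3 b4 \o lin e1 e2 x t.
have Ninj : injective N by exact: inj_comp.
have ND u v : N (u + v) = N u + N v := etrans (congr1 _ (linD _ _ _ _ u v)) (linD _ _ _ _ _ _).
have N1 : N e1 = c1 := etrans (congr1 _ (lin_e1 _ _ _ _)) L1.
have N2 : N e2 = c2 := etrans (congr1 _ (lin_e2 _ _ _ _)) L2.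
have N3 : N e3 = c3 := etrans (congr1 _ (lin_e3 _ _ _ _)) (esym ex).
apply: (@fano_contra (f \o N) (phi \o N)).
  apply/allP=> u; rewrite mem_filter => /andP[+ _] /=; rewrite !inE !negb_or => nu.
  by apply: Xf; rewrite /xcodes !inE !negb_or -N1 -N2 -N3 -(L_0 ND) !(inj_eq Ninj).
apply: (@line_values_lin N ND Ninj disj disj f phi _ H) => Q l.
by rewrite /disj -map_cat map_inj_uniq.
Qed.

Lemma coset_case c1 c2 f phi : c1 != 0 -> c2 != 0 -> c1 != c2 ->
  (forall x, xcodes c1 c2 (c1 + c2) x -> f x) -> line_values anyD f phi -> False.
Proof.
move=> n1 n2 n12 Xf H; have [b3 [b4 Linj]] := lin_basis n1 n2 n12.
pose N := lin c1 c2 b3 b4; have ND : forall u v, N (u + v) = N u + N v := linD c1 c2 b3 b4.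
have N1 : N e1 = c1 := lin_e1 _ _ _ _.
have N2 : N e2 = c2 := lin_e2 _ _ _ _.
apply: (@coset_contra (f \o N) (phi \o N)).
  apply/allP=> u; rewrite mem_filter => /andP[+ _] /=; rewrite !inE !negb_or => nu.
  by apply: Xf; rewrite /xcodes !inE !negb_or -N1 -N2 -ND -(L_0 ND) !(inj_eq Linj).
exact: (@line_values_lin N ND Linj anyD anyD f phi _ H).
Qed.

End Lines.

(** * Sequences without zero-sum part of length 2n *)

Lemma perm_map_lift (T1 T2 : eqType) (f : T1 -> T2) s (W : seq T2) : perm_eq W (map f s) ->
  exists2 s', perm_eq s s' & W = map f s'.
Proof.
elim: W s => [|w W IHW] s pW.
  by exists [::] => //; move: (perm_size pW); case: s {pW}.
have /mapP[x sx ew] : w \in map f s by rewrite -(perm_mem pW) mem_head.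
have ps := perm_to_rem sx.
have [|s' ps' ->] := IHW (rem x s).
  by rewrite -(perm_cons w) (perm_trans pW) // ew (perm_map f ps).
by exists (x :: s'); rewrite /= ?ew // (perm_trans ps) // perm_cons.
Qed.

Lemma perm_lift (T1 T2 : eqType) (f : T1 -> T2) s (T W : seq T2) : perm_eq (T ++ W) (map f s) ->
  exists s1 s2, [/\ perm_eq s (s1 ++ s2), T = map f s1 & W = map f s2].
Proof.
move=> /perm_map_lift[s' ps eTW]; exists (take (size T) s'), (drop (size T) s').
by rewrite cat_take_drop map_take map_drop -eTW take_size_cat // drop_size_cat.
Qed.

Lemma sub_perm (T : eqType) (s X : seq T) : uniq s -> {subset s <= X} ->
  exists W, perm_eq X (s ++ W).
Proof.
elim: s X => [|x s IHs] X /=; first by exists X.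
move=> /andP[nx us] sX; have Xx : x \in X by apply: sX; rewrite mem_head.
have [y sy|W pW] := IHs (rem x X) us.
  have := sX y (mem_behead (s := x :: s) sy); rewrite (perm_mem (perm_to_rem Xx)) inE.
  by case/predU1P => // eyx; rewrite -eyx sy in nx.
by exists W; rewrite (perm_trans (perm_to_rem Xx)) // perm_cons.
Qed.

(** In the first case also a' = a, in the second b' = b: one pair consists of equal terms and
    determines the other up to order. *)
Lemma pair_type (G : zmodType) (a a' b b' h : G) : a + a' = 0 -> b + b' = h ->
  a + b = 0 \/ a + b = h -> a + b' = 0 \/ a + b' = h ->
  (a *+ 2 = 0 /\ (b = a /\ b' = a + h \/ b = a + h /\ b' = a)) \/
  (b *+ 2 = h /\ b' = b /\ (a = b /\ a' = - b \/ a = - b /\ a' = b)).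
Proof.
move=> ea eb [e1|e1] [e2|e2].
- right; split; first by lincomb (addE eb (subE e1 e2)).
  split; first by lincomb (subE e2 e1).
  by right; split; [lincomb e1|lincomb (subE ea e1)].
- left; split; first by lincomb (subE (addE e1 e2) eb).
  left; split; first by lincomb (subE eb e2).
  by lincomb (subE eb e1).
- left; split; first by lincomb (subE (addE e1 e2) eb).
  right; split; first by lincomb (subE eb e2).
  by lincomb (subE eb e1).
right; split; first by lincomb (addE eb (subE e1 e2)).
split; first by lincomb (subE e2 e1).
left; split; first by lincomb (subE e2 eb).
by lincomb (addE (subE ea e2) eb).
Qed.

Lemma double_shift (G : zmodType) (a h g : G) : a *+ 2 = 0 -> a + h + (a + h) = g -> h *+ 2 = g.
Proof. by move=> e1 e2; lincomb (subE e2 e1). Qed.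

Lemma double_opp (G : zmodType) (b h g : G) : b *+ 2 = h -> - b + - b = g -> g = - h.
Proof. by move=> <- <-; abel. Qed.

Lemma perm_types (T : eqType) (x x' y y' v w : T) X :
  (x = v /\ x' = w \/ x = w /\ x' = v) -> (y = v /\ y' = w \/ y = w /\ y' = v) ->
  perm_eq ([:: x; x'; y; y'] ++ X) [:: w, w, v, v & X].
Proof.
by case=> [[-> ->]|[-> ->]] [[-> ->]|[-> ->]]; apply/seq.permP=> f /=; clear; clia.
Qed.

Lemma count_perm (T : eqType) (R : seq T) (x : T) c : (c <= count_mem x R)%N ->
  exists R', perm_eq R (nseq c x ++ R').
Proof.
elim: c => [|c IHc] in R *; first by exists R.
move=> lec; have Rx : x \in R by rewrite -has_pred1 has_count (leq_ltn_trans _ lec).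
have pR := perm_to_rem Rx; have [|R' pR'] := IHc (rem x R).
  by move: lec; rewrite (seq.permP pR) /= eqxx.
by exists R'; rewrite (perm_trans pR) //= perm_cons.
Qed.

(** * Pairs and blocks modulo the kernel of the class map *)

Section Setting.
Variables (G : finZmodType) (cl : G -> K4) (n : nat).
Implicit Types (R S T W B X Y : seq G) (U V : seq (G * G)) (x y g h : G).
Hypothesis clD : forall x y, cl (x + y) = cl x + cl y.
Definition E : {set G} := [set x | cl x == 0].
Hypothesis cardE : #|E| = n.
Hypothesis nE : forall x, x \in E -> x *+ n = 0.

Lemma cl0 : cl 0 = 0. Proof. by apply: (addrI (cl 0)); rewrite -clD !addr0. Qed.
Lemma E0 : 0 \in E. Proof. by rewrite inE cl0. Qed.
Lemma inEE x : (x \in E) = (cl x == 0). Proof. by rewrite inE. Qed.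
Lemma ED x y : x \in E -> y \in E -> x + y \in E.
Proof. by rewrite !inEE clD => /eqP-> /eqP->; rewrite addr0. Qed.
Lemma n_gt0 : (0 < n)%N. Proof. by rewrite -cardE; exact: gt0E E0. Qed.
Lemma nE' x : x \in E -> x *+ #|E| = 0. Proof. by rewrite cardE; exact: nE. Qed.
Lemma cl_sum B : cl (\sum_(x <- B) x) = ksum [seq cl x | x <- B].
Proof. by elim: B => [|x B IHB]; rewrite ?big_nil ?cl0 // big_cons clD IHB. Qed.
Lemma clxx x y : cl x = cl y -> cl (x + y) = 0.
Proof. by move=> e; rewrite clD e K4xx. Qed.
Lemma E2 x : x + x \in E. Proof. by rewrite inEE clxx. Qed.
Lemma nE2 x : x *+ (2 * n) = 0. Proof. by rewrite mulrnA nE // mulr2n E2. Qed.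
Lemma clN x : cl (- x) = cl x.
Proof. by rewrite -[RHS]addr0 -cl0 -(subrr x) clD addrA K4xx add0r. Qed.

Definition cyclic_gen h := h \in E /\ forall j, (0 < j < n)%N -> h *+ j != 0.

Lemma cyclic_genP h : cyclic_gen h -> gen E h.
Proof. by case=> Eh gh; split=> // j; rewrite cardE; exact: gh. Qed.

Lemma cyclic_genE h x : cyclic_gen h -> x \in E -> exists2 j, (j < n)%N & x = h *+ j.
Proof. by move=> gh Ex; rewrite -cardE; exact: (genP E0 ED (cyclic_genP gh) Ex). Qed.

Lemma cyclic_gen0 h j : cyclic_gen h -> (h *+ j == 0) = (n %| j)%N.
Proof. by move=> gh; rewrite -cardE; exact: (gen_eq0 E0 nE' j (cyclic_genP gh)). Qed.

Lemma cyclic_genN0 h j : cyclic_gen h -> (0 < j < n)%N -> h *+ j != 0.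
Proof. by case=> _; apply. Qed.

Lemma sum_fl U g : all (fun p => p.1 + p.2 == g) U -> \sum_(x <- fl U) x = g *+ size U.
Proof.
elim: U => [|p U IHU] /=; first by rewrite big_nil.
by move=> /andP[/eqP ep /IHU IH]; rewrite !big_cons IH addrA ep mulrS.
Qed.

Lemma size_fl U : size (fl U) = (2 * size U)%N.
Proof. by elim: U => //= p U ->; clear; lia. Qed.

Lemma fl_cons z U : fl (z :: U) = [:: z.1, z.2 & fl U].
Proof. by []. Qed.

Lemma fl_cat U V : fl (U ++ V) = fl U ++ fl V.
Proof. by rewrite /fl map_cat flatten_cat. Qed.

Lemma perm_fl U V : perm_eq U V -> perm_eq (fl U) (fl V).
Proof. by move=> p; apply/perm_flatten/perm_map. Qed.

Lemma uniq_class X : (forall x y W, perm_eq X [:: x, y & W] -> cl x = cl y -> False) ->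
  uniq [seq cl x | x <- X].
Proof.
elim: X => //= x X IHX H; apply/andP; split.
  apply/mapP=> -[y Xy e]; apply: (H x y (rem y X)) => //.
  by rewrite perm_cons perm_to_rem.
apply: IHX => y z W pX; apply: (H y z (x :: W)).
by apply/seq.permP=> a; move/seq.permP/(_ a): pX => /=; clear; clia.
Qed.

Lemma class_pair X : ~~ uniq [seq cl x | x <- X] ->
  exists x y W, perm_eq X [:: x, y & W] /\ cl x = cl y.
Proof.
elim: X => //= x X IHX; rewrite negb_and negbK => /orP[/mapP[y Xy e]|/IHX[y [z [W [pX e]]]]].
  by exists x, y, (rem y X); rewrite perm_cons perm_to_rem.
exists y, z, (x :: W); split=> //.
by apply/seq.permP=> a; move/seq.permP/(_ a): pX => /=; clear; clia.
Qed.

(** Before the last pair is taken, |S| - 2 (q - 1) >= d + 1 terms are left, so two of them share a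
    class; hence the successor in the bound. *)
Lemma pairing d q S : (forall X, uniq [seq cl x | x <- X] -> (size X <= d)%N) ->
  (2 * q + d <= (size S).+1)%N ->
  exists (P : seq (G * G)) X, [/\ size P = q, perm_eq S (fl P ++ X) &
    all (fun p => cl p.1 == cl p.2) P].
Proof.
move=> Hd; elim: q S => [|q IHq] S szS; first by exists [::], S.
have [|x [y [W [pS e]]]] := @class_pair S.
  by apply/negP=> /Hd; lia.
have [|P [X [szP pW aP]]] := IHq W; first by have := perm_size pS => /=; lia.
exists ((x, y) :: P), X; split=> /=; rewrite ?szP ?e ?eqxx //.
by rewrite (perm_trans pS) // !perm_cons.
Qed.

Definition nozs S := forall T W, perm_eq (T ++ W) S -> size T = (2 * n)%N ->
  \sum_(x <- T) x != 0.

Definition sums U g := all (fun p => p.1 + p.2 == g) U.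

Lemma block_avoid S U V R B W h m i j : nozs S -> perm_eq S (fl U ++ fl V ++ R) ->
  sums U 0 -> sums V h -> perm_eq R (B ++ W) -> size B = (2 * m)%N ->
  (i <= size V)%N -> (j <= size U)%N -> (i + j + m = n)%N -> \sum_(x <- B) x + h *+ i != 0.
Proof.
move=> nS pS sU sV pR szB lei lej e.
have := nS (B ++ fl (take i V) ++ fl (take j U)) (W ++ fl (drop i V) ++ fl (drop j U)).
rewrite !big_cat /= !size_cat !size_fl !size_takel // szB.
rewrite (sum_fl (g := h)); last by apply/allP=> x /mem_take /(allP sV).
rewrite (sum_fl (g := 0)); last by apply/allP=> x /mem_take /(allP sU).
rewrite mul0rn addr0 size_takel //; apply; last by lia.
apply/seq.permP=> a; rewrite (seq.permP pS) !count_cat (seq.permP pR) count_cat.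
have -> : count a (fl U) = (count a (fl (take j U)) + count a (fl (drop j U)))%N.
  by rewrite -count_cat -fl_cat cat_take_drop.
have -> : count a (fl V) = (count a (fl (take i V)) + count a (fl (drop i V)))%N.
  by rewrite -count_cat -fl_cat cat_take_drop.
by clia.
Qed.

(* The value of B is constrained by padding it with pairs to the length 2n. *)
Lemma trichotomy S U V R B W h m : cyclic_gen h -> nozs S -> perm_eq S (fl U ++ fl V ++ R) ->
  sums U 0 -> sums V h -> perm_eq R (B ++ W) -> size B = (2 * m)%N -> (m <= n)%N ->
  cl (\sum_(x <- B) x) = 0 ->
  [\/ exists2 N, \sum_(x <- B) x + h *+ N = 0 & (m + N + size U < n)%N,
      exists2 N, \sum_(x <- B) x = h *+ (m + N) & (m + N + size V < n)%N |
      exists2 j, \sum_(x <- B) x = h *+ j & (0 < j < m)%N].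
Proof.
move=> gh nS pS sU sV pR szB lem clB.
have [|j ltj ej] := @cyclic_genE h (\sum_(x <- B) x) gh; first by rewrite inEE clB.
have av i k := @block_avoid S U V R B W h m i k nS pS sU sV pR szB.
have [j0|j0] := posnP j.
  apply: Or31; exists 0; first by rewrite ej j0 addr0.
  rewrite addn0 ltnNge; apply/negP=> le.
  have := av 0 (n - m)%N; rewrite ej j0 addr0 eqxx => av'.
  by suff: false by []; apply: av'; lia.
have [ltjm|lemj] := ltnP j m; first by apply: Or33; exists j; rewrite // j0.
have [ltv|lev] := ltnP (j + size V) n.
  by apply: Or32; exists (j - m)%N; rewrite subnKC.
have eN : \sum_(x <- B) x + h *+ (n - j) = 0.
  by rewrite ej -mulrnDr subnKC ?nE ?(ltnW ltj) //; case: gh.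
apply: Or31; exists (n - j)%N => //; rewrite ltnNge; apply/negP=> le.
have := av (n - j)%N (j - m)%N; rewrite eN eqxx => av'.
by suff: false by []; apply: av'; lia.
Qed.

(** Only parts of length 2n matter, and 2n t = 0. *)
Lemma nozs_translate t S : nozs S -> nozs [seq x + t | x <- S].
Proof.
move=> nS T W /perm_lift[s1 [s2 [ps -> _]]]; rewrite size_map => e.
have := nS s1 s2; rewrite perm_sym => /(_ ps e).
by rewrite big_map big_split big_const_seq count_predT iter_addr_0 e nE2 /= addr0.
Qed.

Definition rep X c := nth 0 X (index c [seq cl x | x <- X]).
Definition clset X : {set K4} := [set c | c \in [seq cl x | x <- X]].

Lemma card_clset X : uniq [seq cl x | x <- X] -> #|clset X| = size X.
Proof. by move=> u; rewrite cardsE (card_uniqP u) size_map. Qed.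

Lemma repP X c : c \in clset X -> rep X c \in X /\ cl (rep X c) = c.
Proof.
rewrite inE => Xc; have lt : (index c [seq cl x | x <- X] < size X)%N.
  by rewrite -(size_map cl) index_mem.
by split; [exact: mem_nth | rewrite -(nth_map 0 0 cl lt) nth_index].
Qed.

Lemma rep_cl X x : uniq [seq cl x | x <- X] -> x \in X -> rep X (cl x) = x.
Proof.
move=> uX Xx; have lt : (index x X < size X)%N by rewrite index_mem.
rewrite /rep -{1}(nth_index 0 Xx) -(nth_map 0 0 cl lt) index_uniq ?size_map //.
exact: nth_index.
Qed.

Lemma rep_block X Cs : uniq Cs -> all (mem (clset X)) Cs ->
  exists W, perm_eq X (map (rep X) Cs ++ W).
Proof.
move=> uC /allP aC; apply: sub_perm.
  by rewrite map_inj_in_uniq // => c d /aC/repP[_ ec] /aC/repP[_ ed] e; rewrite -ec -ed e.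
by move=> _ /mapP[c /aC/repP[Xc _] ->].
Qed.

Lemma cl_rep_block X Cs : all (mem (clset X)) Cs -> cl (\sum_(x <- map (rep X) Cs) x) = ksum Cs.
Proof.
move=> /allP aC; rewrite cl_sum -map_comp -[RHS](congr1 ksum (map_id Cs)).
by congr ksum; apply/eq_in_map => c /aC/repP[].
Qed.

Lemma vsumE (phi : K4 -> G) Cs : \sum_(x <- map phi Cs) x = vsum phi Cs.
Proof. by elim: Cs => [|c Cs IH] /=; rewrite ?big_nil // big_cons IH. Qed.

Hypothesis halve : forall e, e \in E -> exists t, t + t = e.

(** Translating by -t with 2t = p lowers every pair sum by p, so the values p and p + g become 0 and
    g. *)
Lemma normal_form S P X p g c W : nozs S -> perm_eq S (fl P ++ X) ->
  p \in E -> perm_eq [seq z.1 + z.2 | z <- P] (nseq c p ++ nseq c (p + g) ++ W) ->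
  exists S' U V X', [/\ nozs S', perm_eq S' (fl U ++ fl V ++ X'), sums U 0, sums V g &
    size U = c /\ size V = c /\ size S' = size S].
Proof.
move=> nS pS Ep; rewrite perm_sym => /perm_lift[U [Q [pP eU pQ]]].
have [V [P' [pQ' eV _]]] : exists V P', [/\ perm_eq Q (V ++ P'),
    nseq c (p + g) = [seq z.1 + z.2 | z <- V] & W = [seq z.1 + z.2 | z <- P']].
  by apply: perm_lift; rewrite -pQ.
have [t et] := halve Ep; pose f x := x - t; pose f2 (z : G * G) := (f z.1, f z.2).
have fl_f Z : fl (map f2 Z) = map f (fl Z).
  by elim: Z => // z Z IH; rewrite map_cons !fl_cons IH.
have sumsf Z k g' : nseq k (p + g') = [seq z.1 + z.2 | z <- Z] -> sums (map f2 Z) g'.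
  move=> e; rewrite /sums all_map; apply/allP=> z Zz /=.
  have : z.1 + z.2 \in nseq k (p + g') by rewrite e; apply: map_f.
  case: z {Zz} => a b /=; rewrite mem_nseq => /andP[_ /eqP ez]; rewrite /f.
  by apply/eqP; lincomb (subE ez et).
have sz Z k g' : nseq k (p + g') = [seq z.1 + z.2 | z <- Z] -> size (map f2 Z) = k.
  by move/(congr1 size); rewrite size_nseq !size_map.
exists (map f S), (map f2 U), (map f2 V), (map f (fl P' ++ X)); split.
- exact: nozs_translate.
- rewrite !fl_f -!map_cat; apply: perm_map; rewrite (perm_trans pS) //.
  have p1 := perm_fl pP; have p2 := perm_fl pQ'; rewrite !fl_cat in p1 p2.
  apply/seq.permP=> a; move: (seq.permP p1 a) (seq.permP p2 a); rewrite !count_cat; clia.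
- by apply: (sumsf _ c); rewrite addr0.
- exact: (sumsf _ c).
- by rewrite (sz _ c 0) ?addr0 // (sz _ c g) // size_map.
Qed.

Lemma pair_values P S X T W : nozs S -> perm_eq S (fl P ++ X) ->
  perm_eq (T ++ W) [seq z.1 + z.2 | z <- P] -> size T = #|E| -> \sum_(x <- T) x != 0.
Proof.
move=> nS pS /perm_lift[P1 [P2 [pP -> _]]]; rewrite size_map cardE => e.
have := nS (fl P1) (fl P2 ++ X).
have -> : \sum_(x <- fl P1) x = \sum_(x <- [seq z.1 + z.2 | z <- P1]) x.
  by elim: (P1) => [|z Z IH]; rewrite ?big_nil // fl_cons !big_cons IH addrA.
apply; last by rewrite size_fl e.
rewrite catA -fl_cat perm_sym (perm_trans pS) // perm_cat2r.
exact: perm_fl.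
Qed.

Lemma pair_valuesE P : all (fun z => cl z.1 == cl z.2) P ->
  {subset [seq z.1 + z.2 | z <- P] <= E}.
Proof. by move=> /allP aP _ /mapP[z /aP/eqP e ->]; rewrite inEE clxx. Qed.

(** Eight classes allow 2n - 2 pairs and leave 7 terms. The pair values are the extremal case k = 1
    of [egz_inverse]: two values, n - 1 times each. *)
Lemma two_values q S : (q = n - 1 /\ 2 <= n)%N -> size S = (4 * n + 3)%N ->
  (forall X, uniq [seq cl x | x <- X] -> (size X <= 8)%N) -> nozs S ->
  exists S' U V X g, [/\ nozs S', perm_eq S' (fl U ++ fl V ++ X), sums U 0, sums V g &
    [/\ size U = q, size V = q, size X = 7 & cyclic_gen g]].
Proof.
move=> [eq n2] szS H8 nS; have [|P [X [szP pS clP]]] := @pairing 8 (2 * q) S H8.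
  by rewrite szS; lia.
have vE := pair_valuesE clP; have av T W := @pair_values P S X T W nS pS.
have [||p [c [R [W [Ep pP zR RE [leR leC]]]]]] := egz_inverse E0 ED nE' (k := 1) vE _ _ av.
- by rewrite size_map szP cardE; lia.
- by rewrite cardE.
have szR : size R = q by have := size_zsf E0 ED RE zR; move: leR; rewrite !cardE; clear -eq; clia.
have [|g eR] := zsf_max E0 ED RE zR; first by rewrite addn1 in leR.
rewrite eR map_nseq szR addrC in pP.
have c1 : (q <= c)%N.
  apply: leq_trans (leC (p + g)); rewrite (seq.permP pP) !count_cat !count_nseq /= eqxx mul1n.
  by move: (count _ W) ((_ == _) * c)%N => i j; lia.
have sz := perm_size pP; rewrite !size_cat !size_nseq size_map szP in sz.
have ec : c = q by lia.
rewrite ec in pP.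
have [S' [U [V [X' [nS' pS' sU sV [szU [szV szS']]]]]]] := normal_form nS pS Ep pP.
exists S', U, V, X', g; split=> //; split=> //.
  have := perm_size pS'; rewrite !size_cat !size_fl szU szV szS' szS; clear -eq n2; clia.
have gE : g \in E by apply: RE; rewrite eR mem_nseq szR eqxx andbT; lia.
split=> // j j0; rewrite eR szR in zR; apply: (zsf_nseq zR); clear -j0 eq; lia.
Qed.

Lemma s_two (H : {set K4}) S : (2 <= n)%N -> {in H &, forall c d, c + d \in H} ->
  #|H| = 8%N -> (forall x, cl x \in H) -> size S = (4 * n + 3)%N -> nozs S -> False.
Proof.
move=> n2 HD cH clH szS nS0.
have [||S' [U [V [X [h [nS pS sU sV [szU szV szX gh]]]]]]] := @two_values (n - 1) S _ szS _ nS0.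
- by [].
- move=> X uX; rewrite -(size_map cl) -(card_uniqP uX) -cH.
  by apply/subset_leq_card/subsetP=> _ /mapP[x _ ->].
move=> {S szS nS0}; have h0 : h != 0 by rewrite -[h]mulr1n (cyclic_genN0 gh).
(* With n - 1 pairs of sum h and at least n - 2 of sum 0, [trichotomy] leaves little choice: a block
   of 4 has sum h, and a block of 2 has sum 0 and exists only after a pair of sum 0 was given up. *)
have val U' X' B W m : sums U' 0 -> perm_eq S' (fl U' ++ fl V ++ X') -> (n - 2 <= size U')%N ->
    perm_eq X' (B ++ W) -> size B = (2 * m)%N -> (0 < m <= 2)%N -> cl (\sum_(x <- B) x) = 0 ->
    (m = 1%N /\ \sum_(x <- B) x = 0 /\ (size U' + 1 < n)%N) \/ (m = 2%N /\ \sum_(x <- B) x = h).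
  move=> sU' pS' szU' pX' szB m2 clB.
  have lemn : (m <= n)%N by clear -m2 n2; lia.
  have [[N e lt]|[N e lt]|[j e lt]] := trichotomy gh nS pS' sU' sV pX' szB lemn clB.
  - left; have [m1 N0] : m = 1%N /\ N = 0%N by clear -m2 lt szU'; clia.
    rewrite N0 mulr0n addr0 in e; split=> //; split=> //.
    by clear -lt m1 N0; clia.
  - by case/negP: (ltn_geF lt); clear -m2 szV; clia.
  - right; have [-> j1] : m = 2%N /\ j = 1%N by clear -m2 lt; lia.
    by split=> //; rewrite e j1.
have szUn : (n - 2 <= size U)%N by rewrite szU leq_sub2l.
have uX : uniq [seq cl x | x <- X].
  apply: uniq_class => x y W pX exy.
  have [|[_ [_ lt]]|[//]] := @val U X [:: x; y] W 1 sU pS szUn pX erefl isT.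
    by rewrite big_cons big_seq1 clxx.
  by move: lt; rewrite szU; clear -n2; lia.
have cX := card_clset uX; rewrite szX in cX.
have XH : clset X \subset H.
  by apply/subsetP=> c; rewrite inE => /mapP[x _ ->].
have plX : planes (mem (clset X)) (rep X) h.
  move=> a b c d uC aC s0; have [W pW] := rep_block uC aC.
  have [|[//]|[_ <-]] := @val U X _ W 2 sU pS szUn pW erefl isT.
    by rewrite (cl_rep_block aC) /= addr0 !addrA.
  by rewrite vsumE /= addr0 !addrA.
have v4 c : c \in clset X -> rep X c *+ 4 = h.
  by apply: (planes_big HD XH _ plX); rewrite cH cX.
case: U sU pS szU szUn => [|[a a'] U].
  by move=> _ _ /=; clear -n2; lia.
rewrite {1}/sums fl_cons => /= /andP[/eqP /= eaa sU] pS szU _.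
have eclaa : cl a' = cl a by rewrite -(clN a); congr cl; lincomb eaa.
(* The pair is given up and [y] joins the leftover terms. If its class is taken, the leftover term
   of that class is -y = y'; if not, the classes fill [H] and 4y = h as for the others. *)
have pull y y' : perm_eq [:: a; a'] [:: y; y'] ->
    (y' \in X) \/ (cl y \notin clset X /\ y *+ 4 = h).
  move=> pa; have pY : perm_eq S' (fl U ++ fl V ++ (y :: X ++ [:: y'])).
    rewrite (perm_trans pS) //; apply/seq.permP=> q; move: (seq.permP pa q) => /=.
    by rewrite !count_cat /= count_cat /=; clear; clia.
  have szU2 : (n - 2 <= size U)%N by clear -szU; lia.
  have [Xy|nXy] := boolP (cl y \in clset X).
    left; have [Xc ec] := repP Xy.
    suff e : y + rep X (cl y) = 0.
      suff -> : y' = rep X (cl y) by [].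
      apply: (addrI y); rewrite e -[RHS]eaa.
      have : \sum_(x <- [:: y; y']) x = \sum_(x <- [:: a; a']) x.
        by apply: perm_big; rewrite perm_sym.
      by rewrite !big_cons !big_nil !addr0.
    have [||[_ [e' _]]|[//]] := @val U _ [:: y; rep X (cl y)] (rem (rep X (cl y)) X ++ [:: y']) 1 sU pY szU2 _ erefl isT.
    - rewrite /= perm_cons -cat_cons perm_cat2r; exact: perm_to_rem.
    - by rewrite big_cons big_seq1 clxx.
    by rewrite -e' big_cons big_seq1.
  right; split=> //; have uY : uniq [seq cl x | x <- y :: X].
    by rewrite /= uX andbT; move: nXy; rewrite inE.
  have cY : #|clset (y :: X)| = 8%N by rewrite card_clset //= szX.
  have YH : clset (y :: X) \subset H.
    by apply/subsetP=> c; rewrite inE => /mapP[x _ ->].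
  have plY : planes (mem (clset (y :: X))) (rep (y :: X)) h.
    move=> b1 b2 b3 b4 uC aC s0; have [W pW] := rep_block uC aC.
    have [||[//]|[_ <-]] := @val U _ (map (rep (y :: X)) [:: b1; b2; b3; b4]) (W ++ [:: y']) 2 sU pY szU2 _ erefl isT.
      by rewrite catA -cat_cons perm_cat2r.
      by rewrite (cl_rep_block aC) /= addr0 !addrA.
    by rewrite vsumE /= addr0 !addrA.
  have yY : y \in y :: X by rewrite mem_head.
  rewrite -{1}(rep_cl uY yY); apply: (planes_big HD YH _ plY).
    by rewrite cH cY.
  by rewrite inE map_f.
have pa' : perm_eq [:: a; a'] [:: a'; a] by apply/seq.permP=> q /=; clear; clia.
have yX (y : G) : y \in X -> cl y \in clset X by move=> Xy; rewrite inE map_f.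
have [Xa'|[nXa a4]] := pull a a' (perm_refl _).
  have [Xa|[]] := pull _ _ pa'; last by rewrite yX.
  have ea : a = a' by rewrite -(rep_cl uX Xa) -(rep_cl uX Xa') eclaa.
  case/negP: h0; rewrite -(v4 (cl a)) ?yX // rep_cl //.
  have a2 : a + a = 0 by rewrite {2}ea.
  by apply/eqP; lincomb (mulE 2 a2).
have [Xa|[_ a4']] := pull _ _ pa'; first by rewrite yX in nXa.
(* Now 4a = 4a' = h and a + a' = 0 give 2h = 0, so n = 2; but then 4a, twice the element 2a of [E],
   vanishes. *)
have : h *+ 2 == 0.
  by apply/eqP; lincomb (subE (mulE 4 eaa) (addE a4 a4')).
rewrite cyclic_gen0 // => /dvdn_leq n2'; case/negP: h0; rewrite -a4 (mulrnA a 2 2).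
have := nE (E2 a); have -> : n = 2%N by have := n2' isT; clear -n2; lia.
by move=> e2; apply/eqP; lincomb e2.
Qed.

(** * Configurations of pairs and blocks, and their potential *)

Section Config.
Variables (S : seq G) (h : G).
Hypotheses (gh : cyclic_gen h) (nS : nozs S) (szS : size S = (4 * n + 5)%N).

(* U and V are the pairs of sum 0 and h in use; D0 and D1 collect the blocks of sum
   - N h and (m + N) h found so far.  The potential mu never exceeds 2n - 2, and every
   block of leftover terms of one of these two kinds increases it. *)
Definition cfg U V mu X := exists D0 D1 m0 N0 m1 N1,
  [/\ perm_eq S (fl U ++ fl V ++ (D0 ++ D1 ++ X)), sums U 0 /\ sums V h,
      size D0 = (2 * m0)%N /\ size D1 = (2 * m1)%N,
      \sum_(x <- D0) x + h *+ N0 = 0 /\ \sum_(x <- D1) x = h *+ (m1 + N1) &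
      [/\ (size U + m0 + N0 < n)%N, (size V + m1 + N1 < n)%N &
          (mu <= size U + size V + m0 + N0 + m1 + N1)%N]].

(** |U| + m0 and |V| + m1 are at most n - 1, so at most 4n - 4 of the 4n + 5 terms are in use. *)
Lemma cfg_size U V mu X : cfg U V mu X -> (9 <= size X)%N.
Proof.
case=> D0 [D1 [m0 [N0 [m1 [N1 [pS _ [e0 e1] _ [lt0 lt1 _]]]]]]].
have := perm_size pS; rewrite !size_cat !size_fl szS e0 e1; clear -lt0 lt1; clia.
Qed.

Lemma cyclic_gen_sum N : cyclic_gen h -> h *+ N = 0 -> (0 < N)%N -> (n <= N)%N.
Proof. by move=> g /eqP; rewrite cyclic_gen0 // => /dvdn_leq H N0; exact: H. Qed.

Lemma cyclic_gen_inj M N : cyclic_gen h -> h *+ M = h *+ N -> (M < n + N)%N -> (N < n + M)%N -> M = N.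
Proof.
move=> g; wlog le : M N / (M <= N)%N => [H e ltM ltN|e _ ltN].
  by have [/H|/ltnW/H e'] := leqP M N; [apply | apply/esym/e'].
apply/eqP; rewrite eqn_leq le leqNgt; apply/negP=> lt.
have : (n <= N - M)%N.
  by apply: cyclic_gen_sum; rewrite ?subn_gt0 // mulrnBr // e subrr.
by clear -ltN lt; lia.
Qed.

(** The block is merged with [D0] or [D1] according to its kind, and [trichotomy] is applied again
    to the result. As [U] and [V] are large, no coefficient can wrap around modulo n, so the merged
    block keeps its kind and the coefficients add up. *)
Lemma cfg_ext U V mu X B W m : cfg U V mu X ->
  (2 * n <= 2 * size U + size V + 3)%N -> (2 * n <= size U + 2 * size V + 3)%N ->
  perm_eq X (B ++ W) -> size B = (2 * m)%N -> (0 < m)%N -> (m <= n)%N -> cl (\sum_(x <- B) x) = 0 ->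
  (exists2 j, \sum_(x <- B) x = h *+ j & (0 < j < m)%N) \/
  exists2 N, \sum_(x <- B) x + h *+ N = 0 \/ \sum_(x <- B) x = h *+ (m + N) &
    cfg U V (mu + (m + N))%N W.
Proof.
case=> D0 [D1 [m0 [N0 [m1 [N1 [pS [sU sV] [sz0 sz1] [sE0 sE1] [lt0 lt1 lemu]]]]]]] u2 v2 pX szB m0' lemn clB.
have hE : h \in E by case: gh.
have cE0 : cl (\sum_(x <- D0) x) = 0.
  apply/eqP; rewrite -inEE; have -> : \sum_(x <- D0) x = - (h *+ N0) by lincomb sE0.
  by rewrite inEE clN -inEE; apply: (EMn E0 ED N0 hE).
have cE1 : cl (\sum_(x <- D1) x) = 0.
  by apply/eqP; rewrite -inEE sE1; apply: (EMn E0 ED _ hE).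
have pB : perm_eq (D0 ++ D1 ++ X) (B ++ D0 ++ D1 ++ W).
  by apply/seq.permP=> a; move/seq.permP/(_ a): pX; rewrite !count_cat; clear; clia.
have pB0 : perm_eq (D0 ++ D1 ++ X) ((D0 ++ B) ++ D1 ++ W).
  by apply/seq.permP=> a; move/seq.permP/(_ a): pX; rewrite !count_cat; clear; clia.
have pB1 : perm_eq (D0 ++ D1 ++ X) ((D1 ++ B) ++ D0 ++ W).
  by apply/seq.permP=> a; move/seq.permP/(_ a): pX; rewrite !count_cat; clear; clia.
have [[N e lt]|[N e lt]|] := trichotomy gh nS pS sU sV pB szB lemn clB; last by left.
- right; exists N; first by left.
  have szE : size (D0 ++ B) = (2 * (m0 + m))%N by rewrite size_cat sz0 szB mulnDr.
  have leE : (m0 + m <= n)%N by clear -lt lt0 lt1 u2 m0'; clia.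
  have clE : cl (\sum_(x <- D0 ++ B) x) = 0 by rewrite big_cat clD cE0 clB addr0.
  have eE : \sum_(x <- D0 ++ B) x + h *+ (N0 + N) = 0.
    by rewrite big_cat mulrnDr addrACA sE0 e addr0.
  have lt' : (size U + (m0 + m) + (N0 + N) < n)%N.
    have [[N' e' ltN']|[N' e' ltN']|[j e' ltj]] := trichotomy gh nS pS sU sV pB0 szE leE clE.
    - suff -> : (N0 + N = N')%N by clear -ltN'; clia.
      apply: (cyclic_gen_inj gh (addrI _ (etrans eE (esym e')))).
        by clear -lt lt0 lt1 u2 m0'; clia.
      by clear -lt0 lt1 u2 ltN'; clia.
    - have : (n <= m0 + m + N' + (N0 + N))%N.
        apply: cyclic_gen_sum => //; last by clear -m0'; lia.
        by rewrite mulrnDr -e' eE.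
      by clear -lt lt0 lt1 u2 ltN' m0'; clia.
    have : (n <= j + (N0 + N))%N.
      apply: cyclic_gen_sum => //; last by clear -ltj; lia.
      by rewrite mulrnDr -e' eE.
    by clear -lt lt0 lt1 u2 ltj; clia.
  exists (D0 ++ B), D1, (m0 + m)%N, (N0 + N)%N, m1, N1; split=> //.
    rewrite (perm_trans pS) //; apply/seq.permP=> a; move/seq.permP/(_ a): pX.
    by rewrite !count_cat; clear; clia.
  by split=> //; clear -lemu; clia.
- right; exists N; first by right.
  have szE : size (D1 ++ B) = (2 * (m1 + m))%N by rewrite size_cat sz1 szB mulnDr.
  have leE : (m1 + m <= n)%N by clear -lt lt0 lt1 v2 m0'; clia.
  have clE : cl (\sum_(x <- D1 ++ B) x) = 0 by rewrite big_cat clD cE1 clB addr0.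
  have eE : \sum_(x <- D1 ++ B) x = h *+ (m1 + m + (N1 + N)).
    by rewrite big_cat /= sE1 e -mulrnDr; congr (_ *+ _); clear; lia.
  have lt' : (size V + (m1 + m) + (N1 + N) < n)%N.
    have [[N' e' ltN']|[N' e' ltN']|[j e' ltj]] := trichotomy gh nS pS sU sV pB1 szE leE clE.
    - have : (n <= m1 + m + (N1 + N) + N')%N.
        apply: cyclic_gen_sum => //; last by clear -m0'; lia.
        by rewrite mulrnDr -eE.
      by clear -lt lt0 lt1 v2 ltN' m0'; clia.
    - suff -> : (N1 + N = N')%N by clear -ltN'; clia.
      suff : (m1 + m + (N1 + N) = m1 + m + N')%N by clear; lia.
      apply: (cyclic_gen_inj gh (etrans (esym eE) e')).
        by clear -lt lt0 lt1 v2 m0'; clia.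
      by clear -lt0 lt1 v2 ltN'; clia.
    have : (n <= m1 + m + (N1 + N) - j)%N.
      apply: cyclic_gen_sum => //; last by clear -ltj; lia.
      by rewrite mulrnBr -?eE ?e' ?subrr //; clear -ltj; lia.
    by clear -lt lt0 lt1 v2 ltj; clia.
  exists D0, (D1 ++ B), m0, N0, (m1 + m)%N, (N1 + N)%N; split=> //.
    rewrite (perm_trans pS) //; apply/seq.permP=> a; move/seq.permP/(_ a): pX.
    by rewrite !count_cat; clear; clia.
  by split=> //; clear -lemu; clia.
Qed.

(** * A configuration whose potential cannot be raised at the cost of two pairs *)

Section Step.
Variables (U V : seq (G * G)) (mu : nat) (X : seq G).
Hypotheses (C : cfg U V mu X) (mu2 : (2 <= mu)%N) (n4 : (4 <= n)%N).
(** The 4 keeps the bounds of [cfg_ext] valid after two pairs of the same kind are given up. *)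
Hypotheses (bu : (2 * n + 4 <= 2 * size U + size V + 3)%N)
  (bv : (2 * n + 4 <= size U + 2 * size V + 3)%N).
Hypothesis noimp : forall U' V' X', (size U <= size U' + 2)%N -> (size V <= size V' + 2)%N ->
  (size U + size V <= size U' + size V' + 2)%N -> ~ cfg U' V' mu.+1 X'.

Definition pulled d Z := exists Ud U' Vd V',
  [/\ perm_eq U (Ud ++ U'), perm_eq V (Vd ++ V'), (size Ud + size Vd = d)%N &
      perm_eq (fl Ud ++ fl Vd) Z].

Lemma pulled_cfg d Z : pulled d Z -> (d <= 2)%N -> exists U' V',
  [/\ cfg U' V' (mu - d) (Z ++ X), (size U <= size U' + d)%N, (size V <= size V' + d)%N &
      (size U + size V = size U' + size V' + d)%N].
Proof.
case=> Ud [U' [Vd [V' [pU pV sd pZ]]]] d2; exists U', V'.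
have szU := perm_size pU; have szV := perm_size pV; rewrite !size_cat in szU szV.
split; [|by clear -szU szV sd; clia..].
case: C => D0 [D1 [m0 [N0 [m1 [N1 [pS [sU sV] sz sE [lt0 lt1 lemu]]]]]]].
exists D0, D1, m0, N0, m1, N1; split=> //.
- rewrite (perm_trans pS) //; have := perm_fl pU; have := perm_fl pV; rewrite !fl_cat => pfV pfU.
  apply/seq.permP=> a; move: (seq.permP pfU a); move: (seq.permP pfV a); move: (seq.permP pZ a).
  by rewrite !count_cat; clear; clia.
- by move: sU sV; rewrite /sums (perm_all _ pU) (perm_all _ pV) !all_cat => /andP[_ ->] /andP[_ ->].
- by split; clear -szU szV sd d2 lt0 lt1 lemu; clia.
Qed.

(** Giving up d pairs lowers the potential by d and the block raises it by m + N; by [noimp] the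
    gain cannot exceed the loss. *)
Lemma pulled_block d Z B W m : pulled d Z -> (d <= 2)%N -> perm_eq (Z ++ X) (B ++ W) ->
  size B = (2 * m)%N -> (0 < m)%N -> (m <= n)%N -> cl (\sum_(x <- B) x) = 0 ->
  (exists2 j, \sum_(x <- B) x = h *+ j & (0 < j < m)%N) \/
  exists2 N, \sum_(x <- B) x + h *+ N = 0 \/ \sum_(x <- B) x = h *+ (m + N) & (m + N <= d)%N.
Proof.
move=> pZ d2 pB szB m0 lemn clB; have [U' [V' [C' ltU ltV ltUV]]] := pulled_cfg pZ d2.
have [||?|[N eN CN]] := cfg_ext C' _ _ pB szB m0 lemn clB; [| |by left|].
- by clear -bu ltU ltUV d2; clia.
- by clear -bv ltV ltUV d2; clia.
right; exists N => //; rewrite leqNgt; apply/negP=> lt.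
apply: (@noimp U' V' W); [by clear -ltU ltV ltUV d2; clia..|].
case: CN => D0 [D1 [m0' [N0 [m1 [N1 [pS sUV sz sE [lt0 lt1 lemu]]]]]]].
exists D0, D1, m0', N0, m1, N1; split=> //; split=> //.
by clear -lemu mu2 d2 lt; clia.
Qed.

(** Two blocks of length 2 already make up for the two pairs given up, so N = 0 for the first of
    them. *)
Lemma pulled_blocks Z x y z w W : pulled 2 Z -> perm_eq (Z ++ X) [:: x, y, z, w & W] ->
  cl (x + y) = 0 -> cl (z + w) = 0 -> x + y = 0 \/ x + y = h.
Proof.
move=> pZ pB cxy czw; have [U' [V' [C' ltU ltV ltUV]]] := pulled_cfg pZ (leqnn 2).
have n1 : (1 <= n)%N by exact: n_gt0.
have b1 : (2 * n <= 2 * size U' + size V' + 3)%N by clear -bu ltU ltUV; clia.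
have b2 : (2 * n <= size U' + 2 * size V' + 3)%N by clear -bv ltV ltUV; clia.
have [|[j _ ltj]|[N eN CN]] := @cfg_ext U' V' _ _ [:: x; y] [:: z, w & W] 1 C' b1 b2 pB erefl isT n1.
- by rewrite big_cons big_seq1.
- by clear -ltj; lia.
rewrite big_cons big_seq1 in eN.
have [|[j _ ltj]|[N' eN' CN']] := @cfg_ext U' V' _ _ [:: z; w] W 1 CN b1 b2 (perm_refl _) erefl isT n1.
- by rewrite big_cons big_seq1.
- by clear -ltj; lia.
have N0 : N = 0%N.
  apply/eqP; rewrite -leqn0 leqNgt; apply/negP=> N0; apply: (@noimp U' V' W); [by clear -ltU ltV ltUV; clia..|].
  case: CN' => D0 [D1 [m0' [N0' [m1 [N1 [pS sUV sz sE [lt0 lt1 lemu]]]]]]].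
  exists D0, D1, m0', N0', m1, N1; split=> //; split=> //.
  by clear -lemu mu2 N0; clia.
by rewrite N0 addr0 in eN.
Qed.

Lemma pulled0 : pulled 0 [::].
Proof. by exists [::], U, [::], V. Qed.

Lemma pulledU1 a : a \in U -> pulled 1 [:: a.1; a.2].
Proof.
by move=> Ua; exists [:: a], (rem a U), [::], V; split; rewrite // perm_to_rem.
Qed.

Lemma pulledV1 a : a \in V -> pulled 1 [:: a.1; a.2].
Proof.
by move=> Va; exists [::], U, [:: a], (rem a V); split; rewrite // perm_to_rem.
Qed.

Lemma uniq_leftover : uniq [seq cl x | x <- X].
Proof.
apply: uniq_class => x y W pX exy.
have [|[j _ ltj]|[N _ ltN]] := @pulled_block 0 [::] [:: x; y] W 1 pulled0 isT pX erefl isT n_gt0.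
- by rewrite big_cons big_seq1 clxx.
- by clear -ltj; lia.
- by clear -ltN; lia.
Qed.

(** For m >= 2 and d <= 1 the bound m + N <= d fails, so only the sums j h with 0 < j < m remain. *)
Lemma pulled_planes d Z Y W : pulled d Z -> (d <= 1)%N -> perm_eq (Z ++ X) (Y ++ W) ->
  planes (mem (clset Y)) (rep Y) h /\ blocks6 (mem (clset Y)) (rep Y) h.
Proof.
move=> pZ d1 pY; have d2 := leq_trans d1 (leqnSn 1).
have blk B W' m : perm_eq Y (B ++ W') -> size B = (2 * m)%N -> (2 <= m <= 3)%N ->
    cl (\sum_(x <- B) x) = 0 -> exists2 j, \sum_(x <- B) x = h *+ j & (0 < j < m)%N.
  move=> pB szB m23 clB.
  have pB' : perm_eq (Z ++ X) (B ++ (W' ++ W)).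
    by rewrite (perm_trans pY) // catA perm_cat2r.
  have [||//|[N _ ltN]] := pulled_block pZ d2 pB' szB _ _ clB.
  - by clear -m23; lia.
  - by clear -m23 n4; lia.
  - by clear -m23 ltN d1; lia.
split=> [a b c d' uC aC s0|a b c d' x y uC aC s0].
  have [W' pW] := rep_block uC aC.
  have [|j e ltj] := @blk _ W' 2 pW erefl isT.
    by rewrite (cl_rep_block aC) /= addr0 !addrA.
  have j1 : j = 1%N by clear -ltj; lia.
  by move: e; rewrite j1 mulr1n => <-; rewrite vsumE /= addr0 !addrA.
have [W' pW] := rep_block uC aC.
have [|j e ltj] := @blk _ W' 3 pW erefl isT.
  by rewrite (cl_rep_block aC) /= addr0 !addrA.
move: e; rewrite vsumE /= addr0 !addrA => ->.
have [->|->] : j = 1%N \/ j = 2%N by clear -ltj; lia.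
  by left.
by right.
Qed.

Lemma h_mul N : (0 < N < n)%N -> h *+ N != 0.
Proof. exact: cyclic_genN0. Qed.

Lemma nine_leftover : #|clset X| = 9%N /\
  exists q, forall p, p \in clset X -> p != q -> rep X p *+ 4 = h.
Proof.
have h0 : h != 0 by rewrite -[h]mulr1n h_mul //; clear -n4; lia.
have [|pl b6] := @pulled_planes 0 [::] X [::] pulled0 isT; first by rewrite cats0.
have c9 : (8 < #|clset X|)%N by rewrite (card_clset uniq_leftover) (cfg_size C).
have [-> [q Hq]] := nine_points_value h0 c9 pl b6; split=> //; exists q => p Xp npq.
exact: (tri_value pl Xp (Hq p Xp npq)).
Qed.

(** A new class would be a tenth point. In the class of a leftover term c with 4c = h, the sums y +
    c, y' + c and y + y' are all 0 or h, so h = 4c would be an even multiple of h between -2h and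
    4h, and h = 0 or 3h = 0. *)
Lemma pulled_class q y y' : (forall p, p \in clset X -> p != q -> rep X p *+ 4 = h) ->
  pulled 1 [:: y; y'] -> y + y' = 0 \/ y + y' = h -> cl y = q.
Proof.
move=> Hq pZ es; apply/eqP/negP=> nyq.
have h0 : h != 0 by rewrite -[h]mulr1n h_mul //; clear -n4; lia.
have hE : h \in E by case: gh.
have eyy : cl y' = cl y.
  rewrite -[LHS]addr0 -(K4xx (cl y)) addrA -clD (addrC y').
  by case: es => ->; rewrite ?cl0 ?add0r //; move: hE; rewrite inEE => /eqP->; rewrite add0r.
have [Xy|nXy] := boolP (cl y \in clset X); last first.
  have uY : uniq [seq cl x | x <- y :: X].
    by rewrite /= uniq_leftover andbT; move: nXy; rewrite inE.
  have [pl b6] := @pulled_planes 1 [:: y; y'] (y :: X) [:: y'] pZ isT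
    ltac:(by apply/seq.permP=> a; rewrite /= count_cat /=; clear; clia).
  apply: (ten_points h0 _ pl b6).
  by rewrite (card_clset uY) /= ltnS (cfg_size C).
have [Xc ec] := repP Xy; set c := rep X (cl y) in Xc ec.
have c4 : c *+ 4 = h by apply: Hq => //; apply/negP.
have blk z z' : perm_eq [:: y; y'] [:: z; z'] -> cl z = cl y -> z + c = 0 \/ z + c = h.
  move=> pz ez.
  have pB : perm_eq ([:: y; y'] ++ X) ([:: z; c] ++ (z' :: rem c X)).
    apply/seq.permP=> a; move: (seq.permP pz a) (seq.permP (perm_to_rem Xc) a).
    by rewrite !count_cat /= ; clear; clia.
  have [|[j _ ltj]|[N e ltN]] := @pulled_block 1 _ _ _ 1 pZ isT pB erefl isT n_gt0.
  - by rewrite big_cons big_seq1 clxx // ec.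
  - by clear -ltj; lia.
  have N0 : N = 0%N by clear -ltN; lia.
  by rewrite big_cons big_seq1 N0 addr0 in e.
have e1 := blk y y' (perm_refl _) erefl.
have e2 : y' + c = 0 \/ y' + c = h.
  by apply: (blk y' y) => //; apply/seq.permP=> a /=; clear; clia.
have n1 : h *+ 1 != 0 by apply: h_mul; clear -n4; lia.
have n3 : h *+ 3 != 0 by apply: h_mul; clear -n4; lia.
move: n1 n3; case: e1 => e1; case: e2 => e2; case: es => es; move=> /eqP n1 /eqP n3;
  have e3 := subE (subE (mulE 2 (addE e1 e2)) (mulE 2 es)) c4; have e4 := esym e3;
  solve [apply: n1; lincomb e3 | apply: n1; lincomb e4 | apply: n3; lincomb e3 | apply: n3; lincomb e4].
Qed.

(** All pairs have class q, so any two of their terms form a block. By [pair_type], regrouping two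
    pairs of the same sum yields a block of sum 2h or -h, where [pulled_blocks] admits only 0 and
    h. *)
Lemma step_contra : False.
Proof.
have [c9 [q Hq]] := nine_leftover.
case: (C) => D0 [D1 [m0 [N0 [m1 [N1 [_ [sU sV] _ _ [lt0 lt1 _]]]]]]].
case eU : U => [|p1 [|p2 U0]]; [by move: lt1 bu; rewrite eU /=; clear; clia..|].
case eV : V => [|q1 [|q2 V0]]; [by move: lt0 bv; rewrite eV /=; clear; clia..|].
have Up1 : p1 \in U by rewrite eU mem_head.
have Up2 : p2 \in U by rewrite eU !inE eqxx orbT.
have Vq1 : q1 \in V by rewrite eV mem_head.
have Vq2 : q2 \in V by rewrite eV !inE eqxx orbT.
have sumU p : p \in U -> p.1 + p.2 = 0 by move=> Up; exact/eqP/(allP sU).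
have sumV p : p \in V -> p.1 + p.2 = h by move=> Vp; exact/eqP/(allP sV).
have pC (x y : G) : perm_eq [:: x; y] [:: y; x].
  by apply/seq.permP=> f /=; clear; clia.
have pulledC (x y : G) : pulled 1 [:: x; y] -> pulled 1 [:: y; x].
  case=> Ud [U' [Vd [V' [pU pV sd pZ]]]]; exists Ud, U', Vd, V'; split=> //.
  exact: perm_trans pZ (pC x y).
have clU p : p \in U -> cl p.1 = q /\ cl p.2 = q.
  move=> Up; split; first by apply: (pulled_class Hq (pulledU1 Up)); left; exact: sumU.
  by apply: (pulled_class Hq (pulledC _ _ (pulledU1 Up))); left; rewrite addrC; exact: sumU.
have clV p : p \in V -> cl p.1 = q /\ cl p.2 = q.
  move=> Up; split; first by apply: (pulled_class Hq (pulledV1 Up)); right; exact: sumV.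
  by apply: (pulled_class Hq (pulledC _ _ (pulledV1 Up))); right; rewrite addrC; exact: sumV.
have clqq (x y : G) : cl x = q -> cl y = q -> cl (x + y) = 0 by move=> ex ey; rewrite clxx // ex ey.
have mix p r : p \in U -> r \in V ->
    (p.1 + r.1 = 0 \/ p.1 + r.1 = h) /\ (p.1 + r.2 = 0 \/ p.1 + r.2 = h).
  move=> Up Vr; have [cp cp'] := clU p Up; have [cr cr'] := clV r Vr.
  have pZ : pulled 2 [:: p.1; p.2; r.1; r.2].
    exists [:: p], (rem p U), [:: r], (rem r V).
    by split; rewrite //= perm_to_rem.
  split.
    apply: (@pulled_blocks _ _ _ p.2 r.2 X pZ _ (clqq _ _ cp cr) (clqq _ _ cp' cr')).
    by apply/seq.permP=> f /=; clear; clia.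
  apply: (@pulled_blocks _ _ _ p.2 r.1 X pZ _ (clqq _ _ cp cr') (clqq _ _ cp' cr)).
  by apply/seq.permP=> f /=; clear; clia.
have type p r : p \in U -> r \in V -> _ := fun Up Vr =>
  pair_type (sumU p Up) (sumV r Vr) (mix p r Up Vr).1 (mix p r Up Vr).2.
have n1 : h <> 0 by apply/eqP; rewrite -[h]mulr1n h_mul //; clear -n4; lia.
have n2 : h *+ 2 <> 0 by apply/eqP; apply: h_mul; clear -n4; lia.
have clh : cl h = 0 by case: gh => + _; rewrite inEE => /eqP.
have [[a2 t1]|[b2 [eb t1]]] := type p1 q1 Up1 Vq1.
  have [[_ t2]|[c2 [_ [[e _]|[e _]]]]] := type p1 q2 Up1 Vq2.
  - have pZ : pulled 2 [:: q1.1; q1.2; q2.1; q2.2].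
      by exists [::], U, [:: q1; q2], V0; split; rewrite // eV.
    have [ca _] := clU p1 Up1.
    have ch : cl (p1.1 + h) = q by rewrite clD clh addr0.
    have [|e|e] := @pulled_blocks _ (p1.1 + h) (p1.1 + h) p1.1 p1.1 X pZ _ (clqq _ _ ch ch) (clqq _ _ ca ca).
    + exact: perm_types t1 t2.
    + exact: n2 (double_shift a2 e).
    by apply: n1; have e' := double_shift a2 e; lincomb e'.
  - by apply: n1; rewrite -c2 -e a2.
  by apply: n1; rewrite -c2 -[_ *+ 2]opprK -mulNrn -e a2 oppr0.
have [[c2 t2]|[_ [_ t2]]] := type p2 q1 Up2 Vq1.
  apply: n1; case: t2 => [[e _]|[_ e]]; first by rewrite -b2 e c2.
  by rewrite -b2 -eb e c2.
have pZ : pulled 2 [:: p1.1; p1.2; p2.1; p2.2].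
  by exists [:: p1; p2], U0, [::], V; split; rewrite // eU.
have [cb _] := clV q1 Vq1; have cb' : cl (- q1.1) = q by rewrite clN.
have [|e|e] := @pulled_blocks _ (- q1.1) (- q1.1) q1.1 q1.1 X pZ _ (clqq _ _ cb' cb') (clqq _ _ cb cb).
- exact: perm_types t1 t2.
- by apply: n1; have e' := double_opp b2 e; lincomb e'.
by apply: n2; have e' := double_opp b2 e; lincomb e'.
Qed.

End Step.

(** The potential never exceeds 2n - 2, so it can be raised fewer than k times. A raise costs at
    most two pairs, which is 4 in each bound. *)
Lemma cfg_contra k U V mu X : cfg U V mu X -> (2 * n - 2 < mu + k)%N -> (2 <= mu)%N ->
  (4 <= n)%N -> (2 * n + 4 * k <= 2 * size U + size V + 3)%N ->
  (2 * n + 4 * k <= size U + 2 * size V + 3)%N -> False.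
Proof.
elim: k U V mu X => [|k IHk] U V mu X C ltmu mu2 n4 bu bv.
  case: C => D0 [D1 [m0 [N0 [m1 [N1 [_ _ _ _ [lt0 lt1 lemu]]]]]]].
  by clear -lt0 lt1 lemu ltmu; clia.
apply: (step_contra C mu2 n4) => [||U' V' X' leU leV leUV C'].
- by clear -bu; clia.
- by clear -bv; clia.
apply: (IHk _ _ _ _ C') => //.
- by clear -ltmu; lia.
- by clear -mu2; lia.
- by clear -bu leU leUV; clia.
- by clear -bv leV leUV; clia.
Qed.

(** Leftover terms of equal class are absorbed as blocks of length 2 until at most 16 terms remain.
    The other terms number at least 4n - 11, and half of this, rounded up, is 2n - 5. *)
Lemma cfg_saturate U V mu X : cfg U V mu X ->
  (2 * n <= 2 * size U + size V + 3)%N -> (2 * n <= size U + 2 * size V + 3)%N ->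
  exists X', cfg U V (2 * n - 5) X'.
Proof.
move=> C bu bv; have [k] := ubnP (size X); elim: k => // k IHk in mu X C * => ltX.
have [uX|/class_pair[x [y [W [pX exy]]]]] := boolP (uniq [seq cl x | x <- X]).
  exists X; have leX : (size X <= 16)%N.
    by have := max_card (mem (clset X)); rewrite (card_clset uX) card_K4.
  case: C => D0 [D1 [m0 [N0 [m1 [N1 [pS sUV [sz0 sz1] sE [lt0 lt1 _]]]]]]].
  exists D0, D1, m0, N0, m1, N1; split=> //; split=> //.
  have := perm_size pS; rewrite !size_cat !size_fl sz0 sz1 szS; clear -leX; clia.
have [|[j _ ltj]|[N _ CN]] := @cfg_ext U V mu X [:: x; y] W 1 C bu bv pX erefl isT n_gt0.
- by rewrite big_cons big_seq1 clxx.
- by clear -ltj; lia.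
apply: IHk CN _; have := perm_size pX; move: ltX; rewrite /=; clear; clia.
Qed.

End Config.

Lemma s_three S : (36 <= n)%N -> size S = (4 * n + 5)%N -> nozs S -> False.
Proof.
move=> n36 szS nS.
have K16 X : uniq [seq cl x | x <- X] -> (size X <= 16)%N.
  by move=> uX; have := max_card (mem (clset X)); rewrite (card_clset uX) card_K4.
(* Sixteen classes allow 2n - 5 pairs, so [egz_inverse] applies with k = 4. *)
have [|P [X [szP pS clP]]] := @pairing 16 (2 * n - 5) S K16.
  by rewrite szS; clear -n36; lia.
have vE := pair_valuesE clP; have av T W := @pair_values P S X T W nS pS.
have [||p [c [R [W [Ep pP zR RE [leR leC]]]]]] := egz_inverse E0 ED nE' (k := 4) vE _ _ av.
- by rewrite size_map szP cardE; clear -n36; lia.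
- by rewrite cardE; clear -n36; lia.
have [||g ltg] := zsf_mult E0 ED RE zR leR; rewrite ?cardE //; first by clear -n36; lia.
(* For k = 4, [zsf_mult] guarantees n + 1 - 8 copies of g. *)
rewrite cardE in ltg; set d := (n - 7)%N.
have [|R' pR] := @count_perm G R g d; first by clear -ltg; clia.
have lec : (d <= c)%N.
  apply: leq_trans (leC (p + g)); rewrite (seq.permP pP) !count_cat.
  rewrite (seq.permP (perm_map _ pR)) map_cat count_cat map_nseq count_nseq /= addrC eqxx.
  by rewrite mul1n -!addnA addnCA leq_addr.
have pP' : perm_eq [seq z.1 + z.2 | z <- P]
    (nseq d p ++ nseq d (p + g) ++ (nseq (c - d) p ++ [seq r + p | r <- R'] ++ W)).
  rewrite (perm_trans pP) // -{1}(subnKC lec) nseqD.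
  apply/seq.permP=> f; have := seq.permP (perm_map (fun r => r + p) pR) f.
  rewrite map_cat map_nseq (addrC g) !count_cat; clear; clia.
have [S' [U [V [X' [nS' pS' sU sV [szU [szV szS']]]]]]] := normal_form nS pS Ep pP'.
have gE : g \in E.
  by apply: RE; rewrite (perm_mem pR) mem_cat mem_nseq eqxx andbT /d; apply/orP; left; clear -n36; lia.
have gg : cyclic_gen g.
  have zg : zsf (nseq d g) by apply: zsf_catl (zsf_perm pR zR).
  have [_ gg] : gen E g.
    apply: (gen_large E0 nE' (m := d) gE) => [j|]; first exact: zsf_nseq zg.
    by rewrite cardE /d; clear -n36; lia.
  by split=> // j ltj; apply: gg; rewrite cardE.
rewrite szS in szS'.
have bu : (2 * n + 16 <= 2 * size U + size V + 3)%N by rewrite szU szV /d; clear -n36; lia.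
have bv : (2 * n + 16 <= size U + 2 * size V + 3)%N by rewrite szU szV /d; clear -n36; lia.
have C : cfg S' g U V 0 X'.
  exists [::], [::], 0%N, 0%N, 0%N, 0%N; split=> //; first by rewrite big_nil addr0 mulr0n.
  by split=> //; rewrite ?szU ?szV /d; clear -n36; lia.
have [||X2 C2] := cfg_saturate gg nS' szS' C.
- by clear -bu; clia.
- by clear -bv; clia.
by apply: (cfg_contra gg nS' szS' (k := 4) C2) => //; clear -n36; lia.
Qed.

End Setting.

(** * Sequences without zero-sum part of length at most 2n *)

Section Eta.
Variables (G : finZmodType) (cl : G -> K4) (n : nat).
Implicit Types (R S T W B X Y Z : seq G) (P : seq (G * G)) (x y g h : G) (phi : K4 -> G).
Hypothesis clD : forall x y, cl (x + y) = cl x + cl y.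
Local Notation E := (E cl).
Hypothesis cardE : #|E| = n.
Hypothesis nE : forall x, x \in E -> x *+ n = 0.
Let eE0 : 0 \in E := E0 clD.
Let eED : forall x y, x \in E -> y \in E -> x + y \in E := @ED _ _ clD.
Let enE : forall x, x \in E -> x *+ #|E| = 0 := nE' cardE nE.

Definition noshort S := forall T W, perm_eq (T ++ W) S -> T <> [::] -> (size T <= 2 * n)%N ->
  \sum_(x <- T) x != 0.

Definition bsum B := \sum_(x <- B) x.

Lemma sum_flatten (BL : seq (seq G)) : bsum (flatten BL) = bsum (map bsum BL).
Proof.
by rewrite /bsum; elim: BL => [|B BL IH]; rewrite ?big_nil //= big_cat big_cons IH.
Qed.

Lemma zsf_blocks S W (BL : seq (seq G)) : noshort S -> perm_eq S (flatten BL ++ W) ->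
  [::] \notin BL -> (size (flatten BL) <= 2 * n)%N -> zsf (map bsum BL).
Proof.
move=> nS pS ne sz T W' /perm_lift[BL1 [BL2 [pBL -> _]]] T0.
have pF : perm_eq (flatten BL) (flatten BL1 ++ flatten BL2).
  by rewrite -flatten_cat; apply: perm_flatten.
rewrite -/(bsum _) -sum_flatten; apply: (nS _ (flatten BL2 ++ W)).
- by rewrite catA perm_sym (perm_trans pS) // perm_cat2r.
- case: BL1 T0 pBL {pF} => // B BL1 _ pBL; have : B \in BL by rewrite (perm_mem pBL) mem_head.
  by case: B {pBL} => // BLn; rewrite BLn in ne.
- by have := perm_size pF; rewrite size_cat => e; rewrite (leq_trans _ sz) // e leq_addr.
Qed.

Lemma pair_all X : exists P X', [/\ perm_eq X (fl P ++ X'),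
  all (fun p => cl p.1 == cl p.2) P & uniq [seq cl x | x <- X']].
Proof.
have [k] := ubnP (size X); elim: k => // k IHk in X * => ltX.
have [uX|/(class_pair)[x [y [W [pX exy]]]]] := boolP (uniq [seq cl x | x <- X]).
  by exists [::], X.
have [|P [X' [pW aP uX']]] := IHk W.
  by have := perm_size pX; move: ltX; rewrite /=; clear; clia.
exists ((x, y) :: P), X'; split=> //=; last by rewrite exy eqxx.
by rewrite (perm_trans pX) //= !perm_cons.
Qed.

(** Giving the class 0 the value 0 adds a point for free: a block through 0 has the sum of the
    shorter block without it. *)
Definition ext0 phi c : G := if c == 0 then 0 else phi c.

Lemma nz_block phi (C : {set K4}) Q : uniq Q -> all (mem (0 |: C)) Q -> ksum Q = 0 ->
  (2 <= size Q)%N ->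
  exists Q', [/\ uniq Q', all (mem C) Q', ksum Q' = 0 & [/\ Q' <> [::], (size Q' <= size Q)%N,
     {subset Q' <= Q} & vsum phi Q' = vsum (ext0 phi) Q]].
Proof.
move=> uQ /allP aQ kQ szQ; exists [seq c <- Q | c != 0]; split.
- exact: filter_uniq.
- apply/allP=> c; rewrite mem_filter => /andP[c0 /aQ].
  by rewrite !inE (negPf c0).
- by rewrite -[RHS]kQ; elim: (Q) => //= c Q' IH; case: eqVneq => [->|_] /=; rewrite IH ?add0r.
split.
- move=> e; have : {subset Q <= [:: 0 : K4]}.
    move=> c Qc; rewrite inE; apply/negPn/negP=> c0.
    by have : c \in [seq c <- Q | c != 0]; [rewrite mem_filter c0 | rewrite e].
  by move/(uniq_leq_size uQ); rewrite leqNgt szQ.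
- by rewrite size_filter count_size.
- by move=> c; rewrite mem_filter => /andP[].
elim: (Q) => //= c Q' IH; rewrite -IH /ext0; case: eqVneq => [->|_] //=.
by rewrite add0r.
Qed.

(** [R] holds the values in E found so far, and [b] is the number of terms still available within
    the length 2n. *)
Definition good R b (C : {set K4}) phi := forall Cs : seq (seq K4), uniq (flatten Cs) ->
  all (mem C) (flatten Cs) -> all (fun l => ksum l == 0) Cs -> [::] \notin Cs ->
  (size (flatten Cs) <= b)%N -> zsf (R ++ map (vsum phi) Cs).

Lemma good1 R b C phi Q : good R b C phi -> uniq Q -> all (mem C) Q -> ksum Q = 0 ->
  Q <> [::] -> (size Q <= b)%N -> zsf (R ++ [:: vsum phi Q]).
Proof.
move=> gR uQ aQ kQ Qn szQ; apply: (gR [:: Q]); rewrite ?[flatten _]cats0 //= ?kQ ?eqxx //.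
by rewrite mem_seq1 eq_sym; apply/eqP.
Qed.

Lemma good2 R b C phi Q L : good R b C phi -> uniq (Q ++ L) -> all (mem C) (Q ++ L) ->
  ksum Q = 0 -> ksum L = 0 -> Q <> [::] -> L <> [::] -> (size Q + size L <= b)%N ->
  zsf (R ++ [:: vsum phi Q; vsum phi L]).
Proof.
move=> gR uQ aQ kQ kL Qn Ln sz; have e : flatten [:: Q; L] = Q ++ L by rewrite /= cats0.
apply: (gR [:: Q; L]); rewrite ?e ?size_cat //= ?kQ ?kL ?eqxx //.
by rewrite !inE ![[::] == _]eq_sym negb_or; apply/andP; split; apply/eqP.
Qed.

Lemma good_cons R b C phi L : good R b C phi -> uniq L -> all (mem C) L -> ksum L = 0 ->
  L <> [::] -> (size L <= b)%N -> good (R ++ [:: vsum phi L]) (b - size L) (C :\: [set c in L]) phi.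
Proof.
move=> gR uL aL kL Ln szL Cs uC /allP aC kC Cn sz; rewrite -catA.
have nL c : c \in flatten Cs -> c \notin L by move/aC; rewrite /= !inE => /andP[].
apply: (gR (L :: Cs)) => /=.
- rewrite cat_uniq uL uC andbT; apply/hasPn=> c; exact: nL.
- by rewrite all_cat aL; apply/allP=> c /aC; rewrite /= !inE => /andP[].
- by rewrite kL eqxx.
- by rewrite inE negb_or Cn eq_sym andbT; apply/eqP.
- by rewrite size_cat; move: sz szL; clear; clia.
Qed.

Lemma zsf_E R : zsf R -> {subset R <= E} -> (size R).+1 = n ->
  (0 < size R)%N -> exists2 g, cyclic_gen cl n g & forall x, x \in R -> x = g.
Proof.
move=> zR RE szR R0; have [|g eR] := zsf_max eE0 eED RE zR; first by rewrite cardE szR.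
exists g.
  split=> [|j ltj]; first by apply: RE; rewrite eR mem_nseq R0 eqxx.
  by rewrite eR in zR; apply: (zsf_nseq zR); move: ltj szR; clear; clia.
by move=> x; rewrite eR mem_nseq => /andP[_ /eqP].
Qed.

Lemma cyclic_gen_values g v m : cyclic_gen cl n g -> v \in E -> zsf (v :: nseq m g) ->
  exists2 j, (0 < j)%N /\ (j + m < n)%N & v = g *+ j.
Proof.
move=> gg Ev zv; have [j] := zsf_cons_nseq eE0 eED enE (cyclic_genP cardE gg) Ev zv.
by rewrite cardE => ltj ->; exists j.
Qed.

(** * Extending a zero-sum free sequence by lines and planes *)

Section Core.
Variables (C : {set K4}) (phi : K4 -> G).
Hypotheses (C0 : 0 \notin C) (clphi : forall c, c \in C -> cl (phi c) = c).

Lemma vsum_E l : all (mem C) l -> ksum l = 0 -> vsum phi l \in E.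
Proof.
move=> aC kl; rewrite inEE -[X in _ == X]kl; apply/eqP.
by elim: l aC {kl} => [_|c l IH /= /andP[/clphi ec /IH]]; rewrite ?(cl0 clD) // clD ec => ->.
Qed.

(** The other points of [D] and their translates by c are two sets of at least 8 among the 14 points
    different from 0 and c, so they meet. *)
Lemma line_through (D : {set K4}) c : D \subset C -> c \in D -> (9 <= #|D|)%N ->
  exists2 l, line l & [/\ uniq l, all (mem D) l & c \in l].
Proof.
move=> DC Dc leD.
have nx (x y : K4) : y != 0 -> (x == x + y) = false.
  by move=> y0; rewrite -{1}[x]addr0 (inj_eq (addrI _)) eq_sym (negPf y0).
have D0 (x : K4) : x \in D -> x != 0.
  by move=> Dx; apply: contraNneq C0 => <-; exact: (subsetP DC).
pose D1 := D :\ c; pose D2 := [set c + x | x in D1].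
have c1 : (8 <= #|D1|)%N by move: leD; rewrite (cardsD1 c) Dc add1n ltnS.
have c2 : #|D2| = #|D1| by apply: card_imset; exact: addrI.
have [|x] := @set0Pn _ (D1 :&: D2) _.
  apply/negP=> /eqP D12.
  have sub : D1 :|: D2 \subset ~: [set 0; c].
    apply/subsetP=> x; rewrite !inE negb_or => /orP[/andP[xc Dx]|/imsetP[y]].
      by rewrite xc D0.
    rewrite !inE => /andP[yc Dy] ->; rewrite K4eq0 eq_sym yc /=.
    by rewrite eq_sym nx // D0.
  have := subset_leq_card sub; rewrite cardsU D12 cards0 c2.
  have := cardsC [set (0 : K4); c]; rewrite cards2 card_K4 (eq_sym 0 c) D0 //.
  by move: c1; clear; clia.
rewrite !inE => /andP[/andP[xc Dx] /imsetP[y]]; rewrite !inE => /andP[yc Dy] ex.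
exists [:: c; y; x]; first by rewrite /line /= addr0 ex addrA K4xx.
rewrite /= Dc Dy Dx !inE eqxx negb_or !andbT; split=> //.
by rewrite eq_sym yc eq_sym xc ex addrC nx // D0.
Qed.

(** The negative of a further term is not a subset sum of [R], and at most one element of [E] has
    this property. *)
Lemma next_value R x y : {subset R <= E} -> (n <= #|ssums R| + 1)%N ->
  zsf (R ++ [:: x]) -> zsf (R ++ [:: y]) -> x \in E -> y \in E -> x = y /\ x != 0.
Proof.
move=> RE le zx zy Ex Ey; have sE := ssumsE eE0 eED RE.
have nx z : zsf (R ++ [:: z]) -> - z \notin ssums R.
  move=> zz; apply/negP=> /ssumsP[T sT eT].
  have := zsf_subseq zz (T := T ++ [:: z]).
  rewrite big_cat big_seq1 eT /= addNr eqxx => H.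
  suff: false by []; apply: H; first by rewrite cat_subseq.
  by case: (T).
have lt : (#|E :\: ssums R| <= 1)%N.
  by have := cardsID (ssums R) E; rewrite (setIidPr sE) cardE; move: le; clear; clia.
have mem z : z \in E -> zsf (R ++ [:: z]) -> - z \in E :\: ssums R.
  by move=> Ez /nx nz; rewrite inE nz inEE (clN clD) -(inEE cl) Ez.
split; last by apply: (zsf_neq0 zx); rewrite mem_cat mem_seq1 eqxx orbT.
by apply: oppr_inj; apply: (card_le1_eqP lt); exact: mem.
Qed.

Lemma good_planes R b lam k : good R b C phi -> (4 <= b)%N ->
  (forall x, zsf (R ++ [:: x]) -> x \in E -> x *+ k = lam) ->
  planes (mem (0 |: C)) (fun c => ext0 phi c *+ k) lam.
Proof.
move=> gR b4 H a b' c d uQ aQ kQ.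
have [|//|Q' [uQ' aQ' kQ' [nQ' szQ' sQ' eQ']]] := @nz_block phi C [:: a; b'; c; d] uQ aQ _ _.
  by rewrite /= addr0 !addrA.
have : vsum phi Q' *+ k = lam.
  apply: H; last exact: vsum_E.
  exact: good1 gR uQ' aQ' kQ' nQ' (leq_trans szQ' b4).
by rewrite eQ' /= addr0 !addrA !mulrnDl.
Qed.

(** As 16 + 6 <= 2 * 11, [planes_big] applies to the whole space, and at the point 0 it gives 4 * 0
    = lam. *)
Lemma ext0_planes_big lam b : (11 <= #|(0%R : K4) |: C|)%N ->
  planes (mem (0 |: C)) (fun c => ext0 phi c *+ b) lam -> lam = 0.
Proof.
move=> le pl.
have HD : {in [set: K4] &, forall c d, c + d \in [set: K4]} by move=> c d _ _; rewrite inE.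
have le' : (#|[set: K4]| + 6 <= 2 * #|(0%R : K4) |: C|)%N.
  by have := cardsT K4; rewrite card_K4; move: le; clear; clia.
have Y0 : 0 \in 0 |: C by rewrite !inE eqxx.
have <- := planes_big HD (subsetT _) le' pl Y0.
by rewrite /ext0 eqxx !mul0rn.
Qed.

Lemma card_ext : #|(0%R : K4) |: C| = #|C|.+1.
Proof. by rewrite cardsU1 C0. Qed.

(** Adding the values of d disjoint lines would give a zero-sum free sequence of length n over [E].
    The bound 6 + 3d leaves nine points for the last line. *)
Lemma good_many R d b : (size R + d = n)%N -> {subset R <= E} -> good R b C phi ->
  (3 * d <= b)%N -> (6 + 3 * d <= #|C|)%N -> False.
Proof.
move=> szR RE gR le cC.
have [Ls [uL aL kL [nL szL sfL]]] : exists Ls : seq (seq K4),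
    [/\ uniq (flatten Ls), all (mem C) (flatten Ls), all (fun l => ksum l == 0) Ls &
      [/\ [::] \notin Ls, size Ls = d & size (flatten Ls) = (3 * d)%N]].
  elim: d {szR le} cC => [|d IHd] cC; first by exists [::].
  have [|Ls [uL aL kL [nL szL sfL]]] := IHd; first by move: cC; clear; clia.
  pose D := C :\: [set c in flatten Ls]; have DC : D \subset C by exact: subsetDl.
  have cD : (9 <= #|D|)%N.
    have := cardsID [set c in flatten Ls] C; rewrite -/D.
    have : (#|C :&: [set c in flatten Ls]| <= 3 * d)%N.
      rewrite -sfL -(card_uniqP uL) -[X in (_ <= X)%N]cardsE.
      exact/subset_leq_card/subsetIr.
    by move: cC; clear; clia.
  have /card_gt0P[c Dc] : (0 < #|D|)%N by apply: leq_trans cD.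
  have [l /andP[/eqP szl kl] [ul al _]] := line_through DC Dc cD.
  exists (l :: Ls); rewrite /= kl kL !all_cat aL szL size_cat szl sfL mulnS andbT; split=> //.
  - rewrite cat_uniq ul uL andbT; apply/hasPn=> x Lx; apply/negP=> /(allP al).
    by rewrite /= !inE Lx.
  - by apply/allP=> x /(allP al) /(subsetP DC).
  - by split=> //; rewrite inE negb_or nL andbT; apply/eqP=> e; rewrite -e in szl.
have zR := gR Ls uL aL kL nL ltac:(by rewrite sfL).
have sub : {subset R ++ map (vsum phi) Ls <= E}.
  move=> x; rewrite mem_cat => /orP[/RE//|/mapP[l Lsl ->]].
  apply: vsum_E; last exact/eqP/(allP kL).
  by apply/allP=> c lc; apply: (allP aL); apply/flattenP; exists l.
have := size_zsf eE0 eED sub zR; rewrite cardE size_cat size_map szL szR.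
by rewrite ltnn.
Qed.

(** The subset sums of [R] miss at most one element of [E], so all lines and planes have the same
    nonzero value, against [ext0_planes_big]. *)
Lemma good_two R b : (size R + 2 = n)%N -> {subset R <= E} -> good R b C phi ->
  (4 <= b)%N -> (10 <= #|C|)%N -> False.
Proof.
move=> szR RE gR b4 cC.
have zR : zsf R by have := gR [::]; rewrite cats0; apply.
have leR : (n <= #|ssums R| + 1)%N.
  by have := card_ssums zR; move: szR; clear; clia.
have [/card_gt0P[c Cc] c9] : (0 < #|C|)%N /\ (9 <= #|C|)%N by split; apply: leq_trans cC.
have [l /andP[/eqP szl /eqP kl] [ul al _]] := line_through (subxx C) Cc c9.
have ln : l <> [::] by move=> e; rewrite e in szl.
have lb : (size l <= b)%N by rewrite szl; apply: leq_trans b4.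
have zl := good1 gR ul al kl ln lb.
have El : vsum phi l \in E by exact: vsum_E.
have [_ /eqP[]] := next_value RE leR zl zl El El.
apply: (ext0_planes_big (b := 1)); first by rewrite card_ext.
apply: (good_planes (k := 1) gR b4) => x zx Ex.
by have [] := next_value RE leR zx zl Ex El.
Qed.

Lemma twelve : (12 <= #|C|)%N -> exists c1 c2 c3 : K4, [/\ c1 != 0, c2 != 0, c1 != c2,
  c3 \notin [:: 0; c1; c2] & forall c, xcodes c1 c2 c3 c -> c \in C].
Proof.
move=> le; have [D DC cD] : exists2 D : {set K4}, D \subset C & #|D| = 12%N.
  have : (0 < #|[set B : {set K4} | B \subset C & #|B| == 12%N]|)%N.
    by rewrite cards_draws bin_gt0.
  by case/card_gt0P=> B; rewrite inE => /andP[? /eqP ?]; exists B.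
pose M := ~: ((0%R : K4) |: D); have cM : #|M| = 3%N.
  have := cardsC ((0%R : K4) |: D); rewrite -/M cardsU1 cD card_K4.
  rewrite (contra (subsetP DC 0) C0) /=; clear; clia.
have := enum_uniq M; have : forall c, (c \in enum M) = (c \in M) by move=> c; rewrite mem_enum.
rewrite fintype.cardE in cM; case: (enum M) cM => [|c1 [|c2 [|c3 []]]] // _ eM.
rewrite /= !inE !negb_or => /and3P[/andP[n12 n13] n23 _].
have Mn c : c \in [:: c1; c2; c3] -> c != 0 by rewrite eM !inE negb_or => /andP[].
exists c1, c2, c3; split=> //.
- by apply: Mn; rewrite mem_head.
- by apply: Mn; rewrite !inE eqxx orbT.
- rewrite !inE !negb_or (eq_sym c3 c1) n13 (eq_sym c3 c2) n23 !andbT.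
  by apply: Mn; rewrite !inE eqxx !orbT.
move=> x; rewrite /xcodes !inE negb_or => /andP[x0 nx]; apply: (subsetP DC).
apply/negPn/negP=> nD; have : x \in M by rewrite !inE negb_or x0.
by rewrite -eM !inE (negPf nx).
Qed.

(** Two disjoint lines bring [R] to the maximal length n - 1, so all values equal a generator g, and
    a plane has value g or 2g. The three points that may be missing are collinear or independent. *)
Lemma good_three R b : (size R + 3 = n)%N -> {subset R <= E} -> good R b C phi ->
  (6 <= b)%N -> (12 <= #|C|)%N -> False.
Proof.
move=> szR RE gR b6 cC.
have LV : line_values anyD (mem C) phi.
  move=> l1 l2 /andP[/eqP s1 /eqP k1] /andP[/eqP s2 /eqP k2] u12 a12.
  have n1 : l1 <> [::] by move=> e; rewrite e in s1.
  have n2 : l2 <> [::] by move=> e; rewrite e in s2.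
  have := a12; rewrite all_cat => /andP[a1 a2].
  have E1 : vsum phi l1 \in E by exact: vsum_E.
  have E2 : vsum phi l2 \in E by exact: vsum_E.
  have l12 : (size l1 + size l2 <= b)%N by rewrite s1 s2.
  have [|||g gg eg] := zsf_E (good2 gR u12 a12 k1 k2 n1 n2 l12).
  - by move=> x; rewrite mem_cat in_cons mem_seq1 => /or3P[/RE //|/eqP->|/eqP->].
  - by rewrite size_cat /=; move: szR; clear; clia.
  - by rewrite size_cat /= addn2.
  have e1 : vsum phi l1 = g by apply: eg; rewrite mem_cat !inE eqxx orbT.
  have e2 : vsum phi l2 = g by apply: eg; rewrite mem_cat !inE eqxx !orbT.
  have eR : R = nseq (size R) g.
    by apply/all_pred1P/allP=> x Rx; rewrite /= (eg x) ?mem_cat ?Rx.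
  have n3 : (3 <= n)%N by rewrite -szR leq_addl.
  rewrite e1 e2; split=> //.
  - by rewrite -[g]mulr1n; case: gg => _; apply; clear -n3; lia.
  - by case: gg => _; apply; clear -n3; lia.
  move=> Q /andP[/eqP sQ /eqP kQ] uQ aQ _.
  have nQ : Q <> [::] by move=> e; rewrite e in sQ.
  have zQ : zsf (vsum phi Q :: nseq (size R) g).
    have sQb : (size Q <= b)%N by rewrite sQ; apply: leq_trans b6.
    apply: zsf_perm (good1 gR uQ aQ kQ nQ sQb); rewrite {1}eR.
    by rewrite perm_catC /=.
  have [j ltj ->] := cyclic_gen_values gg (vsum_E aQ kQ) zQ.
  have [->|->] : j = 1%N \/ j = 2%N by move: szR ltj; clear; clia.
    by left.
  by right.
have [c1 [c2 [c3 [n1 n2 n12 n3 XC]]]] := twelve cC.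
have [e3|n3'] := eqVneq c3 (c1 + c2).
  by rewrite e3 in XC; exact: (coset_case n1 n2 n12 XC LV).
have n4 : c3 \notin [:: 0; c1; c2; c1 + c2].
  by move: n3; rewrite !inE !negb_or n3' andbT.
exact: (fano_case n1 n2 n12 n4 XC (line_values_weak LV)).
Qed.

End Core.

(** * Deficit four with fourteen leftover classes *)

Section Four.
Variables (C : {set K4}) (phi : K4 -> G) (R : seq G).
Hypotheses (C0 : 0 \notin C) (clphi : forall c, c \in C -> cl (phi c) = c).
Hypotheses (szR : (size R + 4 = n)%N) (RE : {subset R <= E}) (gR : good R 8 C phi) (cC : #|C| = 14%N).
Hypothesis cyc : exists h, cyclic_gen cl n h.

(** Let v be the value of L. If [R] had a term other than v, the subset sums of [R] with v would
    miss at most one element of [E], and the eleven other points would contradict as in [good_two].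
    So [R] consists of copies of v, and [gen_large] applies unless n = 4 and 2v = 0. *)
Lemma line_cyclic_gen L : line L -> uniq L -> all (mem C) L ->
  cyclic_gen cl n (vsum phi L) /\ R = nseq (n - 4) (vsum phi L).
Proof.
move=> /andP[/eqP sL /eqP kL] uL aL; have nL : L <> [::] by move=> e; rewrite e in sL.
set C' := C :\: [set c in L]; have sC : C' \subset C by exact: subsetDl.
have C'0 : 0 \notin C' by apply: contra C0; exact: (subsetP sC).
have clphi' c : c \in C' -> cl (phi c) = c by move/(subsetP sC)/clphi.
have cC' : #|C'| = 11%N.
  have := cardsID [set c in L] C; rewrite -/C' (setIidPr _); last first.
    by apply/subsetP=> c; rewrite inE => /(allP aL).
  by rewrite cardsE (card_uniqP uL) sL cC; clear; clia.
have leL : (size L <= 8)%N by rewrite sL.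
have gR' := good_cons gR uL aL kL nL leL; rewrite -/C' sL in gR'.
set v := vsum phi L; have Ev : v \in E by exact: (vsum_E clphi).
have RE' : {subset R ++ [:: v] <= E} by move=> x; rewrite mem_cat mem_seq1 => /orP[/RE//|/eqP->].
have zR : zsf (R ++ [:: v]) := good1 gR uL aL kL nL leL.
have n4 : (4 <= n)%N by rewrite -szR leq_addl.
have [c12] : (11 <= #|(0%R : K4) |: C'|)%N by rewrite card_ext // cC'.
have no_plane lam k : lam <> 0 -> ~ planes (mem (0 |: C')) (fun c => ext0 phi c *+ k) lam.
  by move=> ln pl; apply: ln; exact: ext0_planes_big c12 pl.
have ER : R = nseq (n - 4) v.
  have [aR|/allPn[x Rx nx]] := boolP (all (pred1 v) R).
    by rewrite (all_pred1P _ _ aR); congr nseq; move: szR; clear; clia.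
  have le : (n <= #|ssums (R ++ [:: v])| + 1)%N.
    have Rx' : x \in R ++ [:: v] by rewrite mem_cat Rx.
    have Rv : v \in R ++ [:: v] by rewrite mem_cat mem_head orbT.
    have := zsf_two eE0 zR Rx' Rv nx; rewrite size_cat /=; move: szR; clear; clia.
  have /card_gt0P[c Cc] : (0 < #|C'|)%N by rewrite cC'.
  have c9 : (9 <= #|C'|)%N by rewrite cC'.
  have [l /andP[/eqP szl /eqP kl] [ul al _]] := line_through C'0 (subxx C') Cc c9.
  have ln : l <> [::] by move=> e; rewrite e in szl.
  have zl : zsf ((R ++ [:: v]) ++ [:: vsum phi l]) by apply: (good1 gR') => //; rewrite szl.
  have El : vsum phi l \in E by exact: (vsum_E clphi').
  have [_ /eqP l0] := next_value RE' le zl zl El El.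
  case: (no_plane (vsum phi l) 1%N l0).
  apply: (good_planes (k := 1) clphi' gR') => // y zy Ey.
  by have [] := next_value RE' le zy zl Ey El.
split=> //.
have zv : zsf (nseq (n - 3) v).
  have -> : (n - 3 = (n - 4) + 1)%N by clear -n4; lia.
  by rewrite nseqD -ER.
have vj j : (0 < j <= n - 3)%N -> v *+ j != 0 by exact: zsf_nseq zv.
have [n4'|n4'] := ltnP 4 n.
  have [_ gv] : gen E v.
    by apply: (gen_large eE0 enE (m := (n - 3)%N) Ev vj); rewrite cardE; clear -n4'; lia.
  by split=> // j ltj; apply: gv; rewrite cardE.
have en : n = 4%N by apply/eqP; rewrite eqn_leq n4 n4'.
have [v2|v2] := eqVneq (v *+ 2) 0; last first.
  have [_ gv] : gen E v.
    apply: (gen_large eE0 enE (m := 2) Ev); last by rewrite cardE en.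
    by case=> [|[|[|]]] // _; apply: vj; rewrite en.
  by split=> // j ltj; apply: gv; rewrite cardE.
(* Here v = 2h, and a further value is h or 3h, whose double is v: the doubled values satisfy the
   plane relations with constant v. *)
case: (no_plane v 2%N); first by apply/eqP; rewrite -[v]mulr1n vj // en.
have [h gh] := cyc; have h4 : h *+ 4 = 0 by rewrite -en nE //; case: gh.
have hn j : (0 < j < 4)%N -> h *+ j <> 0 by rewrite -en => ltj; apply/eqP; case: gh => _; exact.
have vh : v = h *+ 2.
  have [j ltj ev] := cyclic_genE clD cardE gh Ev; rewrite en in ltj.
  have v1 : v != 0 by rewrite -[v]mulr1n vj // en.
  case: j ltj ev => [|[|[|[|]]]] // _ ev.
  - by rewrite ev eqxx in v1.
  - by case: (hn 2%N isT); rewrite -[h]mulr1n -ev.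
  by case: (hn 2%N isT); have := v2; rewrite ev => e; lincomb (subE e h4).
apply: (good_planes clphi' gR') => // x zx Ex.
have R0 : R = [::] by rewrite ER en.
rewrite R0 /= in zx.
have [j ltj ex] := cyclic_genE clD cardE gh Ex; rewrite en in ltj.
case: j ltj ex => [|[|[|[|]]]] // _ ex.
- by have := zsf_neq0 zx (x := x); rewrite !inE eqxx orbT ex eqxx => /(_ isT).
- by rewrite vh ex.
- have := zx [:: v; x] [::] (perm_refl _) (fun e => ltac:(by [])).
  by rewrite big_cons big_seq1 vh ex; case/eqP; lincomb h4.
by rewrite vh ex; lincomb h4.
Qed.

Lemma good_four : False.
Proof.
have n4 : (4 <= n)%N by rewrite -szR leq_addl.
have LV : line_values disj (mem C) phi.
  move=> l1 l2 L1 L2 u12 a12; have := a12; rewrite all_cat => /andP[a1 a2].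
  have := u12; rewrite cat_uniq => /and3P[u1 _ u2].
  have [g1 eR1] := line_cyclic_gen L1 u1 a1; have [g2 eR2] := line_cyclic_gen L2 u2 a2.
  have [/andP[/eqP s1 /eqP k1] /andP[/eqP s2 /eqP k2]] := (L1, L2).
  have n1 : l1 <> [::] by move=> e; rewrite e in s1.
  have n2 : l2 <> [::] by move=> e; rewrite e in s2.
  have val Q l : cyclic_gen cl n (vsum phi l) -> R = nseq (n - 4) (vsum phi l) ->
      uniq (Q ++ l) -> all (mem C) (Q ++ l) -> ksum Q = 0 -> ksum l = 0 -> Q <> [::] -> l <> [::] ->
      (size Q + size l <= 8)%N -> vsum phi Q = vsum phi l \/ vsum phi Q = vsum phi l *+ 2.
    move=> gl eR u a kQ kl nQ nl sz; have zQ := good2 gR u a kQ kl nQ nl sz.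
    have zQ' : zsf (vsum phi Q :: nseq (n - 3) (vsum phi l)).
      have -> : (n - 3 = (n - 4).+1)%N by clear -n4; lia.
      apply: zsf_perm zQ; rewrite {1}eR; apply/seq.permP=> f.
      by rewrite count_cat /= addn0; clear; clia.
    have EQ : vsum phi Q \in E.
      by apply: (vsum_E clphi) => //; move: a; rewrite all_cat => /andP[].
    have [j ltj ->] := cyclic_gen_values gl EQ zQ'.
    have [->|->] : j = 1%N \/ j = 2%N by clear -ltj n4; lia.
      by left.
    by right.
  have nz l k : cyclic_gen cl n (vsum phi l) -> (0 < k < 4)%N -> vsum phi l *+ k <> 0.
    by move=> [_ gl] k4; apply/eqP; apply: gl; clear -k4 n4; lia.
  have u21 : uniq (l2 ++ l1) by rewrite uniq_catC.
  have a21 : all (mem C) (l2 ++ l1) by rewrite all_cat a2.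
  (* Each value is once or twice the other; twice in both directions would make three times a
     generator vanish. *)
  have e12 : vsum phi l1 = vsum phi l2.
    have [//|e] := val _ _ g2 eR2 u12 a12 k1 k2 n1 n2 ltac:(by rewrite s1 s2).
    have [//|e'] := val _ _ g1 eR1 u21 a21 k2 k1 n2 n1 ltac:(by rewrite s1 s2).
    by case: (nz l1 3%N g1 isT); lincomb (addE (esym e) (esym (mulE 2 e'))).
  split=> //.
  - by apply/eqP; rewrite -[vsum _ _]mulr1n; exact: nz.
  - by apply/eqP; exact: nz.
  move=> Q /andP[/eqP sQ /eqP kQ] uQ aQ dQ; apply: val => //.
  - by rewrite all_cat aQ.
  - by move=> e; rewrite e in sQ.
  - by rewrite sQ s1.
have pick (s : seq K4) : (size s < 16)%N -> exists c, c \notin s.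
  move=> szs; have [/existsP[c nc]|] := boolP [exists c, c \notin s]; first by exists c.
  rewrite negb_exists => /forallP H; have : (#|K4| <= size s)%N.
    apply: leq_trans (card_size s); apply/subset_leq_card/subsetP=> c _.
    by have := H c; rewrite negbK.
  by rewrite card_K4 leqNgt szs.
(* Only one nonzero point is missing; two freely chosen points complete it to the independent triple
   of [fano_case]. *)
have [w wC] : exists w, forall c, c != 0 -> c != w -> c \in C.
  have cM : #|~: ((0%R : K4) |: C)| = 1%N.
    by have := cardsC ((0%R : K4) |: C); rewrite card_ext // cC card_K4; clear; clia.
  have /cards1P[w eM] : #|~: ((0%R : K4) |: C)| == 1%N by rewrite cM.
  exists w => c c0 cw; apply/negPn/negP=> nC.
  have : c \in ~: ((0%R : K4) |: C) by rewrite !inE negb_or c0.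
  by rewrite eM inE (negPf cw).
have [w' nw'] : exists w', (w' != 0) && ((w == 0) || (w' == w)).
  have [e|nw] := eqVneq w 0; last by exists w; rewrite nw eqxx.
  by have [c] := pick [:: 0] isT; rewrite inE => c0; exists c; rewrite c0.
have {}wC c : c != 0 -> c != w' -> c \in C.
  move=> c0 cw; apply: wC => //; case/andP: nw' => _ /orP[/eqP->//|/eqP<-//].
have {}nw' : w' != 0 by case/andP: nw'.
have [c2] := pick [:: 0; w'] isT; rewrite !inE negb_or => /andP[n2 n2w].
have [c3 n3] := pick [:: 0; w'; c2; w' + c2] isT.
apply: (fano_case nw' n2 _ n3 _ LV); first by rewrite eq_sym.
by move=> c; rewrite /xcodes !inE !negb_or => /and4P[c0 cw _ _]; exact: wC.
Qed.

End Four.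

(** * Deficit one *)

Section One.
Variables (S : seq G) (h : G).
Hypotheses (nS : noshort S) (gh : cyclic_gen cl n h) (n2 : (2 <= n)%N).

Lemma one_block P m B W : perm_eq S (fl P ++ B ++ W) -> sums P h -> (m <= size P)%N ->
  B <> [::] -> (2 * m + size B <= 2 * n)%N -> bsum B \in E ->
  exists2 j, (0 < j)%N /\ (j + m < n)%N & bsum B = h *+ j.
Proof.
move=> pS sP lem nB sz EB; apply: (cyclic_gen_values gh EB).
pose BL := B :: [seq [:: p.1; p.2] | p <- take m P].
have -> : bsum B :: nseq m h = map bsum BL.
  rewrite /= -map_comp; congr (_ :: _); have := size_takel lem.
  have : sums (take m P) h by apply/allP=> p /mem_take /(allP sP).
  move: (take m P) => P' sP' <-; elim: P' sP' => //= p P' IH /andP[/eqP ep /IH ->].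
  by rewrite /bsum big_cons big_seq1 ep.
apply: (zsf_blocks (W := fl (drop m P) ++ W) nS).
- rewrite (perm_trans pS) //= -/(fl _) -{1}(cat_take_drop m P) fl_cat.
  by apply/seq.permP=> f; rewrite !count_cat; clear; clia.
- rewrite inE negb_or eq_sym; apply/andP; split; first exact/eqP.
  by apply/mapP=> -[p _].
- by rewrite /= -/(fl _) size_cat size_fl size_takel //; move: sz; clear; clia.
Qed.

Lemma one_planes P X W : perm_eq S (fl P ++ X ++ W) -> sums P h -> (n - 2 <= size P)%N ->
  planes (mem (0 |: clset cl X)) (ext0 (rep cl X)) h /\
  blocks6 (mem (0 |: clset cl X)) (ext0 (rep cl X)) h.
Proof.
move=> pS sP szP; have blk Q m : uniq Q -> all (mem (0 |: clset cl X)) Q -> ksum Q = 0 ->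
    (2 <= size Q)%N -> (m <= n - 2)%N -> (2 * m + size Q <= 2 * n)%N ->
    exists2 j, (0 < j)%N /\ (j + m < n)%N & vsum (ext0 (rep cl X)) Q = h *+ j.
  move=> uQ aQ kQ szQ lem sz; have [Q' [uQ' aQ' kQ' [nQ' szQ' _ <-]]] := nz_block (rep cl X) uQ aQ kQ szQ.
  have [W' pW] := rep_block uQ' aQ'; rewrite -vsumE; apply: (@one_block P m _ (W' ++ W)) => //.
  - by rewrite (perm_trans pS) // perm_cat2l catA perm_cat2r.
  - exact: leq_trans lem szP.
  - by case: (Q') nQ'.
  - by rewrite size_map; apply: leq_trans sz; rewrite leq_add2l.
  - by rewrite inEE (cl_rep_block clD aQ') kQ'.
split=> [a b c d uQ aQ kQ|a b c d x y uQ aQ kQ].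
  have kQ' : ksum [:: a; b; c; d] = 0 by rewrite /= addr0 !addrA.
  have [|j [j0 ltj] e] := blk [:: a; b; c; d] (n - 2)%N uQ aQ kQ' isT (leqnn _).
    by clear -n2; rewrite /=; lia.
  have j1 : j = 1%N by clear -j0 ltj n2; lia.
  by move: e; rewrite j1 mulr1n => <-; rewrite /= addr0 !addrA.
move=> s; have es : s = vsum (ext0 (rep cl X)) [:: a; b; c; d; x; y].
  by rewrite /s /= addr0 !addrA.
rewrite es; have kQ' : ksum [:: a; b; c; d; x; y] = 0 by rewrite /= addr0 !addrA.
(* For n = 2 there is no room for n - 3 pairs, but then [E] consists of h and 2h = 0. *)
have [n3|n3] := ltnP 2 n.
  have [||j [j0 ltj] ->] := blk [:: a; b; c; d; x; y] (n - 3)%N uQ aQ kQ' isT.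
  - by clear; lia.
  - by clear -n3; rewrite /=; lia.
  have [->|->] : j = 1%N \/ j = 2%N by clear -j0 ltj n3; lia.
    by left.
  by right.
have [Q' [uQ' aQ' kQ'0 [_ _ _ <-]]] := nz_block (rep cl X) uQ aQ kQ' isT.
have en : n = 2%N by apply/eqP; rewrite eqn_leq n2 n3.
have EQ : vsum (rep cl X) Q' \in E.
  by rewrite -vsumE inEE (cl_rep_block clD aQ') kQ'0.
have [j ltj ->] := cyclic_genE clD cardE gh EQ; rewrite en in ltj.
case: j ltj => [|[|]] // _; [right|by left].
by rewrite mulr0n -en nE //; case: gh.
Qed.

(** With the point 0 the eight classes become nine. The exceptional one is 0, where 4 * 0 is not h,
    so 4y = h for all leftover y. Opening a pair x, x' gives a tenth point or, in the class of y, x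
    + y = x' + y = x + x' = h; then 2y = h and 4y = 2h. *)
Lemma eta_one P X : perm_eq S (fl P ++ X) -> sums P h -> size P = (n - 1)%N -> size X = 8%N ->
  uniq [seq cl x | x <- X] -> 0 \notin clset cl X ->
  all (fun p => (cl p.1 == cl p.2) && (cl p.1 != 0)) P -> False.
Proof.
move=> pS sP szP szX uX X0 aP.
have h0 : h != 0 by rewrite -[h]mulr1n; case: gh => _; apply; clear -n2; lia.
have szP2 : (n - 2 <= size P)%N by rewrite szP; clear; lia.
have pS0 : perm_eq S (fl P ++ X ++ [::]) by rewrite cats0.
have [pl b6] := one_planes pS0 sP szP2.
have c9 : (8 < #|(0%R : K4) |: clset cl X|)%N by rewrite card_ext // (card_clset uX) szX.
have [_ [q Hq]] := nine_points_value h0 c9 pl b6.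
have q0 : q = 0.
  apply/eqP/negPn/negP=> nq; case/negP: h0.
  rewrite -(tri_value pl (p := 0)); [by rewrite /ext0 eqxx mul0rn | by rewrite !inE eqxx |].
  by apply: Hq; rewrite ?inE ?eqxx // eq_sym.
have v4 c : c \in clset cl X -> rep cl X c *+ 4 = h.
  move=> Xc; have c0 : c != 0 by apply: contraNneq X0 => <-.
  have Yc : c \in 0 |: clset cl X by apply/setU1P; right.
  have := tri_value pl Yc (Hq c Yc _); rewrite q0 /ext0 (negPf c0); exact.
case: P pS sP szP aP {szP2 pS0 pl b6} => [|[x x'] P]; first by move=> _ _ /=; clear -n2; lia.
move=> pS /andP[/eqP /= ex sP] szP /andP[/andP[/eqP /= exx x0] _].
have szP2 : (n - 2 <= size P)%N by clear -szP; lia.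
have [Xx|nXx] := boolP (cl x \in clset cl X).
  have [Xy ey] := repP Xx; have y4 := v4 _ Xx; set y := rep cl X (cl x) in Xy ey y4.
  have blk z z' : perm_eq [:: x; x'] [:: z; z'] -> cl z = cl x -> z + y = h.
    move=> pz ez; have [||||||j [j0 ltj] e] := @one_block P (n - 2)%N [:: z; y] (z' :: rem y X).
    - apply: perm_trans pS _; rewrite fl_cons; apply/seq.permP=> f.
      move: (seq.permP pz f) (seq.permP (perm_to_rem Xy) f).
      by rewrite /= !count_cat /=; clear; clia.
    - by [].
    - exact: szP2.
    - by [].
    - by rewrite /=; clear -n2; lia.
    - by rewrite inEE /bsum big_cons big_seq1 (clxx clD) // ey.
    have j1 : j = 1%N by clear -j0 ltj n2; lia.
    by move: e; rewrite j1 /bsum big_cons big_seq1.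
  have e1 := blk x x' (perm_refl _) erefl.
  have e2 : x' + y = h.
    by apply: (blk x' x) => //; apply/seq.permP=> f /=; clear; clia.
  case/negP: h0; apply/eqP.
  lincomb (subE y4 (mulE 2 (subE (addE e1 e2) ex))).
have uX' : uniq [seq cl z | z <- x :: X] by rewrite /= uX andbT; move: nXx; rewrite inE.
have pS' : perm_eq S (fl P ++ (x :: X) ++ [:: x']).
  rewrite (perm_trans pS) // fl_cons; apply/seq.permP=> f.
  by rewrite /= !count_cat /= count_cat /=; clear; clia.
have [pl b6] := one_planes pS' sP szP2.
apply: (ten_points h0 _ pl b6).
have X'0 : 0 \notin clset cl (x :: X).
  by move: X0; rewrite !inE /= negb_or eq_sym x0.
by rewrite card_ext // (card_clset uX') /= szX.
Qed.

End One.

Hypothesis cyc : exists h, cyclic_gen cl n h.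

Lemma eta_three S : (2 <= n)%N -> size S = (2 * n + 6)%N -> noshort S -> False.
Proof.
move=> n2 szS nS; pose Z := [seq x <- S | cl x == 0]; pose S' := [seq x <- S | cl x != 0].
have pSZ : perm_eq S (Z ++ S') by rewrite perm_sym perm_filterC.
have [P [X [pS' aP uX]]] := pair_all S'.
have pS : perm_eq S (Z ++ fl P ++ X) by rewrite (perm_trans pSZ) // perm_cat2l.
have nz x : x \in fl P ++ X -> cl x != 0.
  by rewrite -(perm_mem pS') mem_filter => /andP[].
pose BR := [seq [:: z] | z <- Z] ++ [seq [:: p.1; p.2] | p <- P].
have fBR : flatten BR = Z ++ fl P by rewrite flatten_cat flatten_seq1.
have nBR : [::] \notin BR.
  by rewrite mem_cat negb_or; apply/andP; split; apply/mapP=> -[].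
pose R := map bsum BR; have szR : size R = (size Z + size P)%N.
  by rewrite size_map size_cat !size_map.
have RE : {subset R <= E}.
  move=> _ /mapP[B + ->]; rewrite mem_cat => /orP[] /mapP[z].
    by rewrite mem_filter => /andP[cz _] ->; rewrite /bsum big_seq1 inEE.
  by move=> /(allP aP)/eqP ez ->; rewrite /bsum big_cons big_seq1 inEE (clxx clD).
(* Otherwise n blocks of at most two terms would give a zero-sum free sequence of length n over
   [E]. *)
have ltR : (size R < n)%N.
  rewrite ltnNge; apply/negP=> leR.
  have szB : size (take n BR) = n by rewrite size_takel //; move: leR; rewrite size_map.
  have zB : zsf (map bsum (take n BR)).
    apply: (zsf_blocks (W := flatten (drop n BR) ++ X) nS).
    - by rewrite catA -flatten_cat cat_take_drop fBR -catA.
    - by apply: contra nBR; exact: mem_take.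
    have sB : {subset take n BR <= BR} by move=> B; exact: mem_take.
    suff : (size (flatten (take n BR)) <= 2 * size (take n BR))%N by rewrite szB.
    move: (take n BR) sB => BL; elim: BL => // B BL IH H; rewrite /= size_cat.
    have B2 : (size B <= 2)%N.
      by have := H B (mem_head _ _); rewrite mem_cat => /orP[] /mapP[z _ ->].
    have := IH (fun B' H' => H B' (mem_behead (s := B :: BL) H')).
    by move: B2; clear; clia.
  have := size_zsf eE0 eED _ zB; rewrite size_map szB cardE ltnn => H.
  suff: false by []; apply: H => x /mapP[B /mem_take BB ->]; apply: RE; exact: map_f.
(* [k] terms lie in [E] and [d] is the deficit; counting terms leaves 6 + 2d + k of them for [X], of
   which 2d + k fit within the length 2n. *)
have [k [d [ek d0 ed]]] : exists k d, [/\ size Z = k, (0 < d)%N & (size R + d = n)%N].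
  by exists (size Z), (n - size R)%N; split; rewrite ?subn_gt0 ?subnKC // ltnW.
have szX : size X = (6 + 2 * d + k)%N.
  have := perm_size pS; rewrite !size_cat size_fl szS -ed szR ek; clear; clia.
set C := clset cl X; have cC : #|C| = (6 + 2 * d + k)%N by rewrite (card_clset uX).
have C0 : 0 \notin C.
  rewrite inE; apply/mapP=> -[x Xx e]; have := nz x; rewrite -e eqxx mem_cat Xx orbT.
  by move/(_ isT).
have clphi c : c \in C -> cl (rep cl X c) = c by case/repP.
have C15 : (#|C| <= 15)%N.
  by have := max_card (mem ((0%R : K4) |: C)); rewrite card_ext // card_K4.
have gR : good R (2 * d + k) C (rep cl X).
  move=> Cs uC aC kC nC sz; have [W pW] := rep_block uC aC.
  have eW : flatten (map (map (rep cl X)) Cs) = map (rep cl X) (flatten Cs) by rewrite map_flatten.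
  have -> : R ++ map (vsum (rep cl X)) Cs = map bsum (BR ++ map (map (rep cl X)) Cs).
    by rewrite map_cat -map_comp; congr (_ ++ _); apply: eq_map => l /=; rewrite -vsumE.
  have eF := etrans (flatten_cat BR _) (congr2 cat fBR eW).
  apply: (zsf_blocks (W := W) nS); rewrite ?eF.
  - rewrite (perm_trans pS) //; apply/seq.permP=> f; have := seq.permP pW f.
    by rewrite !count_cat; clear; clia.
  - rewrite mem_cat negb_or nBR; apply/mapP=> -[[|c l] //= Cl].
    by rewrite Cl in nC.
  rewrite !size_cat size_map size_fl; move: sz; rewrite -ed szR ek; clear; clia.
have [le|lt] := leqP d k.
  apply: (good_many C0 clphi ed RE gR); [by clear -le; lia | by rewrite cC; clear -le; lia].
(* Only 15 nonzero classes exist, so 2d + k <= 9. *)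
have cases : d = 1%N /\ k = 0%N \/ d = 2%N \/ d = 3%N \/ d = 4%N /\ k = 0%N \/ d = 4%N /\ k = 1%N.
  have k9 : (2 * d + k <= 9)%N by move: C15; rewrite cC; clear; lia.
  move: d0 lt k9; clear; case: d => [|[|[|[|[|d]]]]] // _ lt k9.
  - by left; split=> //; move: lt; clear; lia.
  - by right; left.
  - by do 2 right; left.
  - case: k lt k9 => [|[|k]] _ k9; [by do 3 right; left|by do 4 right|by move: k9; clear; lia].
  by move: k9; clear; lia.
case: cases => [[d1 k0]|[d2|[d3|[[d4 k0]|[d4 k1]]]]].
- have Z0 : Z = [::] by apply/size0nil; rewrite ek.
  have zR : zsf R by have := gR [::]; rewrite cats0; apply.
  have eP : map bsum BR = [seq p.1 + p.2 | p <- P].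
    rewrite /BR Z0 /= -map_comp; apply: eq_map => p /=.
    by rewrite /bsum big_cons big_seq1.
  have [||h gh eh] := zsf_E zR RE; [by rewrite -ed d1 addn1 | by move: ed; rewrite d1; clear -n2; clia |].
  apply: (@eta_one S h nS gh n2 P X) => //.
  + by rewrite Z0 in pS.
  + apply/allP=> p Pp; apply/eqP/eh; rewrite /R eP; exact: map_f.
  + by move: ed; rewrite szR ek k0 d1; clear; clia.
  + by rewrite szX d1 k0.
  apply/allP=> p Pp; rewrite (allP aP) //= nz // mem_cat; apply/orP; left.
  by apply/flattenP; exists [:: p.1; p.2]; rewrite ?mem_head //; apply: map_f.
- rewrite d2 in ed gR cC; apply: (good_two C0 clphi ed RE gR); first by clear; lia.
  by rewrite cC; clear; lia.
- rewrite d3 in ed gR cC; apply: (good_three C0 clphi ed RE gR); first by clear; lia.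
  by rewrite cC; clear; lia.
- rewrite d4 k0 in ed gR cC; exact: (good_four C0 clphi ed RE gR cC cyc).
(* Moving one line to [R] leaves deficit 3, a budget of 9 - 3 terms and 15 - 3 classes, as required
   by [good_three]. *)
rewrite d4 k1 in ed gR cC.
have /card_gt0P[c Cc] : (0 < #|C|)%N by rewrite cC.
have c9 : (9 <= #|C|)%N by rewrite cC.
have [L /andP[/eqP sL /eqP kL] [uL aL _]] := line_through C0 (subxx C) Cc c9.
have nL : L <> [::] by move=> e; rewrite e in sL.
have leL : (size L <= 2 * 4 + 1)%N by rewrite sL.
have gR' := good_cons gR uL aL kL nL leL; rewrite sL in gR'.
have sC : C :\: [set c in L] \subset C by exact: subsetDl.
apply: (good_three _ _ _ _ gR').
- by apply: contra C0; exact: (subsetP sC).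
- by move=> x /(subsetP sC)/clphi.
- by rewrite size_cat /= -ed; clear; clia.
- by move=> x; rewrite mem_cat mem_seq1 => /orP[/RE //|/eqP->]; exact: (vsum_E clphi).
- by [].
have := cardsID [set c in L] C; rewrite (setIidPr _); last first.
  by apply/subsetP=> x; rewrite inE => /(allP aL).
by rewrite cardsE (card_uniqP uL) sL cC; clear; clia.
Qed.

End Eta.

(** * The groups of the theorem *)

Lemma subseq_search (G : finZmodType) (p : pred nat) (S : seq G) :
  (exists T, zero_sum_subseq S T /\ p (size T)) \/
  (forall T W, perm_eq (T ++ W) S -> p (size T) -> \sum_(x <- T) x != 0).
Proof.
have [/existsP[m /andP[/eqP e pm]]|] := boolP [exists m : (size S).-tuple bool,
    (\sum_(x <- mask m S) x == 0) && p (size (mask m S))].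
  by left; exists (mask m S); split=> //; split=> //; exact: mask_subseq.
rewrite negb_exists => /forallP H; right=> T W pTW pT; apply/negP=> /eqP T0.
have /count_subseqP[T' sT' pT'] : forall x, (count_mem x T <= count_mem x S)%N.
  by move=> x; rewrite -(seq.permP pTW) count_cat leq_addr.
have /subseqP[m szm eT'] := sT'; have := H (Tuple (introT eqP szm)).
by rewrite /= -eT' -(perm_big _ pT') /= T0 eqxx -(perm_size pT') pT.
Qed.

Lemma exp_of_dvd (G : finZmodType) m : (forall x : G, x *+ m = 0) -> (exp_of G %| m)%N.
Proof. by move=> H; apply/exponentP=> x _; rewrite FinRing.zmodXgE H. Qed.

Lemma mul_exp_of (G : finZmodType) (x : G) : x *+ exp_of G = 0.
Proof. by rewrite -FinRing.zmodXgE; apply: expg_exponent; rewrite inE. Qed.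

Section Concrete.
Variables (r n : nat).
Hypotheses (r3 : (r <= 3)%N) (n2 : (2 <= n)%N).
Local Notation G := ('rV['Z_2]_r * 'Z_(2 * n))%type.
Implicit Types (x y : G).

(* The class of (v, a) mod 2G; the bits beyond the rank r are set to false. *)
Definition bitv (v : 'rV['Z_2]_r) (i : nat) : bool :=
  if insub i is Some j then v 0 j != 0 else false.
Definition cls x : K4 := (bitv x.1 0, bitv x.1 1, bitv x.1 2, odd x.2).

Lemma two_n_gt1 : (1 < 2 * n)%N. Proof. by move: n2; clear; lia. Qed.

Lemma Z2_addb (a b : 'Z_2) : (a + b != 0) = (a != 0) (+) (b != 0).
Proof. by case: a b => [[|[|a]] ia] [[|[|b]] ib]. Qed.

Lemma bitvD v w i : bitv (v + w) i = bitv v i (+) bitv w i.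
Proof. by rewrite /bitv; case: insubP => // j _ _; rewrite mxE Z2_addb. Qed.

Lemma val_ZpD (a b : 'Z_(2 * n)) : nat_of_ord (a + b) = ((a + b) %% (2 * n))%N.
Proof. exact: (congr1 (fun m => (nat_of_ord a + nat_of_ord b) %% m)%N (Zp_cast two_n_gt1)). Qed.

Lemma clsD x y : cls (x + y) = cls x + cls y.
Proof.
have e : odd (x + y).2 = odd x.2 (+) odd y.2.
  by rewrite val_ZpD odd_mod ?oddM // oddD.
by rewrite /cls !bitvD e.
Qed.

Definition hh : G := (0, 2%:R).

Lemma hhE j : hh *+ j = (0, (2 * j)%:R).
Proof.
elim: j => [|j IHj]; first by rewrite muln0.
rewrite mulrS IHj; congr (_, _); first exact: addr0.
by rewrite mulnS natrD.
Qed.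

Lemma val_hh j : (j < n)%N -> nat_of_ord (hh *+ j).2 = (2 * j)%N.
Proof. by move=> ltj; rewrite hhE val_Zp_nat ?two_n_gt1 // modn_small // ltn_pmul2l. Qed.

Lemma clsE x : x \in E cls -> exists2 j, (j < n)%N & x = hh *+ j.
Proof.
rewrite inE => /eqP[v0 v1 v2 od].
have ev : nat_of_ord x.2 = (2 * (nat_of_ord x.2)./2)%N.
  by rewrite -[LHS]odd_double_half od; apply/esym/mul2n.
have lt : (nat_of_ord x.2 < 2 * n)%N := leq_trans (ltn_ord x.2) (eq_leq (Zp_cast two_n_gt1)).
exists ((nat_of_ord x.2)./2); first by rewrite -(ltn_pmul2l (m := 2)) // -ev.
rewrite hhE -ev natr_Zp; case: x v0 v1 v2 {od ev lt} => v a /= v0 v1 v2; congr (_, _).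
apply/rowP=> j; rewrite mxE; have ltj := leq_trans (ltn_ord j) r3.
have b0 : bitv v j = false by case: (nat_of_ord j) ltj => [|[|[|]]].
apply/eqP; move: b0; rewrite /bitv; case: insubP => [k _ ek|]; last by rewrite ltn_ord.
by rewrite (val_inj ek) => /negbFE.
Qed.

Lemma hhE0 j : hh *+ j \in E cls.
Proof.
have E1 : hh \in E cls.
  have b0 i : bitv 0 i = false by rewrite /bitv; case: insubP => // k _ _; rewrite mxE eqxx.
  have e2 : odd hh.2 = false.
    by rewrite [nat_of_ord _](val_Zp_nat two_n_gt1) odd_mod // oddM.
  by rewrite inE /cls !b0 e2.
exact: (EMn (E0 clsD) (@ED _ _ clsD)).
Qed.

Lemma cardEcls : #|E cls| = n.
Proof.
have -> : E cls = [set hh *+ (nat_of_ord j) | j : 'I_n].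
  apply/setP=> x; apply/idP/imsetP => [/clsE[j ltj ->]|[j _ ->]]; last exact: hhE0.
  by exists (Ordinal ltj).
rewrite card_imset ?card_ord // => i j e; apply: val_inj => /=.
have := congr1 (fun x => nat_of_ord x.2) e; rewrite !val_hh //; lia.
Qed.

Lemma nEcls x : x \in E cls -> x *+ n = 0.
Proof.
move=> /clsE[j _ ->]; rewrite mulrnAC hhE.
have -> : (2 * n)%:R = 0 :> 'Z_(2 * n) by apply: val_inj; rewrite /= (val_Zp_nat two_n_gt1) modnn.
exact: mul0rn.
Qed.

Lemma halve x : x \in E cls -> exists t, t + t = x.
Proof.
move=> /clsE[j _ ->]; exists (0, j%:R); rewrite hhE; congr (_, _); first exact: addr0.
by rewrite -natrD; apply: (congr1 (fun k => k%:R)); clear; lia.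
Qed.

Lemma cyc_cls : exists h, cyclic_gen cls n h.
Proof.
exists hh; split=> [|j /andP[j0 ltj]]; first exact: (hhE0 1).
apply/eqP=> e; have := val_hh ltj; rewrite e /=; lia.
Qed.

Lemma exp_G : exp_of G = (2 * n)%N.
Proof.
apply/eqP; rewrite eqn_dvd; apply/andP; split.
  apply: exp_of_dvd => x; rewrite mulrnA nEcls //.
  by rewrite inEE mulr2n (clxx clsD).
pose x : G := (0, 1); have e : x *+ exp_of G = 0 by exact: (@mul_exp_of G).
have xE j : x *+ j = (0, j%:R).
  elim: j => // j IHj; rewrite mulrS IHj; congr (_, _); first exact: addr0.
  by rewrite -[RHS]natr1 addrC.
have := congr1 (fun x => nat_of_ord x.2) e; rewrite xE val_Zp_nat ?two_n_gt1 //= => e0.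
by rewrite /dvdn e0.
Qed.

Lemma trim (P : seq G -> Prop) l : (forall S : seq G, size S = l -> exists T, P T /\ subseq T S) ->
  forall S : seq G, (l <= size S)%N -> exists T, P T /\ subseq T S.
Proof.
move=> H S le; have [|T [PT sT]] := H (take l S); first by rewrite size_takel.
by exists T; split=> //; apply: subseq_trans sT (take_subseq _ _).
Qed.

Lemma s_upper l : (forall S : seq G, size S = l -> nozs n S -> False) -> s_prop G l.
Proof.
move=> H S le; have [|T [[T0 szT] sT]] := @trim (fun T => \sum_(x <- T) x = 0 /\ size T = (2 * n)%N) l _ S le.
  move=> S' szS'; have [[T [[sT T0] /eqP szT]]|nz] := subseq_search (pred1 (2 * n)%N) S'.
    by exists T.
  by case: (H S' szS') => T W pTW szT; apply: nz pTW _; rewrite /= szT.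
by exists T; rewrite exp_G.
Qed.

Lemma eta_upper l : (forall S : seq G, size S = l -> noshort n S -> False) -> eta_prop G l.
Proof.
move=> H S le.
have [|T [[T0 szT] sT]] := @trim (fun T => \sum_(x <- T) x = 0 /\ (1 <= size T <= 2 * n)%N) l _ S le.
  move=> S' szS'; have [[T [[sT T0] szT]]|nz] := subseq_search (fun k => 1 <= k <= 2 * n)%N S'.
    by exists T.
  case: (H S' szS') => T W pTW T0 szT; apply: nz pTW _; rewrite szT andbT.
  by case: (T) T0.
by exists T; rewrite exp_G.
Qed.

Lemma subseq_catP (T : eqType) (s A B : seq T) : subseq s (A ++ B) ->
  exists s1 s2, [/\ s = s1 ++ s2, subseq s1 A & subseq s2 B].
Proof.
move=> /subseqP[m szm ->]; exists (mask (take (size A) m) A), (mask (drop (size A) m) B).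
rewrite !mask_subseq -mask_cat ?cat_take_drop //.
by rewrite size_takel // szm size_cat leq_addr.
Qed.

Lemma subseq_nseq (T : eqType) (s : seq T) k a : subseq s (nseq k a) ->
  exists2 j, (j <= k)%N & s = nseq j a.
Proof.
move=> sub; exists (size s); first by have := size_subseq sub; rewrite size_nseq.
by apply/all_pred1P/allP=> x /(mem_subseq sub); rewrite mem_nseq => /andP[].
Qed.

Lemma sum_zeros k : \sum_(x <- nseq k (0 : G)) x = 0.
Proof. by rewrite big1_seq // => x /andP[_]; rewrite mem_nseq => /andP[_ /eqP]. Qed.

(** The 2n - 1 zeros cannot fill 2n places, so a nonempty part of [S] with the same sum is left. *)
Lemma zeros_subseq (S T : seq G) : subseq T (nseq (2 * n - 1) 0 ++ S) -> \sum_(x <- T) x = 0 ->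
  size T = (2 * n)%N -> exists T', [/\ subseq T' S, \sum_(x <- T') x = 0 & (1 <= size T' <= 2 * n)%N].
Proof.
move=> /subseq_catP[s1 [s2 [-> /subseq_nseq[j lej ->] s2S]]].
rewrite big_cat /= sum_zeros add0r size_cat size_nseq => e0 sz; exists s2; split=> //.
by move: sz lej n2; clear; clia.
Qed.

Lemma eta_of_s l : s_prop G (2 * n - 1 + l) -> eta_prop G l.
Proof.
move=> H S le; have [|T [[sT T0] szT]] := H (nseq (2 * n - 1) 0 ++ S).
  by rewrite size_cat size_nseq leq_add2l.
rewrite exp_G in szT; have [T' [sT' T'0 szT']] := zeros_subseq sT T0 szT.
by exists T'; rewrite exp_G.
Qed.

Lemma s_upper_three : (36 <= n)%N -> s_prop G (4 * n + 5).
Proof. by move=> n36; apply: s_upper => S; exact: (s_three clsD cardEcls nEcls halve n36). Qed.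

Lemma eta_upper_three : eta_prop G (2 * n + 6).
Proof. by apply: eta_upper => S; exact: (eta_three clsD cardEcls nEcls cyc_cls n2). Qed.

(** For r <= 2 the third bit of every class vanishes, so the classes lie in a subgroup of order
    8. *)
Lemma s_upper_two : (r <= 2)%N -> s_prop G (4 * n + 3).
Proof.
move=> r2; pose H := [set c : K4 | ~~ c.1.2].
have HD : {in H &, forall c d, c + d \in H}.
  by move=> [[[a b] c] d] [[[a' b'] c'] d']; rewrite !inE /=; case: c c' => [] [].
have cH : #|H| = 8%N by rewrite card_kl.
apply: s_upper => S; apply: (s_two clsD cardEcls nEcls halve n2 HD cH) => x.
rewrite inE /cls /= /bitv; case: insubP => // j lt2.
by have := leq_trans lt2 r2.
Qed.

(** * Extremal sequences and the lower bounds *)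

Definition one_at (a : 'Z_(2 * n)) (i : 'I_r) : G := (delta_mx 0 i, a).
Definition extremal : seq G :=
  nseq (2 * n - 1) (0, 1) ++ [seq one_at 1 i | i <- enum 'I_r] ++ [seq one_at 0 i | i <- enum 'I_r].

Lemma size_extremal : size extremal = (2 * n - 1 + 2 * r)%N.
Proof. by rewrite !size_cat size_nseq 2!size_map size_enum_ord addnn -mul2n. Qed.

Lemma fst_sum (s : seq G) i : (\sum_(x <- s) x).1 0 i = \sum_(x <- s) x.1 0 i.
Proof. by elim: s => [|x s IH]; rewrite ?big_nil ?mxE // !big_cons -IH mxE. Qed.

Lemma snd_sum (s : seq G) : (\sum_(x <- s) x).2 = \sum_(x <- s) x.2.
Proof. by elim: s => [|x s IH]; rewrite ?big_nil // !big_cons -IH. Qed.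

Lemma one_at_fst a (I : seq 'I_r) i : uniq I ->
  \sum_(x <- [seq one_at a j | j <- I]) x.1 0 i = (i \in I)%:R.
Proof.
rewrite big_map; elim: I => [|j I IH] /=; first by rewrite big_nil.
move=> /andP[nj uI]; rewrite big_cons (IH uI) mxE eqxx inE /=.
by case: eqVneq => [->|_] /=; rewrite ?add0r // (negPf nj) addr0.
Qed.

Lemma one_at_snd a (I : seq 'I_r) : \sum_(x <- [seq one_at a j | j <- I]) x.2 = a *+ size I.
Proof. by rewrite big_map; elim: I => [|j I IH]; rewrite ?big_nil // big_cons IH -mulrS. Qed.

(** The first component forces the same indices in both families, so I = J. The second makes a + |I|
    a positive multiple of 2n, against a < 2n and a + 2|I| <= 2n. *)
Lemma extremal_short (T : seq G) : subseq T extremal -> \sum_(x <- T) x = 0 -> (1 <= size T <= 2 * n)%N -> False.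
Proof.
move=> /subseq_catP[s1 [s2 [-> /subseq_nseq[a lea ->]]]].
move=> /subseq_catP[t1 [t2 [-> /subseqP[m1 _ ->] /subseqP[m2 _ ->]]]].
rewrite -(map_mask (one_at 1)) -(map_mask (one_at 0)).
set I := mask m1 (enum 'I_r); set J := mask m2 (enum 'I_r).
have uI : uniq I by apply: mask_uniq; exact: enum_uniq.
have uJ : uniq J by apply: mask_uniq; exact: enum_uniq.
move=> e0; have IJ : I =i J.
  move=> i; have := congr1 (fun x : G => x.1 0 i) e0.
  rewrite fst_sum !big_cat /= !one_at_fst // [X in X + _]big1_seq; last first.
    by move=> x /andP[_]; rewrite mem_nseq => /andP[_ /eqP->]; rewrite mxE.
  by rewrite add0r mxE; case: (i \in I); case: (i \in J).
have szIJ : size I = size J by apply/esym/eqP; rewrite -(uniq_size_uniq uI IJ).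
have e2 : (a + size I)%:R = 0 :> 'Z_(2 * n).
  have := congr1 snd e0; rewrite snd_sum !big_cat !one_at_snd mul0rn /= => e2.
  by rewrite natrD -[RHS]e2 big_nseq iter_addr_0 addr0.
have := congr1 (@nat_of_ord _) e2; rewrite (val_Zp_nat two_n_gt1) => /eqP dv.
rewrite !size_cat size_nseq 2!size_map -szIJ => sz.
have dv' : (2 * n %| a + size I)%N by [].
move: (size I) sz dv' lea => k sz dv' lea.
have [|] := posnP (a + k); first by move: sz; clear; lia.
by move/dvdn_leq => /(_ _ dv'); move: sz lea n2; clear; lia.
Qed.

Lemma eta_lower m : eta_prop G m -> (2 * n + 2 * r <= m)%N.
Proof.
move=> H; rewrite leqNgt; apply/negP=> lt.
have [|T [[sT T0]]] := H extremal; first by rewrite size_extremal; move: lt n2; clear; lia.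
by rewrite exp_G; exact: extremal_short sT T0.
Qed.

Lemma s_lower m : s_prop G m -> (4 * n - 1 + 2 * r <= m)%N.
Proof.
move=> H; rewrite leqNgt; apply/negP=> lt.
have [|T [[sT T0]]] := H (nseq (2 * n - 1) 0 ++ extremal).
  by rewrite size_cat size_nseq size_extremal; move: lt n2; clear; lia.
rewrite exp_G => szT; have [T' [sT' T'0 szT']] := zeros_subseq sT T0 szT.
exact: extremal_short sT' T'0 szT'.
Qed.

End Concrete.

Theorem theorem1p2 (n : nat) (hn : (2 <= n)%N) :
  (eta_const ('rV['Z_2]_2 * 'Z_(2 * n))%type (2 * n + 4)%N /\
   s_const ('rV['Z_2]_2 * 'Z_(2 * n))%type (4 * n + 3)%N) /\
  (eta_const ('rV['Z_2]_3 * 'Z_(2 * n))%type (2 * n + 6)%N /\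
   ((36 <= n)%N -> s_const ('rV['Z_2]_3 * 'Z_(2 * n))%type (4 * n + 5)%N)).
Proof.
have least (Q : nat -> Prop) l : (0 < l)%N -> Q l -> (forall m, Q m -> (l <= m)%N) ->
    smallest_pos Q l by move=> l0 Ql H; split=> // m _; exact: H.
have s2 := @s_upper_two 2 n isT hn isT.
split; split.
- apply: least; first by rewrite addn_gt0 orbT.
    apply: (@eta_of_s 2 n isT hn); rewrite (_ : (_ + _ = 4 * n + 3)%N) //.
    by move: hn; clear; lia.
  by move=> m /(@eta_lower 2 n isT hn).
- apply: least => //; first by rewrite addn_gt0 orbT.
  by move=> m /(@s_lower 2 n isT hn); apply: leq_trans; move: hn; clear; lia.
- apply: least; first by rewrite addn_gt0 orbT.
    exact: (@eta_upper_three 3 n isT hn).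
  by move=> m /(@eta_lower 3 n isT hn).
move=> n36; apply: least; first by rewrite addn_gt0 orbT.
  exact: (@s_upper_three 3 n isT hn n36).
by move=> m /(@s_lower 3 n isT hn); apply: leq_trans; move: hn; clear; lia.
Qed.
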